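(* Let $\nu\in\mathcal P_2(\mathbb R)$ be such that $\operatorname{supp}\nu=[a,b]$ and $\mathrm{Lip}(Q_\nu)<\infty$. Consider an initial value $g_0=Q_{\mu_0}\in\mathcal C(0,1)$ with convex support $\operatorname{supp}\mu_0\subseteq[a,b]$ and $\mathrm{Lip}(g_0)<\infty$. Then the strong solution $g\colon[0,\infty)\to\mathcal C(0,1)$ of the Cauchy problem $\partial_t g(t)\in-\partial F_\nu(g(t))$, $t\in(0,\infty)$, $g(0)=Q_{\mu_0}$, fulfills for all $t>0$ $$\mathrm{Lip}(g(t)) \le \mathrm{Lip}(g_0)\cdot e^{-\frac{2t}{\mathrm{Lip}(Q_\nu)}}+\mathrm{Lip}(Q_\nu)\cdot\Big(1-e^{-\frac{2t}{\mathrm{Lip}(Q_\nu)}}\Big)<\infty.$$ In particular, the cumulative distribution function $R_{\gamma_t}^+$ of the associated Wasserstein gradient flow $\gamma_t:=(g(t))_\#\Lambda_{(0,1)}$ admits a lower Lipschitz constant on $\overline{(R_{\gamma_t}^+)^{-1}(0,1)}$ for all $t>0$, and $$L_{\rm low}(R_{\gamma_t}^+)\ge\Big(\mathrm{Lip}(g_0)\cdot e^{-\frac{2t}{\mathrm{Lip}(Q_\nu)}}+\mathrm{Lip}(Q_\nu)\cdot\Big(1-e^{-\frac{2t}{\mathrm{Lip}(Q_\nu)}}\Big)\Big)^{-1}>0.$$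
   Context: $\mathcal P_2(\mathbb R)$ is the set of Borel probability measures on $\mathbb R$ with finite second moment; $\Lambda_{(0,1)}$ is Lebesgue measure on $(0,1)$ and $T_\#\mu=\mu\circ T^{-1}$. For a probability measure $\mu$ on $\mathbb R$: $R_\mu^+(x) := \mu((-\infty,x])$ and $Q_\mu(s) := \min\{x \in \mathbb R : R_\mu^+(x) \ge s\}$, $s\in(0,1)$. $\mathcal C(0,1) := \{ f \in L_2(0,1) : f \text{ is non-decreasing (a.e.)}\}$ is the set of (classes of) quantile functions of measures in $\mathcal P_2(\mathbb R)$; each element is identified with its unique left-continuous non-decreasing representative. The smallest Lipschitz constant of $Q_\mu\in\mathcal C(0,1)$ is $$\mathrm{Lip}(Q_\mu) := \min\Big\{L\ge0 : \frac{Q_\mu(s_1)-Q_\mu(s_2)}{s_1-s_2}\le L \text{ for all } s_1\ne s_2\in(0,1)\Big\}\in[0,\infty].$$ $L_{\rm low}(R_{\gamma_t}^+)$ is the largest $L\in[0,\infty]$ such that $\frac{R_{\gamma_t}^+(x)-R_{\gamma_t}^+(y)}{x-y}\ge L$ for all $x\ne y$ in $\overline{(R_{\gamma_t}^+)^{-1}(0,1)}$ (being $\infty$ if there are no such pairs). In the degenerate case $\mathrm{Lip}(Q_\nu)=0$ one reads $e^{-2t/0}=0$ and $0^{-1}=\infty$. $F_\nu\colon L_2(0,1)\to\mathbb R$, $F_\nu(u) = \int_0^1 \big( (1-2s)\,u(s) + \int_0^1 |u(s)-Q_\nu(t)|\,dt \big) ds$, with subdifferential $\partial F(u) := \{ v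 \in L_2(0,1) : F(w) \ge F(u) + \langle v, w-u\rangle + o(\|w-u\|) \text{ for all } w \}$ (for convex $F$ the $o$-term can be omitted). A strong solution of the Cauchy problem is a function $g \in W^1_1((0,T];L_2(0,1)) \cap C([0,\infty);L_2(0,1))$ for every $T>0$, satisfying the initial condition and, for a.e. $t>0$, the inclusion, with $\partial_t g(t)$ the strong derivative; it exists, is unique, and takes values in $\mathcal C(0,1)$. *)

(* Defs.v *)
From HB Require Import structures.
From mathcomp Require Import all_boot all_order all_algebra.
From mathcomp Require Import all_classical all_reals all_analysis.

Set Implicit Arguments.
Unset Strict Implicit.
Unset Printing Implicit Defensive.

Import Order.TTheory GRing.Theory Num.Theory.
Import numFieldNormedType.Exports.

Local Open Scope classical_set_scope.
Local Open Scope ring_scope.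

Section measures_on_the_line.
Context {R : realType}.
Implicit Types (mu : probability (measurableTypeR R) R) (q : R -> R).

Definition P2 : set (probability (measurableTypeR R) R) :=
  [set mu | (\int[mu]_x ((x : R) ^+ 2)%:E < +oo)%E].

Definition supp mu : set R :=
  [set x | forall U : set R, open U -> U x -> (0 < mu U)%E].

Definition Rplus (m : set R -> \bar R) (x : R) : R := fine (m `]-oo, x]%classic).

(* For 0 < s < 1 the infimum is a minimum, since [Rplus mu] is
   right-continuous; for other [s] the value is irrelevant. *)
Definition quantile mu (s : R) : R := inf [set x : R | s <= Rplus mu x].

Definition slope q (x y : R) : R := (q x - q y) / (x - y).

(* The infimum in [0, +oo] is attained, so this is the smallest constant. *)
Definition Lip q : \bar R :=
  ereal_inf [set L : \bar R | (0 <= L)%E /\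
    forall s1 s2 : R, 0 < s1 < 1 -> 0 < s2 < 1 -> s1 != s2 ->
      ((slope q s1 s2)%:E <= L)%E].

(* Likewise attained, and +oo when the closure has at most one point. *)
Definition L_low (f : R -> R) : \bar R :=
  ereal_sup [set L : \bar R | (0 <= L)%E /\
    forall x y : R,
      closure (f @^-1` `]0, 1[%classic) x -> closure (f @^-1` `]0, 1[%classic) y -> x != y ->
      (L <= (slope f x y)%:E)%E].

End measures_on_the_line.

Definition Leb01 {R : realType} : {measure set (measurableTypeR R) -> \bar R} :=
  mrestr (@lebesgue_measure R)
    (measurable_itv `]0, 1[ : measurable (`]0, 1[%classic : set R)).

(* Elements are square-integrable functions rather than classes; all the
   notions below depend only on the class modulo equality a.e. on (0, 1). *)
Notation L2 R := (LfunType (@Leb01 R) (lee1n 2)).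

Section L2_of_the_unit_interval.
Context {R : realType}.

Definition inner (u v : L2 R) : R :=
  \int[lebesgue_measure]_(s in `]0, 1[) (u s * v s).

Definition nrm (u : L2 R) : R := fine ('N[Leb01]_2%:E[EFin \o u])%E.

Definition nondecreasing01 (q : R -> R) : Prop :=
  {in `]0, 1[ &, {homo q : x y / x <= y}}.

Definition quantile_cone : set (L2 R) :=
  [set u | exists q, nondecreasing01 q /\ {ae Leb01, forall s, u s = q s}].

Definition lc_representative (u : L2 R) (q : R -> R) : Prop :=
  [/\ nondecreasing01 q,
      (forall s, 0 < s < 1 -> q x @[x --> s^'-] --> q s)
    & {ae Leb01, forall s, u s = q s}].

(* On (0, 1) this is the unique left-continuous non-decreasing representative
   of [u] if [u] is in [quantile_cone]; otherwise it is a dummy value. *)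
Definition lc (u : L2 R) : R -> R := xget (cst 0) [set q | lc_representative u q].

End L2_of_the_unit_interval.

Section Bochner_Sobolev.
Context {R : realType}.
Local Notation leb := (@lebesgue_measure R).

Record simple_fun := SimpleFun {
  sf_size : nat ;
  sf_set : 'I_sf_size -> set R ;
  sf_val : 'I_sf_size -> L2 R ;
  sf_measurable : forall i,
    measurable (sf_set i : set (measurableTypeR R)) }.

Definition sf_eval (f : simple_fun) (t : R) : L2 R :=
  \sum_(i < sf_size f) \1_(sf_set i) t *: sf_val i.

(* Meant for [D] of finite measure. *)
Definition sf_integral (D : set R) (f : simple_fun) : L2 R :=
  \sum_(i < sf_size f) fine (leb (D `&` sf_set i)) *: sf_val i.

Definition Bochner_integral (D : set R) (v : R -> L2 R) (I : L2 R) : Prop :=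
  exists f : nat -> simple_fun,
  [/\ {ae leb, forall t, D t -> nrm (sf_eval (f n) t - v t) @[n --> \oo] --> 0},
      (\int[leb]_(t in D) (nrm (sf_eval (f n) t - v t))%:E @[n --> \oo] --> 0)%E
    & nrm (sf_integral D (f n) - I) @[n --> \oo] --> 0].

Definition L1 (D : set R) (v : R -> L2 R) : Prop :=
  exists I, Bochner_integral D v I.

Definition test_function (D : set R) (phi : R -> R) : Prop :=
  [/\ (forall n x, derivable (derive1n n phi) x 1),
      compact (closure [set x | phi x != 0])
    & closure [set x | phi x != 0] `<=` D].

Definition weak_derivative (D : set R) (g v : R -> L2 R) : Prop :=
  forall phi, test_function D phi ->
  exists I, Bochner_integral D (fun t => derive1 phi t *: g t) I /\
            Bochner_integral D (fun t => phi t *: v t) (- I).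

(* W^1_1((0,T]; L_2(0,1)): the derivative need only be integrable away
   from 0, whence the half-open interval in the notation. *)
Definition W11 (T : R) (g : R -> L2 R) : Prop :=
  L1 `]0, T[ g /\
  forall delta, 0 < delta < T ->
  exists v, L1 `]delta, T[ v /\ weak_derivative `]delta, T[ g v.

Definition continuous_on_nonneg (g : R -> L2 R) : Prop :=
  forall t, 0 <= t ->
    nrm (g s - g t) @[s --> within [set s | 0 <= s] (nbhs t)] --> 0.

Definition strong_derivative (g : R -> L2 R) (t : R) (d : L2 R) : Prop :=
  nrm (h^-1 *: (g (t + h) - g t) - d) @[h --> 0^'] --> 0.

End Bochner_Sobolev.

Section Cauchy_problem.
Context {R : realType}.

Definition F (nu : probability (measurableTypeR R) R) (u : L2 R) : R :=
  \int[lebesgue_measure]_(s in `]0, 1[)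
    ((1 - 2 * s) * u s +
     \int[lebesgue_measure]_(t in `]0, 1[) `|u s - quantile nu t|).

Definition subdifferential (G : L2 R -> R) (u : L2 R) : set (L2 R) :=
  [set v | forall eps : R, 0 < eps -> exists2 delta : R, 0 < delta &
    forall w : L2 R, nrm (w - u) <= delta ->
      G u + inner v (w - u) - eps * nrm (w - u) <= G w].

(* Only the restriction of [g] to [0, +oo) matters. *)
Definition strong_solution (G : L2 R -> R) (q0 : R -> R) (g : R -> L2 R) :
    Prop :=
  [/\ (forall T, 0 < T -> W11 T g),
      continuous_on_nonneg g,
      {ae Leb01, forall s, g 0 s = q0 s}
    & {ae lebesgue_measure, forall t : R, 0 < t ->
        exists d, strong_derivative g t d /\ subdifferential G (g t) (- d)}].

(* [inve 0 = +oo] and [expeR -oo = 0], so that this is 0 when L = 0 < t. *)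
Definition decay (L : \bar R) (t : R) : \bar R :=
  expeR (- (2 * t)%:E / L)%E.

Definition Lip_bound (L0 L : \bar R) (t : R) : \bar R :=
  (L0 * decay L t + L * (1 - decay L t))%E.

(* The distribution function of the push-forward of [Leb01] by [u]. *)
Definition flow_cdf (u : L2 R) : R -> R :=
  Rplus (pushforward Leb01 (u : R -> measurableTypeR R)).

End Cauchy_problem.

(* Main.v *)
Require Import Defs.
From mathcomp Require Import all_boot all_order all_algebra.
From mathcomp Require Import all_classical all_reals all_analysis.
From mathcomp Require Import measurable_realfun ring lra.
Set Implicit Arguments.
Unset Strict Implicit.
Unset Printing Implicit Defensive.
Import Order.TTheory GRing.Theory Num.Theory.
Import numFieldNormedType.Exports.
Local Open Scope classical_set_scope.
Local Open Scope ring_scope.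



(** Write [Q] for the quantile function of [nu], and [p x] for the integral over
    (0, 1) of [|x - Q|]. The energy of [u] is the integral of
    [(1 - 2 s) u s + p (u s)], so the gradient flow decouples: at almost every
    time the velocity [d] of [g] satisfies [d s = 2 s - 1 - eta s], where [eta s]
    is a subgradient of the convex function [p] at [g t s]
    ([pointwise_subdifferential], [velocity_subgradient]). A difference quotient
    of [p] counts the mass of [Q] on either side, so subgradients [eta] at [x]
    and [zeta] at [y < x] differ by at least twice the measure of the set where
    [Q] takes values between [y] and [x]. If [Q] has Lipschitz constant [L] and
    range dense in [[a, b]] this measure is at least [(x - y) / L] for [x], [y]
    in [[a, b]] ([subgradient_strong_mono]).

    Comparing the velocities at [s] and [s + h] yields all the estimates. The
    velocity points inwards outside [[a, b]], so [a <= g <= b] persists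
    ([flow_le], [flow_ge]); [eta] is monotone in [g], so monotonicity in [s]
    persists ([flow_mono]); and the increment [w = g t (s + h) - g t s] has
    velocity at most [2 h - (2 / L) w], so by comparison with the solution of
    this linear equation it stays below [h] times
    [L + (L0 - L) exp (- 2 t / L)] ([flow_lip]). When [L = 0] the measure [nu]
    is a Dirac mass, [a = b], and [g] is constant.

    A solution is only a curve in L2, so these comparisons are made through the
    squared norm of the positive part of the quantity to be kept nonpositive
    ([barrier], [constraint_propagates]). Its one-sided derivative is nonpositive
    at almost every time, and this suffices because it is absolutely continuous
    in time. Absolute continuity comes from the weak derivative, tested against
    smooth functions close to the indicator of an interval ([W11_abs_cont]); the
    passage from the almost everywhere derivative to monotonicity is
    [ae_nonincreasing].

    The conclusions hold for almost every [s], for each [h] separately.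
    Lebesgue points turn them into inequalities between the values of [g t] on
    one set of full measure ([ae_increment]), hence into a Lipschitz
    non-decreasing representative [q] ([flow_representative]). The lower bound
    on the slope of the distribution function is the same counting argument
    applied to [q] in place of [Q] ([flow_cdf_lower_slope]). *)

(** * The Hilbert space L2(0,1) *)

Section L2_structure.
Context {R : realType}.
Local Notation leb := (@lebesgue_measure R).
Local Notation I01 := (`]0%R, 1%R[%classic : set (measurableTypeR R)).
Implicit Types (u v w : L2 R).

Lemma measurable_oo01 : measurable I01.
Proof. exact: measurable_itv. Qed.

Lemma leb_oo01 : leb `]0, 1[%classic = 1%E.
Proof. by rewrite lebesgue_measure_itv/= lte01 oppr0 adde0. Qed.

Lemma Leb01_setC : (@Leb01 R) (~` I01) = 0%E.
Proof. by rewrite /Leb01/= /mrestr setICl measure0. Qed.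

Lemma ge0_integral_Leb01 (f : measurableTypeR R -> \bar R) :
  measurable_fun setT f -> (forall x, 0 <= f x)%E ->
  (\int[Leb01]_x f x = \int[leb]_(x in `]0%R, 1%R[) f x)%E.
Proof.
move=> mf f0.
rewrite (@ge0_negligible_integral _ _ _ _ _ (~` I01))//.
- rewrite setDE setCK setTI; apply: eq_measure_integral => A mA AD.
  by rewrite /Leb01/= /mrestr setIidl.
- exact: measurableC.
- exact: Leb01_setC.
Qed.

Lemma integrable_Leb01 (f : measurableTypeR R -> \bar R) :
  (@Leb01 R).-integrable setT f -> leb.-integrable I01 f.
Proof.
move=> /integrableP[mf foo]; apply/integrableP; split.
  exact: measurable_funS mf.
by rewrite -ge0_integral_Leb01//; exact: measurableT_comp.
Qed.

Lemma ae_Leb01 (P : measurableTypeR R -> Prop) :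
  {ae @Leb01 R, forall s, P s} <-> {ae leb, forall s, 0 < s < 1 -> P s}.
Proof.
split=> -[N [mN N0 PN]].
- exists (N `&` I01); split.
  + exact: measurableI.
  + by move: N0; rewrite /Leb01/= /mrestr.
  + move=> s /= /not_implyP[s01 Ps]; split; last by rewrite in_itv.
    exact: PN.
- exists (N `|` ~` I01); split.
  + by apply: measurableU => //; exact: measurableC.
  + apply/eqP; rewrite -measure_le0/= /Leb01/= /mrestr setIUl setICl setU0.
    rewrite -N0 le_measure ?inE//; first exact: measurableI.
  + move=> s /= Ps; have [s01|s01] := boolP (0 < s < 1).
      by left; apply: PN => /=; tauto.
    by right; rewrite /= in_itv/=; exact/negP.
Qed.

Lemma ae_imp (P Q : measurableTypeR R -> Prop) : (forall s, P s -> Q s) ->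
  {ae leb, forall s, P s} -> {ae leb, forall s, Q s}.
Proof. exact: (@filterS _ _ (ae_filter_ringOfSetsType leb)). Qed.

Lemma ae_and (P Q : measurableTypeR R -> Prop) :
  {ae leb, forall s, P s} -> {ae leb, forall s, Q s} ->
  {ae leb, forall s, P s /\ Q s}.
Proof. exact: (@filterI _ _ (ae_filter_ringOfSetsType leb)). Qed.

Lemma L2_measurable u : measurable_fun (setT : set (measurableTypeR R)) (u : R -> R).
Proof. exact: measurable_funPT. Qed.

Lemma L2_measurable_on (D : set (measurableTypeR R)) u : measurable_fun D (u : R -> R).
Proof. exact: measurable_funS (L2_measurable u). Qed.

Lemma L2_addE u v s : (u + v) s = u s + v s. Proof. by []. Qed.
Lemma L2_oppE u s : (- u) s = - u s. Proof. by []. Qed.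
Lemma L2_scaleE k u s : (k *: u) s = k * u s. Proof. by []. Qed.
Definition L2E := (L2_addE, L2_oppE, L2_scaleE).

Lemma inner_integrable u v : leb.-integrable I01 (EFin \o (u \* v)).
Proof.
apply: integrable_Leb01; apply/Lfun1_integrable.
by apply: Lfun2_mul_Lfun1; exact: LfunP.
Qed.

Lemma innerDl u v w : inner (u + v) w = inner u w + inner v w.
Proof.
rewrite /inner -RintegralD//; [|exact: inner_integrable..].
by apply: eq_Rintegral => s _ /=; rewrite mulrDl.
Qed.

Lemma innerZl k u v : inner (k *: u) v = k * inner u v.
Proof.
rewrite /inner -RintegralZl//; last exact: inner_integrable.
by apply: eq_Rintegral => s _ /=; rewrite /GRing.scale/= mulrA.
Qed.

Lemma innerC u v : inner u v = inner v u.
Proof. by apply: eq_Rintegral => s _ /=; rewrite mulrC. Qed.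

Lemma innerDr u v w : inner w (u + v) = inner w u + inner w v.
Proof. by rewrite innerC innerDl ![inner _ w]innerC. Qed.

Lemma innerZr k u v : inner u (k *: v) = k * inner u v.
Proof. by rewrite innerC innerZl innerC. Qed.

Lemma innerNl u v : inner (- u) v = - inner u v.
Proof. by rewrite -scaleN1r innerZl mulN1r. Qed.

Lemma innerNr u v : inner u (- v) = - inner u v.
Proof. by rewrite innerC innerNl innerC. Qed.

Lemma innerBl u v w : inner (u - v) w = inner u w - inner v w.
Proof. by rewrite innerDl innerNl. Qed.

Lemma innerBr u v w : inner w (u - v) = inner w u - inner w v.
Proof. by rewrite innerDr innerNr. Qed.

Lemma inner0l u : inner 0 u = 0.
Proof. by rewrite -(scale0r 0) innerZl mul0r. Qed.

Lemma inner_suml (I : Type) (r : seq I) (x : I -> L2 R) u :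
  inner (\sum_(i <- r) x i) u = \sum_(i <- r) inner (x i) u.
Proof.
elim: r => [|i r IH]; first by rewrite !big_nil inner0l.
by rewrite !big_cons innerDl IH.
Qed.

Lemma inner_ge0 u : 0 <= inner u u.
Proof. by apply: Rintegral_ge0 => s _; rewrite -expr2 sqr_ge0. Qed.

Lemma nrm_ge0 u : 0 <= nrm u.
Proof. by rewrite fine_ge0// Lnorm_ge0. Qed.

Lemma nrm_sqr u : nrm u ^+ 2 = inner u u.
Proof.
have E : ((nrm u)%:E = 'N[Leb01]_2%:E[EFin \o u])%E by rewrite finite_norm_fine.
apply/EFin_inj; rewrite -powR_mulrn ?nrm_ge0// -poweR_EFin E powR_Lnorm//.
under eq_integral do rewrite abse_EFin poweR_EFin powR_mulrn// real_normK ?num_real//.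
rewrite ge0_integral_Leb01.
- rewrite /inner /Rintegral fineK.
    by apply: eq_integral => s _; rewrite expr2.
  exact: integrable_fin_num (inner_integrable u u).
- by apply/measurable_EFinP; apply: measurable_funX; exact: L2_measurable.
- by move=> x; rewrite lee_fin sqr_ge0.
Qed.

Lemma nrm_eq_sqrt u : nrm u = Num.sqrt (inner u u).
Proof. by rewrite -nrm_sqr sqrtr_sqr ger0_norm// nrm_ge0. Qed.

Lemma nrm_le u c : 0 <= c -> inner u u <= c ^+ 2 -> nrm u <= c.
Proof.
by move=> c0; rewrite -nrm_sqr ler_sqr ?nnegrE ?nrm_ge0.
Qed.

Lemma nrmZ k u : nrm (k *: u) = `|k| * nrm u.
Proof.
by rewrite !nrm_eq_sqrt innerZl innerZr mulrA -expr2 sqrtrM ?sqr_ge0// sqrtr_sqr.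
Qed.

Lemma nrmN u : nrm (- u) = nrm u.
Proof. by rewrite -scaleN1r nrmZ normrN1 mul1r. Qed.

Lemma nrmBC u v : nrm (u - v) = nrm (v - u).
Proof. by rewrite -nrmN opprB. Qed.

Lemma nrm0 : nrm (0 : L2 R) = 0.
Proof. by rewrite -(scale0r 0) nrmZ normr0 mul0r. Qed.

Lemma cauchy_schwarz u v : `|inner u v| <= nrm u * nrm v.
Proof.
have key (x y : L2 R) : inner x y <= nrm x * nrm y.
  have [x0|x0] := eqVneq (nrm x) 0; last first.
    have xp : 0 < nrm x by rewrite lt_neqAle eq_sym x0 nrm_ge0.
    have := inner_ge0 (nrm y *: x - nrm x *: y).
    rewrite innerBl !innerBr !innerZl !innerZr -!nrm_sqr (innerC y x) => h.
    have [y0|y0] := eqVneq (nrm y) 0; last first.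
      have yp : 0 < nrm y by rewrite lt_neqAle eq_sym y0 nrm_ge0.
      have xy : 0 < nrm x * nrm y by rewrite mulr_gt0.
      rewrite -(ler_pM2l xy); nra.
    rewrite y0 mulr0 leNgt; apply/negP => i0.
    (* With [nrm y = 0] this multiple of [y] brings the square norm down to [- nrm x ^+ 2]. *)
    have := inner_ge0 (x - (nrm x ^+ 2 / inner x y) *: y).
    rewrite innerBl !innerBr !innerZl !innerZr -!nrm_sqr (innerC y x) y0.
    rewrite expr0n/= !mulr0 subr0 divfK ?gt_eqF// => h2.
    have : 0 < nrm x ^+ 2 by rewrite exprn_gt0.
    lra.
  rewrite x0 mul0r leNgt; apply/negP => i0.
  have := inner_ge0 (y - ((nrm y ^+ 2 + 1) / inner x y) *: x).
  rewrite innerBl !innerBr !innerZl !innerZr -!nrm_sqr (innerC y x) x0.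
  rewrite expr0n/= !mulr0 subr0 divfK ?gt_eqF// => h2.
  have : 0 <= nrm y ^+ 2 by rewrite exprn_ge0// nrm_ge0.
  lra.
rewrite ler_norml key andbT lerNl -innerNl.
by rewrite (le_trans (key _ _))// nrmN.
Qed.

Lemma nrm_triangle u v : nrm (u + v) <= nrm u + nrm v.
Proof.
apply: nrm_le; first by rewrite addr_ge0 ?nrm_ge0.
rewrite innerDl !innerDr -!nrm_sqr (innerC v u).
have := le_trans (ler_norm _) (cauchy_schwarz u v); lra.
Qed.

Lemma nrm_dist u v : `|nrm u - nrm v| <= nrm (u - v).
Proof.
rewrite ler_norml; apply/andP; split.
- rewrite lerNl opprB lerBlDr nrmBC.
  by rewrite (le_trans _ (nrm_triangle _ _))// subrK.
- by rewrite lerBlDr (le_trans _ (nrm_triangle _ _))// subrK.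
Qed.

Lemma nrm_sum (I : Type) (r : seq I) (x : I -> L2 R) :
  nrm (\sum_(i <- r) x i) <= \sum_(i <- r) nrm (x i).
Proof.
elim: r => [|i r IH]; first by rewrite !big_nil nrm0.
by rewrite !big_cons (le_trans (nrm_triangle _ _))// lerD2l.
Qed.

Lemma finite_norm_L2 (f : measurableTypeR R -> R) : measurable_fun setT f ->
  (\int[leb]_(s in I01) (f s ^+ 2)%:E < +oo)%E -> f \in Lfun (@Leb01 R) 2%:E.
Proof.
move=> mf foo; apply/andP; split; rewrite inE//=.
rewrite /finite_norm unlock /Lnorm poweR_lty//.
under eq_integral do rewrite abse_EFin poweR_EFin powR_mulrn// real_normK ?num_real//.
rewrite ge0_integral_Leb01//.
  by apply/measurable_EFinP; apply: measurable_funX.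
by move=> x; rewrite lee_fin sqr_ge0.
Qed.

(** Elements are functions on the whole line, but the norm ignores the values
    outside (0, 1): extending by zero costs nothing. *)
Lemma exists_L2 (f : measurableTypeR R -> R) : measurable_fun I01 f ->
  (\int[leb]_(s in I01) (f s ^+ 2)%:E < +oo)%E ->
  exists u : L2 R, forall s, 0 < s < 1 -> u s = f s.
Proof.
move=> mf foo.
have m1 : measurable_fun setT (f \_ I01) by apply/(measurable_restrictT _ _).1.
have fin : f \_ I01 \in Lfun (@Leb01 R) 2%:E.
  apply: finite_norm_L2 => //; apply: le_lt_trans foo.
  apply: ge0_le_integral => //=.
  - by move=> x _; rewrite lee_fin sqr_ge0.
  - apply/measurable_EFinP; apply: measurable_funX; exact: measurable_funTS.
  - by apply/measurable_EFinP; apply: measurable_funX.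
  - by move=> x x01; rewrite patchE mem_set.
exists (Lfun_Sub (lee1n 2) fin) => s s01 /=.
by rewrite patchE mem_set//= in_itv.
Qed.

Lemma exists_L2_dominated (f : measurableTypeR R -> R) (v : L2 R) :
  measurable_fun I01 f -> (forall s, 0 < s < 1 -> `|f s| <= `|v s|) ->
  exists u : L2 R, forall s, 0 < s < 1 -> u s = f s.
Proof.
move=> mf fv; apply: exists_L2 => //.
have [_ foo] := elimT (integrableP _ _ _) (inner_integrable v v).
apply: le_lt_trans foo.
apply: ge0_le_integral => //=.
- by move=> x _; rewrite lee_fin sqr_ge0.
- by apply/measurable_EFinP; apply: measurable_funX.
- apply/measurable_EFinP; apply: measurableT_comp => //.
  by apply: measurable_funM; exact: L2_measurable_on.
- move=> x; rewrite in_itv/= => x01; rewrite lee_fin normrM -expr2.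
  by rewrite -[leLHS]real_normK ?num_real// ler_sqr ?nnegrE//; exact: fv.
Qed.

Lemma eq_inner u u' v v' : (forall s, 0 < s < 1 -> u s = u' s) ->
  (forall s, 0 < s < 1 -> v s = v' s) -> inner u v = inner u' v'.
Proof.
move=> uu vv; apply: eq_Rintegral => s; rewrite inE/= in_itv/= => s01.
by rewrite uu// vv.
Qed.

Lemma ae_le_inner u u' v v' :
  {ae leb, forall s, 0 < s < 1 -> u s * v s <= u' s * v' s} ->
  inner u v <= inner u' v'.
Proof.
move=> [N [mN N0 h]]; rewrite /inner /Rintegral.
have i1 := inner_integrable u v; have i2 := inner_integrable u' v'.
rewrite (negligible_integral mN _ i1 N0)//.
rewrite (negligible_integral mN _ i2 N0)//.
have mD : measurable (I01 `\` N) by apply: measurableD.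
have j1 : leb.-integrable (I01 `\` N) (EFin \o (u \* v)).
  by apply: integrableS i1 => //; exact: subDsetl.
have j2 : leb.-integrable (I01 `\` N) (EFin \o (u' \* v')).
  by apply: integrableS i2 => //; exact: subDsetl.
apply: le_Rintegral => // s [s01 sN] /=.
apply: contrapT => hs; apply: sN; apply: h => /= /(_ _); apply: contra_not hs.
by apply; move: s01; rewrite /= in_itv.
Qed.

Lemma inner_self_eq0 u : inner u u = 0 -> {ae leb, forall s, 0 < s < 1 -> u s = 0}.
Proof.
move=> u0; have /fine_Lnormr_eq0 : nrm u = 0 by rewrite nrm_eq_sqrt u0 sqrtr0.
move=> /(ae_Leb01 (fun s => [set: R] s -> u s = 0)); apply: ae_imp => s h s01.
exact: h.
Qed.

End L2_structure.

(** * A smooth step function *)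

Section smooth_step.
Context {R : realType}.
Implicit Types (f h : R -> R) (p : {poly R}).

Lemma is_derive_comp1 f h x a b : is_derive x (1:R) f a ->
  is_derive (f x) (1:R) h b -> is_derive x (1:R) (h \o f) (b * a).
Proof.
move=> [df fa] [dh hb]; apply: DeriveDef.
  by apply/derivable1_diffP/differentiable_comp; apply/derivable1_diffP.
by rewrite -derive1E derive1_comp// !derive1E fa hb.
Qed.

Lemma is_derive_inv1 f x a : f x != 0 -> is_derive x (1:R) f a ->
  is_derive x (1:R) (fun y => (f y)^-1) (- (f x) ^- 2 * a).
Proof.
move=> fx0 [df <-]; apply: DeriveDef; first exact: derivableV.
by rewrite deriveV.
Qed.

(** Peeling derivatives off from the inside makes the product and inverse rules
    go through by induction on the order. *)
Fixpoint smooth_upto n f : Prop :=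
  (forall x, derivable f x 1) /\
  if n is m.+1 then smooth_upto m (derive1 f) else True.

Lemma smooth_derivable n f x : smooth_upto n f -> derivable f x 1.
Proof. by case: n => [|n] []. Qed.

Lemma smoothW n f : smooth_upto n.+1 f -> smooth_upto n f.
Proof. by elim: n f => [|n IH] f [df sf]; split => //; exact: IH. Qed.

Lemma smooth_derive1n n f : (forall m, smooth_upto m f) ->
  forall x, derivable (derive1n n f) x 1.
Proof.
elim: n f => [|n IH] f sf x; first exact: smooth_derivable (sf 0%N).
by rewrite derive1Sn; apply: IH => m; have [] := sf m.+1.
Qed.

Lemma smooth_cst n (c : R) : smooth_upto n (cst c).
Proof.
elim: n c => [|n IH] c; split => //.
rewrite (_ : derive1 _ = cst 0); first exact: IH.
by apply/funext => y; rewrite derive1_cst.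
Qed.

Lemma smoothD n f h : smooth_upto n f -> smooth_upto n h ->
  smooth_upto n (fun x => f x + h x).
Proof.
elim: n f h => [|n IH] f h [df sf] [dh sh]; split => [x|//]; try exact: derivableD.
rewrite (_ : derive1 _ = fun x => derive1 f x + derive1 h x); first exact: IH.
by apply/funext => x; rewrite !derive1E deriveD.
Qed.

Lemma smoothM n f h : smooth_upto n f -> smooth_upto n h ->
  smooth_upto n (fun x => f x * h x).
Proof.
elim: n f h => [|n IH] f h sf sh.
  by split => // x; apply: derivableM; [exact: smooth_derivable sf|exact: smooth_derivable sh].
have [df sf'] := sf; have [dh sh'] := sh; split => [x|]; first exact: derivableM.
rewrite (_ : derive1 _ = fun x => f x * derive1 h x + h x * derive1 f x).
  by apply: smoothD; apply: IH => //; exact: smoothW.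
by apply/funext => x; rewrite !derive1E deriveM.
Qed.

(** The derivative of [1 / f] is the product of [- f'] and two copies of [1 / f]. *)
Lemma smoothV n f : (forall x, f x != 0) -> smooth_upto n f ->
  smooth_upto n (fun x => (f x)^-1).
Proof.
move=> f0; elim: n => [|n IH] [df sf].
  by split => [x|//]; apply: derivableV; [exact: f0|exact: df].
have dV x : derivable (fun x => (f x)^-1) x 1 by exact: derivableV.
split => //.
rewrite (_ : derive1 _ = fun x => ((f x)^-1 * (f x)^-1) * (-1 * derive1 f x)).
  have sV : smooth_upto n (fun x => (f x)^-1).
    by apply: IH; apply: smoothW; split.
  do 2 apply: smoothM => //; exact: smooth_cst.
apply/funext => x; rewrite !derive1E deriveV// /GRing.scale/=.
by rewrite mulN1r mulrN mulNr -expr2 exprVn.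
Qed.

Lemma derive1_affine f a b x : derivable f (a * x + b) 1 ->
  is_derive x (1:R) (fun y => f (a * y + b)) (a * derive1 f (a * x + b)).
Proof.
move=> df; rewrite mulrC derive1E.
have dl : is_derive x (1:R) (fun y => a * y + b) a.
  have h := is_deriveD (is_deriveZ a (is_derive_id x (1:R)))
    (is_derive_cst b x (1:R)).
  by apply: is_derive_eq h _; rewrite addr0 /GRing.scale/= mulr1.
exact: (@is_derive_comp1 (fun y => a * y + b) f x a _ dl (derivableP df)).
Qed.

Lemma smooth_affine n f a b : smooth_upto n f ->
  smooth_upto n (fun x => f (a * x + b)).
Proof.
elim: n f => [|n IH] f [df sf]; split => [x|//]; try by case: (derive1_affine (df (a * x + b))).
rewrite (_ : derive1 _ = fun x => a * derive1 f (a * x + b)).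
  by apply: smoothM; [exact: smooth_cst|exact: IH].
by apply/funext => x; rewrite derive1E; case: (derive1_affine (df (a * x + b))).
Qed.

(** The polynomial factor makes the family of the functions [p(1/x) exp(-1/x)]
    closed under differentiation, which is what smoothness at 0 amounts to. *)
Definition flat p (x : R) : R := if 0 < x then p.[x^-1] * expR (- x^-1) else 0.

Lemma poly_growth p : exists n C, 0 <= C /\
  forall y, 1 <= y -> `|p.[y]| <= C * y ^+ n.
Proof.
elim/poly_ind: p => [|p c [n [C [C0 H]]]].
  by exists 0%N, 0; split => // y _; rewrite horner0 normr0 mul0r.
exists n.+1, (C + `|c|); split; first by rewrite addr_ge0.
move=> y y1; rewrite !hornerE (le_trans (ler_normD _ _))// mulrDl lerD//.
  rewrite normrM (ger0_norm (le_trans ler01 y1)) exprSr mulrA.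
  by rewrite ler_wpM2r ?(le_trans ler01)// H.
by rewrite ler_peMr// exprn_ege1.
Qed.

(** This is differentiability at 0: there, the difference quotient of [flat p]
    is [flat ('X * p)]. *)
Lemma flat_bound p : exists2 C, 0 <= C &
  forall x, `|x| <= 1 -> `|flat p x| <= C * `|x|.
Proof.
have [n [C [C0 H]]] := poly_growth p.
exists (C * (n.+1)`!%:R) => [|x x1]; first by rewrite mulr_ge0.
rewrite /flat; case: ifPn => x0; last by rewrite normr0 !mulr_ge0.
rewrite (gtr0_norm x0) in x1 *.
set y := x^-1; have y1 : 1 <= y by rewrite invf_ge1.
have y0 : 0 < y := lt_le_trans ltr01 y1.
rewrite normrM (gtr0_norm (expR_gt0 _)) expRN.
(* A term of the exponential series one degree above the growth of [p]. *)
have hn : y ^+ n.+1 / (n.+1)`!%:R <= expR y.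
  by apply: le_trans (@expR_ge1Dxn R y n (ltW y0)); rewrite lerDr.
rewrite ler_pdivrMr ?expR_gt0// (le_trans (H _ y1))// -!mulrA ler_wpM2l//.
have -> : y ^+ n = x * y ^+ n.+1 by rewrite exprS mulrA divff ?mul1r// gt_eqF.
rewrite mulrCA ler_wpM2l ?(ltW x0)//.
by rewrite -ler_pdivrMl ?ltr0n ?fact_gt0// mulrC.
Qed.

Lemma is_derive_flat p x :
  is_derive x (1:R) (flat p) (flat ('X ^+ 2 * (p - p^`())) x).
Proof.
have [x0|x0|->] := ltrgt0P x.
- have xn0 : x != 0 by rewrite gt_eqF.
  have dV : is_derive x (1:R) (fun y => y^-1) (- x ^- 2).
    apply: DeriveDef; first exact: derivableV.
    by rewrite (@deriveV _ _ id)// derive_id /GRing.scale/= mulr1.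
  have dN : is_derive x (1:R) (fun y => - y^-1) (x ^- 2).
    by apply: is_derive_eq (is_deriveN _) _; rewrite opprK.
  have d1 := @is_derive_comp1 _ _ _ _ _ dV (is_derive_poly p _).
  have d2 := @is_derive_comp1 _ _ _ _ _ dN (is_derive_expR _).
  have d3 := is_deriveM d1 d2.
  apply: (@near_eq_is_derive R R R (fun y => p.[y^-1] * expR (- y^-1))).
    near=> y; rewrite /flat ifT//; near: y; exact: lt_nbhsr.
  apply: is_derive_eq d3 _.
  rewrite /flat x0 !hornerE /= /GRing.scale/= exprVn; ring.
- apply: (@near_eq_is_derive R R R (cst 0)).
    near=> y; rewrite /flat ifF//; apply/negbTE; rewrite -leNgt; near: y.
    exact: lt_le_nbhsl.
  by rewrite /flat ltNge (ltW x0)/=; exact: is_derive_cst.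
- rewrite {2}/flat ltxx.
  have [C C0 H] := flat_bound ('X * p).
  have cv : (fun t : R => t^-1 *: (flat p (t *: 1 + 0) - flat p 0)) @ 0^' --> (0 : R).
    apply/cvgrPdist_le => /= e e0; near=> t.
    have t0 : t != 0 by near: t; exact: nbhs_dnbhs_neq.
    have t1 : `|t| <= 1.
      near: t; apply: dnbhs0_le; exact: ltr01.
    have -> : t^-1 *: (flat p (t *: 1 + 0) - flat p 0) = flat ('X * p) t.
      rewrite /flat ltxx subr0 addr0 /GRing.scale/= mulr1.
      by case: ifPn; rewrite ?mulr0// !hornerE.
    rewrite sub0r normrN (le_trans (H _ t1))//.
    rewrite (@le_trans _ _ ((C + 1) * `|t|))//.
      by rewrite ler_wpM2r// lerDl.
    rewrite -ler_pdivlMl ?ltr_wpDl//; near: t; apply: dnbhs0_le.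
    by rewrite mulr_gt0 ?invr_gt0 ?ltr_wpDl.
  apply: DeriveDef; first by apply/cvg_ex; exists 0.
  exact: cvg_lim cv.
Unshelve. all: by end_near. Qed.

Lemma derive1_flat p : derive1 (flat p) = flat ('X ^+ 2 * (p - p^`())).
Proof. by apply/funext => x; rewrite derive1E; case: (is_derive_flat p x). Qed.

Lemma smooth_flat n p : smooth_upto n (flat p).
Proof.
elim: n p => [|n IH] p; split => [x|//]; try by case: (is_derive_flat p x).
by rewrite derive1_flat; exact: IH.
Qed.

Lemma flat1_ge0 x : 0 <= flat 1 x.
Proof. by rewrite /flat; case: ifP => // _; rewrite hornerE mul1r expR_ge0. Qed.

Lemma flat1_gt0 x : 0 < x -> 0 < flat 1 x.
Proof. by rewrite /flat => ->; rewrite hornerE mul1r expR_gt0. Qed.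

Lemma flat_le0 p x : x <= 0 -> flat p x = 0.
Proof. by rewrite /flat ltNge => ->. Qed.

Lemma derive1_flat1_ge0 x : 0 <= derive1 (flat 1) x.
Proof.
rewrite derive1_flat -[1]/(1%:P) derivC subr0 mulr1 /flat; case: ifP => // _.
by rewrite !hornerE mulr_ge0 ?expR_ge0 ?sqr_ge0.
Qed.

(** A smooth transition from 0 on the left of 0 to 1 on the right of 1. *)
Definition step (x : R) : R := flat 1 x / (flat 1 x + flat 1 (1 - x)).

Lemma step_den_gt0 x : 0 < flat 1 x + flat 1 (1 - x).
Proof.
have [x0|x0] := ltP 0 x; first by rewrite ltr_pwDl ?flat1_gt0 ?flat1_ge0.
by rewrite ltr_wpDl ?flat1_ge0// flat1_gt0//; lra.
Qed.

Lemma step_le0 x : x <= 0 -> step x = 0.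
Proof. by move=> x0; rewrite /step flat_le0// mul0r. Qed.

Lemma step_ge1 x : 1 <= x -> step x = 1.
Proof.
move=> x1; rewrite /step (@flat_le0 _ (1 - x)) ?addr0; last by lra.
by rewrite divff// gt_eqF// flat1_gt0// (lt_le_trans ltr01).
Qed.

Lemma step_ge0 x : 0 <= step x.
Proof. by rewrite divr_ge0 ?flat1_ge0// ltW// step_den_gt0. Qed.

Lemma step_le1 x : step x <= 1.
Proof. by rewrite ler_pdivrMr ?step_den_gt0// mul1r lerDl flat1_ge0. Qed.

Lemma flat_refl_eq : (fun x => flat 1 (1 - x)) = (fun x => flat 1 (-1 * x + 1)).
Proof. by apply/funext => x; rewrite mulN1r addrC. Qed.

Lemma smooth_step n : smooth_upto n step.
Proof.
apply: smoothM; first exact: smooth_flat.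
apply: smoothV => [x|]; first by rewrite gt_eqF// step_den_gt0.
apply: smoothD; first exact: smooth_flat.
by rewrite flat_refl_eq; apply: smooth_affine; exact: smooth_flat.
Qed.

Lemma derive1_step_ge0 x : 0 <= derive1 step x.
Proof.
have d1 := is_derive_flat 1 x.
have d2 : is_derive x (1:R) (fun y => flat 1 (1 - y)) (- derive1 (flat 1) (1 - x)).
  have := @derive1_affine (flat 1) (-1) 1 x.
  rewrite -flat_refl_eq mulN1r (addrC _ 1) mulN1r; apply.
  by case: (is_derive_flat 1 (1 - x)).
have den : flat 1 x + flat 1 (1 - x) != 0 by rewrite gt_eqF ?step_den_gt0.
have d3 := is_deriveD d1 d2.
have d4 : is_derive x (1:R) (fun y => (flat 1 y + flat 1 (1 - y))^-1)
   (- (flat 1 x + flat 1 (1 - x)) ^- 2 *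
     (derive1 (flat 1) x - derive1 (flat 1) (1 - x))).
  have := @is_derive_inv1 (fun y => flat 1 y + flat 1 (1 - y)) _ _ den d3.
  by rewrite derive1_flat.
have [_ E] := is_deriveM d1 d4.
rewrite derive1E E /GRing.scale/= -derive1_flat.
have -> : flat 1 x * (- (flat 1 x + flat 1 (1 - x)) ^- 2 *
   (derive1 (flat 1) x - derive1 (flat 1) (1 - x))) +
  (flat 1 x + flat 1 (1 - x))^-1 * derive1 (flat 1) x =
  (flat 1 x * derive1 (flat 1) (1 - x) + flat 1 (1 - x) * derive1 (flat 1) x)
   / (flat 1 x + flat 1 (1 - x)) ^+ 2 by field.
apply: divr_ge0; last exact: sqr_ge0.
by apply: addr_ge0; apply: mulr_ge0;
  solve [exact: flat1_ge0 | exact: derive1_flat1_ge0].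
Qed.

Lemma derivable_step x : derivable step x 1.
Proof. exact: smooth_derivable (smooth_step 0). Qed.

End smooth_step.

(** * Bochner integrals *)

Section Bochner_integral_theory.
Context {R : realType}.
Local Notation leb := (@lebesgue_measure R).
Implicit Types (D E N : set (measurableTypeR R)) (f : @simple_fun R) (e : L2 R).

(** The distance from a simple function to a Bochner integrable one need not be
    Borel measurable. The integral of a nonnegative function is a supremum over
    simple functions below it, so monotonicity survives as long as the smaller
    function is measurable. *)
Lemma lower_integral_le E D (h q : measurableTypeR R -> \bar R) :
  E `<=` D -> (forall t, E t -> 0 <= h t)%E -> (forall t, 0 <= q t)%E ->
  (forall t, E t -> h t <= q t)%E ->
  (\int[leb]_(t in E) h t <= \int[leb]_(t in D) q t)%E.
Proof.
move=> ED h0 q0 hq; rewrite !ge0_integralE//.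
apply: ereal_sup_le => _ [s /= sh <-]; exists s => //= t.
apply: (le_trans (sh t)); rewrite !patchE.
case: ifPn => [/set_mem Et|_]; first by rewrite mem_set ?hq//; exact: ED.
by case: ifPn.
Qed.

Lemma lower_integral_ae_le D N (h q : measurableTypeR R -> \bar R) :
  measurable D -> measurable N -> leb N = 0%E -> measurable_fun D h ->
  (forall t, D t -> 0 <= h t)%E -> (forall t, 0 <= q t)%E ->
  (forall t, D t -> ~ N t -> h t <= q t)%E ->
  (\int[leb]_(t in D) h t <= \int[leb]_(t in D) q t)%E.
Proof.
move=> mD mN N0 mh h0 q0 hq; rewrite (ge0_negligible_integral mN)//.
apply: lower_integral_le => // t [Dt Nt]; [exact: h0|exact: hq].
Qed.

Lemma EFin_Rintegral D (h : measurableTypeR R -> R) : measurable D ->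
  leb.-integrable D (EFin \o h) ->
  ((\int[leb]_(t in D) h t)%:E = \int[leb]_(t in D) (h t)%:E)%E.
Proof.
by move=> mD ih; rewrite /Rintegral fineK//; exact: (integrable_fin_num mD ih).
Qed.

Lemma inner_sf_eval f e t :
  inner (sf_eval f t) e = \sum_(i < sf_size f) \1_(sf_set i) t * inner (sf_val i) e.
Proof. by rewrite inner_suml; apply: eq_bigr => i _; rewrite innerZl. Qed.

Lemma measurable_inner_sf f e D :
  measurable_fun D (fun t => inner (sf_eval f t) e).
Proof.
apply: (@measurable_funS _ _ _ _ setT) => //.
under eq_fun do rewrite inner_sf_eval.
apply: measurable_sum => i; apply: measurable_funM => //.
by apply: measurable_indic; exact: sf_measurable.
Qed.

(** By bilinearity the square norm is a polynomial in indicators. *)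
Lemma measurable_nrm_sf f D : measurable_fun D (fun t => nrm (sf_eval f t)).
Proof.
under eq_fun do rewrite nrm_eq_sqrt inner_sf_eval.
apply: (@measurableT_comp _ _ _ _ _ _ (@Num.sqrt R)).
  by apply: continuous_measurable_fun; exact: sqrt_continuous.
apply: measurable_sum => i; apply: measurable_funM => //.
  apply: (@measurable_funS _ _ _ _ setT) => //.
  by apply: measurable_indic; exact: sf_measurable.
by under eq_fun do rewrite innerC; exact: measurable_inner_sf.
Qed.

Lemma measurable_inner_sf2 f h D :
  measurable_fun D (fun t => inner (sf_eval f t) (sf_eval h t)).
Proof.
under eq_fun do rewrite inner_sf_eval.
apply: measurable_sum => i; apply: measurable_funM => //.
  apply: (@measurable_funS _ _ _ _ setT) => //.
  by apply: measurable_indic; exact: sf_measurable.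
by under eq_fun do rewrite innerC; exact: measurable_inner_sf.
Qed.

Lemma measurable_nrm_sfB f h D :
  measurable_fun D (fun t => nrm (sf_eval f t - sf_eval h t)).
Proof.
under eq_fun do rewrite nrm_eq_sqrt innerBl !innerBr.
apply: (@measurableT_comp _ _ _ _ _ _ (@Num.sqrt R)).
  by apply: continuous_measurable_fun; exact: sqrt_continuous.
by do 2 try apply: measurable_funB; exact: measurable_inner_sf2.
Qed.

Lemma nrm_sf_bounded f t : nrm (sf_eval f t) <= \sum_(i < sf_size f) nrm (sf_val i).
Proof.
apply: (le_trans (nrm_sum _ _)); apply: ler_sum => i _.
by rewrite nrmZ indicE ler_piMl ?nrm_ge0//; case: (_ \in _); rewrite ?normr1 ?normr0.
Qed.

Lemma integrable_of_bounded D (h : measurableTypeR R -> R) C : measurable D ->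
  (leb D < +oo)%E -> measurable_fun D h -> (forall t, D t -> `|h t| <= C) ->
  leb.-integrable D (EFin \o h).
Proof.
move=> mD Doo mh hC; apply: measurable_bounded_integrable => //.
exists C; split; rewrite ?num_real// => M CM t Dt; exact: le_trans (hC t Dt) (ltW CM).
Qed.

Lemma integrable_nrm_sf f D : measurable D -> (leb D < +oo)%E ->
  leb.-integrable D (EFin \o (fun t => nrm (sf_eval f t))).
Proof.
move=> mD Doo; apply: integrable_of_bounded => //; first exact: measurable_nrm_sf.
by move=> t _; rewrite ger0_norm ?nrm_ge0//; exact: nrm_sf_bounded.
Qed.

Lemma integrable_inner_sf f e D : measurable D -> (leb D < +oo)%E ->
  leb.-integrable D (EFin \o (fun t => inner (sf_eval f t) e)).
Proof.
move=> mD Doo; apply: integrable_of_bounded => //; first exact: measurable_inner_sf.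
move=> t _; apply: (le_trans (cauchy_schwarz _ _)).
by apply: ler_wpM2r; [exact: nrm_ge0|exact: nrm_sf_bounded].
Qed.

Lemma inner_sf_integral f e D : measurable D -> (leb D < +oo)%E ->
  inner (sf_integral D f) e = \int[leb]_(t in D) inner (sf_eval f t) e.
Proof.
move=> mD Doo; rewrite /sf_integral inner_suml.
transitivity (\int[leb]_(t in D)
    \sum_(i < sf_size f) \1_(sf_set i) t * inner (sf_val i) e); last first.
  by apply: eq_Rintegral => t _; rewrite inner_sf_eval.
have int i : leb.-integrable D
    (EFin \o (fun t => \1_(@sf_set R f i) t * inner (sf_val i) e)).
  apply: (integrable_of_bounded (C := `|inner (sf_val i) e|)) => //.
    apply: measurable_funM => //; apply: (@measurable_funS _ _ _ _ setT) => //.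
    by apply: measurable_indic; exact: sf_measurable.
  move=> t _; rewrite normrM ler_piMl// indicE.
  by case: (_ \in _); rewrite ?normr1 ?normr0.
rewrite /Rintegral.
under [in RHS]eq_integral do rewrite -sumEFin.
rewrite integral_sum// -sum_fine; last first.
  by move=> i _; apply: (integrable_fin_num mD); exact: int.
apply: eq_bigr => i _; rewrite innerZl.
under [in RHS]eq_integral do rewrite mulrC EFinM.
rewrite integralZl//; last first.
  apply: (integrable_of_bounded (C := 1)) => //.
    apply: (@measurable_funS _ _ _ _ setT) => //.
    by apply: measurable_indic; exact: sf_measurable.
  by move=> t _; rewrite indicE; case: (_ \in _); rewrite ?normr1 ?normr0.
rewrite integral_indic//; last exact: sf_measurable.
rewrite fineM// ?(setIC D) 1?mulrC//.
rewrite ge0_fin_numE// (le_lt_trans _ Doo)// le_measure ?inE//.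
  by apply: measurableI => //; exact: sf_measurable.
Qed.

Lemma near_lt_cvg0 (u : nat -> \bar R) (eps : R) : u n @[n --> \oo] --> 0%E ->
  0 < eps -> \forall n \near \oo, (u n < eps%:E)%E.
Proof.
move=> /fine_cvgP[ufin uc] e0; near=> n.
rewrite -[u n]fineK; last by near: n.
by rewrite lte_fin; near: n; exact: (cvgr_lt _ uc).
Unshelve. all: by end_near. Qed.

Lemma Bochner_approx D (w : R -> L2 R) I (eps : R) : 0 < eps ->
  Bochner_integral D w I -> exists f,
    (\int[leb]_(t in D) (nrm (sf_eval f t - w t))%:E <= eps%:E)%E /\
    nrm (sf_integral D f - I) <= eps.
Proof.
move=> e0 [f [_ h1 h2]].
have n1 : \forall n \near \oo,
    (\int[leb]_(t in D) (nrm (sf_eval (f n) t - w t))%:E <= eps%:E)%E.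
  by near=> n; apply: ltW; near: n; exact: near_lt_cvg0.
have n2 : \forall n \near \oo, nrm (sf_integral D (f n) - I) <= eps.
  near=> n; apply: ltW; near: n.
  exact: (cvgr_lt _ h2).
have [n [h3 h4]] := filter_ex (filterI n1 n2).
by exists (f n).
Unshelve. all: by end_near. Qed.

(** The factor [nrm e + 1] only serves to divide by a positive number. *)
Lemma integral_inner_le D N (h : measurableTypeR R -> R) (w : R -> L2 R) f e eps :
  measurable D -> measurable N -> leb N = 0%E -> measurable_fun D h ->
  (forall t, D t -> 0 <= h t) ->
  (forall t, D t -> ~ N t -> h t <= nrm e * nrm (sf_eval f t - w t)) ->
  (\int[leb]_(t in D) (nrm (sf_eval f t - w t))%:E <= eps%:E)%E ->
  (\int[leb]_(t in D) (h t)%:E <= ((nrm e + 1) * eps)%:E)%E.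
Proof.
move=> mD mN N0 mh h0 hle fe.
have ep : 0 < nrm e + 1 by rewrite ltr_wpDl ?nrm_ge0.
have : (\int[leb]_(t in D) ((nrm e + 1)^-1 * h t)%:E <= eps%:E)%E.
  apply: le_trans fe; apply: (lower_integral_ae_le mD mN N0) => //.
  - by apply: measurableT_comp => //; exact: measurable_funM.
  - by move=> t Dt; rewrite lee_fin mulr_ge0 ?invr_ge0 ?(ltW ep) ?h0.
  - by move=> t; rewrite lee_fin nrm_ge0.
  - move=> t Dt Nt; rewrite lee_fin ler_pdivrMl// (le_trans (hle t Dt Nt))//.
    by rewrite ler_wpM2r ?nrm_ge0// lerDl.
under eq_integral do rewrite EFinM.
rewrite (@ge0_integralZl _ _ _ _ _ mD (fun t => (h t)%:E)); first last.
- by rewrite lee_fin invr_ge0 ltW.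
- by move=> t Dt; rewrite lee_fin h0.
- exact/measurable_EFinP.
by rewrite lee_pdivrMl// EFinM.
Qed.

(** True for simple functions by linearity; both sides pass to the limit because
    the approximation is in mean. *)
Lemma inner_Bochner D (w : R -> L2 R) I e : measurable D -> (leb D < +oo)%E ->
  Bochner_integral D w I ->
  leb.-integrable D (EFin \o (fun t => inner (w t) e)) ->
  inner I e = \int[leb]_(t in D) inner (w t) e.
Proof.
move=> mD Doo bI iw.
have mw : measurable_fun D (fun t => inner (w t) e).
  by case/integrableP : iw => /measurable_EFinP.
apply/eqP; rewrite -subr_eq0 -normr_le0.
apply/ler_addgt0Pl => eps' eps'0; rewrite addr0.
pose eps := eps' / (2 * nrm e + 1).
have ep : 0 < 2 * nrm e + 1 by rewrite ltr_wpDl ?mulr_ge0 ?nrm_ge0.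
have eps0 : 0 < eps by rewrite divr_gt0.
have [f [f1 f2]] := Bochner_approx eps0 bI.
have -> : inner I e - \int[leb]_(t in D) inner (w t) e =
    \int[leb]_(t in D) (inner (sf_eval f t - w t) e) - inner (sf_integral D f - I) e.
  rewrite innerBl inner_sf_integral//.
  under [in RHS]eq_Rintegral do rewrite innerBl.
  rewrite RintegralB//; last exact: integrable_inner_sf.
  by rewrite opprB [RHS]addrC addrA subrK.
have mfw : measurable_fun D (fun t => inner (sf_eval f t - w t) e).
  under eq_fun do rewrite innerBl.
  by apply: measurable_funB => //; exact: measurable_inner_sf.
have ifw : leb.-integrable D (EFin \o (fun t => inner (sf_eval f t - w t) e)).
  rewrite (_ : _ \o _ = (fun t => (inner (sf_eval f t) e)%:E - (inner (w t) e)%:E)%E).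
    by apply: integrableB => //; exact: integrable_inner_sf.
  by apply/funext => t /=; rewrite innerBl EFinB.
apply: (le_trans (ler_normB _ _)).
have b1 : `|inner (sf_integral D f - I) e| <= eps * nrm e.
  by apply: (le_trans (cauchy_schwarz _ _)); rewrite ler_wpM2r ?nrm_ge0.
have b2 : `|\int[leb]_(t in D) (inner (sf_eval f t - w t) e)| <= (nrm e + 1) * eps.
  apply: (le_trans (le_normr_Rintegral mD ifw)).
  rewrite -lee_fin EFin_Rintegral//; last first.
    rewrite (_ : _ \o _ = (abse \o (EFin \o (fun t => inner (sf_eval f t - w t)%R e)))%E)//.
    exact: integrable_abse.
  apply: (@integral_inner_le _ set0 _ w f e) => //.
  - exact: measurableT_comp.
  - move=> t _ _; rewrite mulrC; exact: cauchy_schwarz.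
apply: (le_trans (lerD b2 b1)).
have -> : (nrm e + 1) * eps + eps * nrm e = eps * (2 * nrm e + 1) by ring.
by rewrite divfK// gt_eqF.
Qed.

(** A majorant of the integrand bounds the integral. Only the measurable part
    [h] of the pairing of the simple approximation that exceeds the majorant is
    compared with the possibly non-measurable distance to the integrand. *)
Lemma inner_Bochner_le D N (w : R -> L2 R) I e (M : measurableTypeR R -> R) :
  measurable D -> (leb D < +oo)%E -> Bochner_integral D w I ->
  measurable N -> leb N = 0%E -> leb.-integrable D (EFin \o M) ->
  (forall t, 0 <= M t) -> (forall t, D t -> ~ N t -> nrm (w t) <= M t) ->
  `|inner I e| <= nrm e * \int[leb]_(t in D) M t.
Proof.
move=> mD Doo bI mN N0 iM M0 wM.
have mM : measurable_fun D M by case/integrableP : iM => /measurable_EFinP.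
apply/ler_addgt0Pl => eps' eps'0.
pose eps := eps' / (2 * nrm e + 1).
have ep : 0 < 2 * nrm e + 1 by rewrite ltr_wpDl ?mulr_ge0 ?nrm_ge0.
have eps0 : 0 < eps by rewrite divr_gt0.
have [f [f1 f2]] := Bochner_approx eps0 bI.
have -> : inner I e = \int[leb]_(t in D) inner (sf_eval f t) e
   - inner (sf_integral D f - I) e.
  by rewrite innerBl inner_sf_integral// subKr.
have b1 : `|inner (sf_integral D f - I) e| <= eps * nrm e.
  by apply: (le_trans (cauchy_schwarz _ _)); rewrite ler_wpM2r ?nrm_ge0.
have iF := integrable_inner_sf f e mD Doo.
pose h t := Num.max 0 (`|inner (sf_eval f t) e| - nrm e * M t).
have mh : measurable_fun D h.
  apply: measurable_maxr => //; apply: measurable_funB.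
    by apply: measurableT_comp => //; exact: measurable_inner_sf.
  exact: measurable_funM.
have h0 t : 0 <= h t by rewrite /h le_max lexx.
have b2 : `|\int[leb]_(t in D) inner (sf_eval f t) e| <=
    nrm e * (\int[leb]_(t in D) M t) + (nrm e + 1) * eps.
  rewrite -RintegralZl// (le_trans (le_normr_Rintegral mD iF))//.
  have ieM : leb.-integrable D (EFin \o (fun t => nrm e * M t)).
    by under [X in _.-integrable _ X]eq_fun do rewrite /= EFinM; exact: integrableZl.
  have hle : (\int[leb]_(t in D) (h t)%:E <= ((nrm e + 1) * eps)%:E)%E.
    apply: (integral_inner_le mD mN N0 mh _ _ f1) => // t Dt Nt.
    rewrite /h ge_max mulr_ge0 ?nrm_ge0//=.
    rewrite lerBlDr (le_trans (cauchy_schwarz _ _))// mulrC -mulrDr.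
    rewrite ler_wpM2l ?nrm_ge0//.
    rewrite -[X in nrm X](subrK (w t)) (le_trans (nrm_triangle _ _))//.
    by rewrite lerD2l wM.
  have ih : leb.-integrable D (EFin \o h).
    apply/integrableP; split; first exact/measurable_EFinP.
    under eq_integral => t Dt do rewrite /= ger0_norm//.
    by rewrite (le_lt_trans hle)// ltry.
  have -> : (nrm e + 1) * eps = fine ((nrm e + 1) * eps)%:E by [].
  apply: (@le_trans _ _ (\int[leb]_(t in D) (nrm e * M t + h t))).
    apply: le_Rintegral => //.
    - rewrite (_ : _ \o _ = (abse \o (EFin \o (fun t => inner (sf_eval f t) e)))%E)//.
      exact: integrable_abse.
    - rewrite (_ : _ \o _ = (fun t => (nrm e * M t)%:E + (h t)%:E)%E)//.
      exact: integrableD.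
    - by move=> t _; rewrite -lerBlDl /h le_max lexx orbT.
  rewrite RintegralD// lerD2l /Rintegral fine_le//; exact: integrable_fin_num.
apply: (le_trans (ler_normB _ _)); apply: (le_trans (lerD b2 b1)).
rewrite [leRHS]addrC -addrA lerD2l.
have -> : (nrm e + 1) * eps + eps * nrm e = eps * (2 * nrm e + 1) by ring.
by rewrite divfK// gt_eqF.
Qed.

(** Away from a null set the norm of [v] is the pointwise limit of the norms of
    simple functions, hence measurable there; [M] is its extension by zero. *)
Lemma L1_nrm_majorant D (v : R -> L2 R) : measurable D -> (leb D < +oo)%E ->
  L1 D v -> exists N (M : measurableTypeR R -> R),
  [/\ measurable N, leb N = 0%E, (forall t, 0 <= M t),
      leb.-integrable setT (EFin \o M) &
      forall t, D t -> ~ N t -> nrm (v t) <= M t].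
Proof.
move=> mD Doo [I [f [[N [mN N0 fv]] h1 _]]].
have {}fv t : D t -> ~ N t -> nrm (sf_eval (f n) t - v t) @[n --> \oo] --> 0.
  by move=> Dt Nt; apply: contrapT => nc; apply: Nt; apply: fv => /= /(_ Dt).
pose E := D `\` N; have mE : measurable E by exact: measurableD.
have ED : E `<=` D by exact: subDsetl.
have Eoo : (leb E < +oo)%E.
  by rewrite (le_lt_trans _ Doo)// le_measure ?inE.
have mv : measurable_fun E (fun t => nrm (v t)).
  apply: (@measurable_fun_cvg _ _ _ _ (fun n t => nrm (sf_eval (f n) t))).
    by move=> n; exact: measurable_nrm_sf.
  move=> t [Dt Nt]; apply/cvgrPdist_le => /= eps eps0; near=> n.
  rewrite distrC (le_trans (nrm_dist _ _))// -[leLHS]ger0_norm ?nrm_ge0//.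
  rewrite -[X in `|X|]subr0 distrC; near: n.
  by move: (fv t Dt Nt) => /cvgrPdist_le; exact.
have mfv n : measurable_fun E (fun t => nrm (sf_eval (f n) t - v t)).
  apply: (@measurable_fun_cvg _ _ _ _
     (fun k t => nrm (sf_eval (f n) t - sf_eval (f k) t))).
    by move=> k; exact: measurable_nrm_sfB.
  move=> t [Dt Nt]; apply/cvgrPdist_le => /= eps eps0; near=> k.
  rewrite distrC (le_trans (nrm_dist _ _))//.
  rewrite opprB addrC addrA subrK nrmBC -[leLHS]ger0_norm ?nrm_ge0//.
  rewrite -[X in `|X|]subr0 distrC; near: k.
  by move: (fv t Dt Nt) => /cvgrPdist_le; exact.
have [n fn] := filter_ex (near_lt_cvg0 h1 ltr01).
have ifv : leb.-integrable E (EFin \o (fun t => nrm (sf_eval (f n) t - v t))).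
  apply/integrableP; split; first exact/measurable_EFinP.
  under eq_integral => t _ do rewrite /= ger0_norm ?nrm_ge0//.
  apply: le_lt_trans (lt_trans fn (ltry _)).
  by apply: lower_integral_le => // t *; rewrite lee_fin nrm_ge0.
have iv : leb.-integrable E (EFin \o (fun t => nrm (v t))).
  have := integrableD mE ifv (integrable_nrm_sf (f n) mE Eoo).
  apply: le_integrable => //; first exact/measurable_EFinP.
  move=> t Et /=; rewrite lee_fin ger0_norm ?nrm_ge0// ger0_norm ?addr_ge0 ?nrm_ge0//.
  rewrite -[X in nrm X](subrK (sf_eval (f n) t)) (le_trans (nrm_triangle _ _))//.
  by rewrite lerD2r nrmBC.
exists N, ((fun t => nrm (v t)) \_ E); split => //.
- by move=> t; rewrite patchE; case: ifP => // _; exact: nrm_ge0.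
- rewrite (_ : _ \o _ = (EFin \o (fun t => nrm (v t))) \_ E); last first.
    by rewrite restrict_EFin.
  by apply/(integrable_restrict leb mE measurableT _); rewrite setTI.
- by move=> t Dt Nt; rewrite patchE mem_set.
Unshelve. all: by end_near. Qed.

End Bochner_integral_theory.

(** * Absolute continuity of W11 paths *)

Section absolute_continuity.
Context {R : realType}.
Local Notation leb := (@lebesgue_measure R).
Implicit Types (g : R -> L2 R) (alpha eta x s t eps T delta : R).

Lemma continuous_on_nonnegP g t eps : continuous_on_nonneg g -> 0 <= t -> 0 < eps ->
  exists2 eta, 0 < eta &
    forall s, 0 <= s -> `|s - t| < eta -> nrm (g s - g t) < eps.
Proof.
move=> cg t0 e0.
have /cvgrPdist_lt/(_ _ e0) := cg _ t0.
rewrite near_withinE => /nbhs_ballP[eta /= eta0 H]; exists eta => // s s0 st.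
have := H s; rewrite /ball/= distrC => /(_ st s0).
by rewrite sub0r normrN ger0_norm ?nrm_ge0.
Qed.

Lemma continuous_inner g e t : continuous_on_nonneg g -> 0 < t ->
  {for t, continuous (fun s => inner (g s) e)}.
Proof.
move=> cg t0; apply/cvgrPdist_lt => /= eps eps0.
have e1 : 0 < nrm e + 1 by rewrite ltr_wpDl ?nrm_ge0.
have [eta eta0 H] := continuous_on_nonnegP cg (ltW t0) (divr_gt0 eps0 e1).
near=> s; rewrite distrC -innerBl (le_lt_trans (cauchy_schwarz _ _))//.
have : nrm (g s - g t) < eps / (nrm e + 1).
  apply: H; first by apply: ltW; near: s; exact: lt_nbhsr.
  by rewrite distrC; near: s; apply/nbhs_ballP; exists eta.
rewrite ltr_pdivlMr//; apply: le_lt_trans; rewrite ler_wpM2l ?nrm_ge0//.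
by rewrite lerDl.
Unshelve. all: by end_near. Qed.

(** A smooth ramp rising from 0 to 1 on [[alpha, alpha + eta]]: its derivative is
    an approximation of the Dirac mass at [alpha]. *)
Definition ramp (alpha eta x : R) : R := step (eta^-1 * x + - (eta^-1 * alpha)).

Lemma derivable_ramp alpha eta x : derivable (ramp alpha eta) x 1.
Proof.
exact: (@ex_derive _ _ _ _ _ _ _ (derive1_affine (@derivable_step R _))).
Qed.

Lemma derive1_ramp alpha eta x : derive1 (ramp alpha eta) x =
  eta^-1 * derive1 step (eta^-1 * x + - (eta^-1 * alpha)).
Proof.
rewrite derive1E.
exact: (@derive_val _ _ _ _ _ _ _ (derive1_affine (@derivable_step R _))).
Qed.

Lemma smooth_ramp n alpha eta : smooth_upto n (ramp alpha eta).
Proof. exact: (smooth_affine _ _ (smooth_step n)). Qed.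

Lemma ramp_le alpha eta x : 0 < eta -> x <= alpha -> ramp alpha eta x = 0.
Proof.
move=> e0 xa; apply: step_le0.
by rewrite -mulrBr pmulr_rle0 ?invr_gt0// subr_le0.
Qed.

Lemma ramp_ge alpha eta x : 0 < eta -> alpha + eta <= x -> ramp alpha eta x = 1.
Proof.
move=> e0 xa; apply: step_ge1.
by rewrite -mulrBr ler_pdivlMl// mulr1 lerBrDl.
Qed.

Lemma ramp_ge0 alpha eta x : 0 <= ramp alpha eta x. Proof. exact: step_ge0. Qed.
Lemma ramp_le1 alpha eta x : ramp alpha eta x <= 1. Proof. exact: step_le1. Qed.

Lemma derive1_ramp_ge0 alpha eta x : 0 < eta -> 0 <= derive1 (ramp alpha eta) x.
Proof.
by move=> e0; rewrite derive1_ramp mulr_ge0 ?derive1_step_ge0// invr_ge0 ltW.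
Qed.

Lemma continuous_derive1_ramp alpha eta : continuous (derive1 (ramp alpha eta)).
Proof.
move=> x; apply: differentiable_continuous; apply/derivable1_diffP.
by have [_ [d _]] := smooth_ramp 1 alpha eta.
Qed.

Lemma derive1_ramp_eq0 alpha eta x : 0 < eta ->
  ~~ (alpha <= x <= alpha + eta) -> derive1 (ramp alpha eta) x = 0.
Proof.
move=> e0; rewrite negb_and -!ltNge => /orP[xa|xa].
- rewrite derive1E (@near_eq_derive R R R _ (cst (0 : R))) ?derive_cst//.
  near=> y; rewrite ramp_le//; near: y; exact: lt_le_nbhsl.
- rewrite derive1E (@near_eq_derive R R R _ (cst (1 : R))) ?derive_cst//.
  near=> y; rewrite ramp_ge//; near: y; exact: lt_le_nbhsr.
Unshelve. all: by end_near. Qed.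

Lemma integral_derive1_ramp alpha eta : 0 < eta ->
  (\int[leb]_(x in `[alpha, (alpha + eta)%R]) (derive1 (ramp alpha eta) x)%:E = 1)%E.
Proof.
move=> e0.
rewrite (@continuous_FTC2 _ _ (ramp alpha eta)).
- by rewrite ramp_ge// (@ramp_le _ _ alpha)// sube0.
- by rewrite ltrDl.
- by apply: continuous_subspaceT; exact: continuous_derive1_ramp.
- have cr : continuous (ramp alpha eta).
    move=> x; apply: differentiable_continuous; apply/derivable1_diffP.
    exact: derivable_ramp.
  split; first by move=> x _; exact: derivable_ramp.
  + exact: cvg_at_right_filter (cr _).
  + exact: cvg_at_left_filter (cr _).
- by [].
Qed.

Section ramp_average.
Variables (k : R -> R) (alpha eta kappa eps : R) (D : set (measurableTypeR R)).
Hypotheses (eta0 : 0 < eta)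
  (ck : forall x, alpha <= x <= alpha + eta -> {for x, continuous k})
  (kk : forall x, alpha <= x <= alpha + eta -> `|k x - kappa| <= eps)
  (mD : measurable D) (KD : `[alpha, alpha + eta] `<=` D).

Let K : set (measurableTypeR R) := `[alpha, alpha + eta]%classic.
Let mK : measurable K. Proof. exact: measurable_itv. Qed.
Let ramp' := derive1 (ramp alpha eta).

Let ramp'kE : (fun x => ramp' x * k x) = (fun x => ramp' x * k x) \_ K.
Proof.
apply/funext => x; rewrite patchE; case: ifPn => // xK.
rewrite /ramp' derive1_ramp_eq0 ?mul0r//; apply: contra xK => xK.
by rewrite inE/K/= in_itv.
Qed.

Let integrable_ramp'k_K : leb.-integrable K (EFin \o (fun x => ramp' x * k x)).
Proof.
apply: continuous_compact_integrable; first exact: segment_compact.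
apply: continuous_in_subspaceT => x; rewrite inE/K/= in_itv/= => xK.
by apply: continuousM; [exact: continuous_derive1_ramp|exact: ck].
Qed.

Let integrable_ramp'_K : leb.-integrable K (EFin \o ramp').
Proof.
apply: continuous_compact_integrable; first exact: segment_compact.
apply: continuous_subspaceT; exact: continuous_derive1_ramp.
Qed.

Lemma integrable_derive1_ramp_mul :
  leb.-integrable D (EFin \o (fun x => derive1 (ramp alpha eta) x * k x)).
Proof.
rewrite -/ramp' ramp'kE -restrict_EFin.
by apply/(integrable_restrict leb mK mD _); rewrite setIidr.
Qed.

(** The derivative of the ramp is a probability density. *)
Lemma ramp_average :
  `|\int[leb]_(x in D) (derive1 (ramp alpha eta) x * k x) - kappa| <= eps.
Proof.
rewrite -/ramp' ramp'kE -Rintegral_mkcondr setIidr//.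
have iR : \int[leb]_(x in K) ramp' x = 1.
  by rewrite /Rintegral integral_derive1_ramp.
have -> : \int[leb]_(x in K) (ramp' x * k x) - kappa =
   \int[leb]_(x in K) (ramp' x * (k x - kappa)).
  under [RHS]eq_Rintegral do rewrite mulrBr.
  rewrite RintegralB//.
    by rewrite RintegralZr// iR mul1r.
  by under [X in _.-integrable _ X]eq_fun do rewrite /= EFinM; exact: integrableZr.
have ii : leb.-integrable K (EFin \o (fun x => ramp' x * (k x - kappa))).
  apply: continuous_compact_integrable; first exact: segment_compact.
  apply: continuous_in_subspaceT => x; rewrite inE/K/= in_itv/= => xK.
  apply: continuousM; first exact: continuous_derive1_ramp.
  by apply: continuousB; [exact: ck|exact: cst_continuous].
apply: (le_trans (le_normr_Rintegral mK ii)).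
apply: (@le_trans _ _ (\int[leb]_(x in K) (ramp' x * eps))).
  apply: le_Rintegral => //.
  - rewrite (_ : _ \o _ = (abse \o (EFin \o (fun x => ramp' x * (k x - kappa)%R)%R))%E)//.
    exact: integrable_abse.
  - by under [X in _.-integrable _ X]eq_fun do rewrite /= EFinM; exact: integrableZr.
  - move=> x; rewrite /K/= in_itv/= => xK.
    rewrite normrM ger0_norm ?derive1_ramp_ge0// ler_wpM2l ?derive1_ramp_ge0//.
    exact: kk.
by rewrite RintegralZr// iR mul1r.
Qed.
End ramp_average.

Lemma dist_swap (A B x y e J : R) : `|A - x| <= e -> `|B - y| <= e ->
  `|A - B| <= J -> `|y - x| <= e + e + J.
Proof.
rewrite !ler_norml => /andP[? ?] /andP[? ?] /andP[? ?]; apply/andP; split; lra.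
Qed.

(** Test the weak derivative against a ramp up just after [s] minus a ramp up
    just before [t]. This function is supported in [[s, t]] and bounded by 1, so
    the weak derivative contributes at most the integral of its norm, while its
    derivative averages [g] near [s] and near [t]. Pairing with
    [e = g t - g s] and letting the ramps steepen gives the square norm of [e]. *)
Lemma W11_abs_cont g T delta : 0 < delta < T -> W11 T g -> continuous_on_nonneg g ->
  exists M : measurableTypeR R -> R,
  [/\ forall x, 0 <= M x, leb.-integrable setT (EFin \o M) &
   forall s t, delta < s -> s < t -> t < T ->
     nrm (g t - g s) <= \int[leb]_(x in `]s, t[) M x].
Proof.
move=> dT [_ /(_ _ dT)[v [L1v wd]]] cg.
have [d0 dltT] := andP dT.
pose D : set (measurableTypeR R) := `]delta, T[%classic.
have mD : measurable D by exact: measurable_itv.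
have Doo : (leb D < +oo)%E.
  by rewrite /D lebesgue_measure_itv/=; case: ifP; rewrite ?ltry// -EFinB ltry.
have [N [M [mN N0 M0 iM vM]]] := L1_nrm_majorant mD Doo L1v.
exists M; split => // s t ds st tT.
set e := g t - g s.
set J := \int[leb]_(x in `]s, t[) M x.
have key : `|inner e e| <= nrm e * J.
  apply/ler_addgt0Pl => eps2 eps20.
  pose eps := eps2 / 2; have eps0 : 0 < eps by rewrite divr_gt0.
  pose k x := inner (g x) e.
  have ck x : 0 < x -> {for x, continuous k} by exact: continuous_inner.
  have s0 : 0 < s := lt_trans d0 ds.
  have t0 : 0 < t := lt_trans s0 st.
  have [h1 h10 k1] : exists2 h, 0 < h & forall x, `|x - s| < h -> `|k x - k s| <= eps.
    have /cvgrPdist_le/(_ _ eps0)/nbhs_ballP[h /= h0 H] := ck s s0.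
    by exists h => // x xh; rewrite distrC; apply: H; rewrite /ball/= distrC.
  have [h2 h20 k2] : exists2 h, 0 < h & forall x, `|x - t| < h -> `|k x - k t| <= eps.
    have /cvgrPdist_le/(_ _ eps0)/nbhs_ballP[h /= h0 H] := ck t t0.
    by exists h => // x xh; rewrite distrC; apply: H; rewrite /ball/= distrC.
  pose eta := Num.min (t - s) (Num.min h1 h2) / 2.
  have m0 : 0 < Num.min (t - s) (Num.min h1 h2) by rewrite !lt_min subr_gt0 st h10 h20.
  have eta0 : 0 < eta by rewrite divr_gt0.
  have [e1 e2 e3] : [/\ eta < t - s, eta < h1 & eta < h2].
    have : eta < Num.min (t - s) (Num.min h1 h2).
      by rewrite /eta ltr_pdivrMr// ltr_pMr// ltr1n.
    by rewrite !lt_min => /and3P[].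
  pose phi x := ramp s eta x - ramp (t - eta) eta x.
  have sphi n : smooth_upto n phi.
    rewrite (_ : phi = fun x => ramp s eta x + (-1) * ramp (t - eta) eta x).
      apply: smoothD; first exact: smooth_ramp.
      by apply: smoothM; [exact: smooth_cst|exact: smooth_ramp].
    by apply/funext => x; rewrite mulN1r.
  have dphi x : derive1 phi x = derive1 (ramp s eta) x - derive1 (ramp (t - eta) eta) x.
    by rewrite !derive1E deriveB//; exact: derivable_ramp.
  have phi0 x : ~~ (s < x < t) -> phi x = 0.
    rewrite negb_and -!leNgt => /orP[xs|tx].
      by rewrite /phi !ramp_le ?subrr//; lra.
    by rewrite /phi !ramp_ge ?subrr//; lra.
  have phi1 x : `|phi x| <= 1.
    have := ramp_ge0 s eta x; have := ramp_le1 s eta x.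
    have := ramp_ge0 (t - eta) eta x; have := ramp_le1 (t - eta) eta x.
    by rewrite /phi ler_norml => *; lra.
  have supp_phi : closure [set x | phi x != 0] `<=` `[s, t].
    rewrite [X in _ `<=` X](closure_id _).1; last exact: itv_closed.
    apply: closureS => x /= phix; rewrite in_itv/=.
    by apply: contraNT phix => sxt; rewrite phi0//; apply: contra sxt => /andP[/ltW-> /ltW->].
  have tphi : test_function D phi.
    split.
    - by move=> n; exact: smooth_derive1n.
    - apply: (@subclosed_compact _ _ `[s, t]%classic) => //.
      + exact: closed_closure.
      + exact: segment_compact.
    - move=> x /supp_phi; rewrite /D/= !in_itv/= => /andP[sx xt].
      by rewrite (lt_le_trans ds sx) (le_lt_trans xt tT).
  have [I [bI1 bI2]] := wd _ tphi.
  have inK1 x : s <= x <= s + eta -> `|x - s| < h1.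
    by move=> ?; rewrite ltr_norml; lra.
  have inK2 x : t - eta <= x <= t - eta + eta -> `|x - t| < h2.
    by move=> ?; rewrite ltr_norml; lra.
  have KD1 : `[s, s + eta] `<=` D.
    by move=> x; rewrite /D/= !in_itv/= => ?; lra.
  have KD2 : `[t - eta, t - eta + eta] `<=` D.
    by move=> x; rewrite /D/= !in_itv/= => ?; lra.
  have ck1 x : s <= x <= s + eta -> {for x, continuous k}.
    by move=> ?; apply: ck; lra.
  have ck2 x : t - eta <= x <= t - eta + eta -> {for x, continuous k}.
    by move=> ?; apply: ck; lra.
  have i1 := integrable_derive1_ramp_mul eta0 ck1 mD KD1.
  have i2 := integrable_derive1_ramp_mul eta0 ck2 mD KD2.
  have a1 := ramp_average eta0 ck1 (fun x xK => k1 x (inK1 x xK)) KD1.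
  have a2 := ramp_average eta0 ck2 (fun x xK => k2 x (inK2 x xK)) KD2.
  have Ie : inner I e =
     \int[leb]_(x in D) (derive1 (ramp s eta) x * k x) -
     \int[leb]_(x in D) (derive1 (ramp (t - eta) eta) x * k x).
    rewrite -(RintegralB mD i1 i2).
    have E x : inner (derive1 phi x *: g x) e =
        derive1 (ramp s eta) x * k x - derive1 (ramp (t - eta) eta) x * k x.
      by rewrite innerZl dphi mulrBl.
    rewrite (@inner_Bochner _ _ _ _ e mD Doo bI1).
      by apply: eq_Rintegral => x _; exact: E.
    under [X in _.-integrable _ X]eq_fun do rewrite /= E EFinB.
    exact: (integrableB mD i1 i2).
  have J1 : `|inner (- I) e| <= nrm e * J.
    have -> : J = \int[leb]_(x in D) (M \_ `]s, t[) x.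
      rewrite -Rintegral_mkcondr setIidr// => x.
      by rewrite /D/= !in_itv/= => /andP[sx xt]; rewrite (lt_trans ds sx) (lt_trans xt tT).
    apply: (@inner_Bochner_le _ _ N _ _ e (M \_ `]s, t[) mD Doo bI2 mN N0) => //.
    - rewrite -restrict_EFin; apply/(integrable_restrict leb _ mD _); first exact: measurable_itv.
      by apply: integrableS iM => //; apply: measurableI => //; exact: measurable_itv.
    - by move=> x; rewrite patchE; case: ifP.
    - move=> x Dx Nx; rewrite nrmZ patchE; case: ifPn => xst.
        rewrite (le_trans _ (vM x Dx Nx))// ler_piMl ?nrm_ge0//.
      rewrite phi0 ?normr0 ?mul0r//; apply: contra xst => xst.
      by rewrite inE/= in_itv.
  have -> : inner e e = k t - k s by rewrite /k -innerBl.
  have -> : eps2 = eps + eps by rewrite /eps -splitr.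
  by apply: dist_swap a1 a2 _; rewrite -Ie -normrN -innerNl.
have J0 : 0 <= J by apply: Rintegral_ge0.
have [->//|e0] := eqVneq (nrm e) 0.
have ep : 0 < nrm e by rewrite lt_neqAle eq_sym e0 nrm_ge0.
by move: key; rewrite -nrm_sqr ger0_norm ?sqr_ge0// expr2 ler_pM2l.
Qed.

End absolute_continuity.

(** * A barrier principle for absolutely continuous paths *)

Section barrier.
Context {R : realType}.
Local Notation leb := (@lebesgue_measure R).

Section ae_nonincreasing.
Variables (f : R -> R) (m : measurableTypeR R -> R) (alpha beta : R)
  (N : set (measurableTypeR R)).
Hypotheses (alpha_beta : alpha < beta) (m0 : forall x, 0 <= m x)
  (im : leb.-integrable setT (EFin \o m))
  (fm : forall x y, alpha <= x -> x < y -> y <= beta ->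
     f y - f x <= \int[leb]_(z in `]x, y[) m z)
  (mN : measurable N) (N0 : leb N = 0%E)
  (fN : forall t, alpha <= t < beta -> ~ N t -> forall eps, 0 < eps ->
     exists2 eta, 0 < eta & forall k, 0 < k < eta -> f (t + k) - f t <= eps * k).

Let subset_int (A B : set (measurableTypeR R)) : measurable A -> measurable B ->
  A `<=` B -> \int[leb]_(z in A) m z <= \int[leb]_(z in B) m z.
Proof.
move=> mA mB AB.
have iA : leb.-integrable A (EFin \o m) by exact: integrableS im.
have iB : leb.-integrable B (EFin \o m) by exact: integrableS im.
rewrite -lee_fin !EFin_Rintegral//; apply: ge0_subset_integral => //.
- by case/integrableP : iB.
- by move=> x _; rewrite lee_fin.
Qed.

(** The exceptional null set sits in an open set over which the majorant has a
    small integral; the increments of [f] are charged to that integral when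
    they start in the exceptional set, and to the derivative otherwise. *)
Lemma ae_nonincreasing : f beta <= f alpha.
Proof.
have key eps : 0 < eps -> f beta <= f alpha + eps * (1 + (beta - alpha)).
  move=> eps0.
  have [d [d0 dA]] := integral_normr_continuous im eps0.
  have smallm A : measurable A -> (leb A < d%:E)%E -> \int[leb]_(x in A) m x < eps.
    move=> mA lA; rewrite (le_lt_trans _ (dA A mA lA))//.
    by rewrite le_eqVlt; apply/orP; left; apply/eqP/eq_Rintegral => x _; rewrite ger0_norm.
  have Noo : (leb N < +oo)%E by rewrite N0 ltry.
  have [U [oU NU Ud]] := lebesgue_regularity_outer mN Noo d0.
  have mU : measurable (U : set (measurableTypeR R)) by exact: open_measurable.
  have Ud' : (leb U < d%:E)%E.
    apply: le_lt_trans Ud.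
    have mD : measurable (U `\` N) by exact: measurableD.
    have -> : leb U = (leb N + leb (U `\` N))%E.
      by rewrite -measureU ?setDIK// setDUK.
    by rewrite N0 add0e.
  pose G t := \int[leb]_(z in U `&` `]alpha, t[) m z.
  have mUI t : measurable (U `&` `]alpha, t[ : set (measurableTypeR R)).
    by apply: measurableI => //; exact: measurable_itv.
  have Gmono s t : s <= t -> G s <= G t.
    by move=> st; apply: subset_int => //; apply: setIS; apply: subset_itvl; rewrite bnd_simp.
  have Glt t : G t < eps.
    apply: smallm => //; apply: le_lt_trans Ud'.
    by rewrite le_measure ?inE//; exact: subIsetl.
  pose S := [set t | alpha <= t <= beta /\
    f t <= f alpha + G t + eps * (t - alpha)].
  have G0 t : 0 <= G t by apply: Rintegral_ge0.
  have Sa : S alpha.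
    by split; [rewrite lexx ltW|rewrite subrr mulr0 addr0 lerDl].
  have hS : has_sup S.
    by split; [exists alpha|exists beta => t [/andP[]]].
  set sigma := sup S.
  have as_ : alpha <= sigma by exact: (sup_ubound (proj2 hS) Sa).
  have sb : sigma <= beta.
    by apply: ge_sup => // [|t [/andP[]]//]; exists alpha.
  have Ps : S sigma.
    split; first by rewrite as_ sb.
    apply/ler_addgt0Pr => e e0.
    have [d' [d'0 d'A]] := integral_normr_continuous im e0.
    have [t St st] := sup_adherent d'0 hS.
    have ts : t <= sigma by exact: (sup_ubound (proj2 hS) St).
    have [tas ft] := St.
    move: ts; rewrite le_eqVlt => /predU1P[<-|ts].
      by rewrite (le_trans ft)// lerDl ltW.
    have := fm (proj1 (andP tas)) ts sb.
    have : \int[leb]_(z in `]t, sigma[) m z < e.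
      have mA : measurable (`]t, sigma[%classic : set (measurableTypeR R)).
        exact: measurable_itv.
      apply: le_lt_trans (d'A _ mA _).
        rewrite le_eqVlt; apply/orP; left; apply/eqP/eq_Rintegral => x _.
        by rewrite ger0_norm.
      have lA : leb `]t, sigma[%classic = (sigma - t)%:E.
        by rewrite lebesgue_measure_itv/= lte_fin ts EFinB.
      suff : (leb `]t, sigma[%classic < d'%:E)%E by [].
      by rewrite lA lte_fin; rewrite -/sigma in st; lra.
    have := Gmono t sigma (ltW ts).
    have : eps * (t - alpha) <= eps * (sigma - alpha).
      by rewrite ler_pM2l// lerB// ltW.
    lra.
  have [_ fs] := Ps.
  have -> : beta = sigma.
    apply/eqP; rewrite eq_le sb andbT leNgt; apply/negP => sltb.
    suff [k k0 Sk] : exists2 k, 0 < k & S (sigma + k).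
      by have := sup_ubound (proj2 hS) Sk; rewrite -/sigma leNgt ltrDl k0.
    have [Ns|Ns] := pselect (N sigma).
      have /nbhs_ballP[r /= r0 rU] : nbhs sigma U by apply: open_nbhs_nbhs; split => //; exact: NU.
      pose k := Num.min r (beta - sigma) / 2.
      have mr : 0 < Num.min r (beta - sigma) by rewrite lt_min r0 subr_gt0.
      have k0 : 0 < k by rewrite divr_gt0.
      have : k < Num.min r (beta - sigma) by rewrite ltr_pdivrMr// ltr_pMr// ltr1n.
      rewrite lt_min => /andP[kr kb].
      exists k => //; split; first by apply/andP; split; lra.
      have h1 : f (sigma + k) - f sigma <= \int[leb]_(z in `]sigma, sigma + k[) m z.
        by apply: fm => //; lra.
      have h2 : G sigma + \int[leb]_(z in `]sigma, sigma + k[) m z <= G (sigma + k).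
        rewrite /G -Rintegral_setU//.
        - apply: subset_int => //.
            by apply: measurableU => //; exact: measurable_itv.
          rewrite subUset; split.
            by apply: setIS; apply: subset_itvl; rewrite bnd_simp; lra.
          rewrite subsetI; split; last by apply: subset_itv; rewrite bnd_simp; lra.
          move=> x xs; have {xs}/andP[x1 x2] : sigma < (x : R) < sigma + k := xs.
          by apply: rU; rewrite /ball/= ltr_norml; lra.
        - by apply: integrableS im => //; apply: measurableU => //; exact: measurable_itv.
        - apply/disj_setPS => x [[_ xa] xs].
          have /andP[_ x1] : alpha < (x : R) < sigma := xa.
          have /andP[x2 _] : sigma < (x : R) < sigma + k := xs.
          by have := lt_trans x1 x2; rewrite ltxx.
      have : eps * (sigma + k - alpha) = eps * (sigma - alpha) + eps * k by ring.
      have : 0 < eps * k by rewrite mulr_gt0.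
      lra.
    have ss : alpha <= sigma < beta by rewrite as_.
    have [eta eta0 H] := fN ss Ns eps0.
    pose k := Num.min eta (beta - sigma) / 2.
    have mr : 0 < Num.min eta (beta - sigma) by rewrite lt_min eta0 subr_gt0.
    have k0 : 0 < k by rewrite divr_gt0.
    have : k < Num.min eta (beta - sigma) by rewrite ltr_pdivrMr// ltr_pMr// ltr1n.
    rewrite lt_min => /andP[kr kb].
    exists k => //; split; first by apply/andP; split; lra.
    have ke : 0 < k < eta by rewrite k0.
    have := H k ke.
    have := Gmono sigma (sigma + k) ltac:(by rewrite lerDl ltW).
    have : eps * (sigma + k - alpha) = eps * (sigma - alpha) + eps * k by ring.
    lra.
  have := Glt sigma; have : eps * (1 + (sigma - alpha)) = eps + eps * (sigma - alpha) by ring.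
  lra.
apply/ler_addgt0Pr => e e0.
have c0 : 0 < 1 + (beta - alpha) by rewrite addr_gt0// subr_gt0.
by have := key _ (divr_gt0 e0 c0); rewrite divfK// gt_eqF.
Qed.
End ae_nonincreasing.

Implicit Types u v w e d : L2 R.

Lemma exists_pos u : exists v : L2 R, forall s, 0 < s < 1 -> v s = Num.max 0 (u s).
Proof.
apply: (exists_L2_dominated (v := u)).
  by apply: measurable_maxr => //; exact: L2_measurable_on.
move=> s _; rewrite ger0_norm ?le_max ?lexx//.
by rewrite ge_max normr_ge0 ler_norm.
Qed.

(** Elements of the space are functions with measurability built in, so the
    positive part is chosen; it is determined on (0, 1). *)
Definition pos u : L2 R := sval (cid (exists_pos u)).

Lemma pos_valE u s : 0 < s < 1 -> pos u s = Num.max 0 (u s).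
Proof. by move=> s01; rewrite /pos; case: cid => v /= ->. Qed.

Lemma ae_le0_pos u : nrm (pos u) = 0 -> {ae leb, forall s, 0 < s < 1 -> u s <= 0}.
Proof.
move=> h; have : inner (pos u) (pos u) = 0 by rewrite -nrm_sqr h expr0n.
move/inner_self_eq0; apply: ae_imp => s + s01 => /(_ s01).
by rewrite pos_valE// => <-; rewrite le_max lexx orbT.
Qed.

Lemma nrm_pos_le u : nrm (pos u) <= nrm u.
Proof.
apply: nrm_le; rewrite ?nrm_ge0// nrm_sqr; apply: ae_le_inner.
apply: aeW => s s01; rewrite pos_valE// -!expr2.
by case: (leP 0 (u s)) => // _; rewrite expr0n sqr_ge0.
Qed.

(** The squared positive part is convex with a derivative of Lipschitz constant
    2: pointwise, the positive part of [v] is at most the positive part of [w]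
    plus [v - w] wherever [v >= 0]. *)
Lemma pos_expand w v : nrm (pos v) ^+ 2 <=
  nrm (pos w) ^+ 2 + 2 * inner (pos w) (v - w) + nrm (v - w) ^+ 2.
Proof.
apply: (@le_trans _ _ (nrm (pos w + (v - w)) ^+ 2)); last first.
  move: (pos w) (v - w) => x z.
  by rewrite !nrm_sqr innerDl !innerDr (innerC z x); lra.
rewrite !nrm_sqr; apply: ae_le_inner.
apply: aeW => s s01 /=; rewrite -!expr2 !pos_valE//.
have [v0|v0] := leP 0 (v s); last by rewrite expr0n sqr_ge0.
have h : v s <= (pos w + (v - w)) s.
  suff : v s <= pos w s + (v s - w s) by [].
  by rewrite pos_valE// addrCA lerDl subr_ge0 le_max lexx orbT.
by apply: lerXn2r; rewrite ?nnegrE// (le_trans v0 h).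
Qed.

(** If [w] never points outwards where it is positive, its positive part stays
    null. The squared norm [Phi] is used because its one-sided derivative is
    twice the pairing of the positive part with the velocity, including at times
    when the positive part vanishes. *)
Section barrier_lemma.
Variable w : R -> L2 R.
Hypotheses
  (w_ac : forall delta T, 0 < delta < T -> exists m : measurableTypeR R -> R,
    [/\ forall x, 0 <= m x, leb.-integrable setT (EFin \o m) &
     forall s t, delta < s -> s < t -> t < T ->
       nrm (w t - w s) <= \int[leb]_(x in `]s, t[) m x])
  (w_cont : forall eps, 0 < eps -> exists2 eta, 0 < eta &
     forall s, 0 <= s -> s < eta -> nrm (w s - w 0) < eps)
  (w_der : {ae leb, forall t, 0 < t -> exists d,
     (forall eps, 0 < eps -> exists2 eta, 0 < eta & forall k, 0 < k < eta ->
        nrm (w (t + k) - w t - k *: d) <= eps * k) /\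
     inner (pos (w t)) d <= 0})
  (w0 : nrm (pos (w 0)) = 0).

Let Phi t := nrm (pos (w t)) ^+ 2.

Let Phi_nonincreasing alpha beta : 0 < alpha -> alpha < beta -> Phi beta <= Phi alpha.
Proof.
move=> a0 ab; have [N [mN N0 derN]] := w_der.
have dT : 0 < alpha / 2 < beta + 1 by apply/andP; split; lra.
have [m [m0 im wm]] := w_ac dT.
pose J := \int[leb]_x m x.
have J0 : 0 <= J by apply: Rintegral_ge0.
have leJ (A : set (measurableTypeR R)) : measurable A -> \int[leb]_(x in A) m x <= J.
  move=> mA; rewrite -lee_fin !EFin_Rintegral//; last exact: integrableS im.
  apply: ge0_subset_integral => //.
  - by case/integrableP : im.
  - by move=> x _; rewrite lee_fin.
(* [B] bounds the norm of [w], which makes [Phi] absolutely continuous. *)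
pose B := nrm (w alpha) + J.
have B0 : 0 <= B by rewrite addr_ge0 ?nrm_ge0.
have wB x : alpha <= x -> x <= beta -> nrm (w x) <= B.
  rewrite le_eqVlt => /predU1P[<- _|ax xb]; first by rewrite lerDl.
  rewrite -[X in nrm X](subrK (w alpha)) (le_trans (nrm_triangle _ _))// addrC lerD2l.
  apply: le_trans (leJ `]alpha, x[%classic _); last exact: measurable_itv.
  by apply: wm => //; lra.
apply: (@ae_nonincreasing _ (fun x => 4 * B * m x) _ _ N) => //.
- by move=> x; rewrite !mulr_ge0.
- by under [X in _.-integrable _ X]eq_fun do rewrite /= EFinM; exact: integrableZl.
- move=> x y ax xy yb.
  rewrite RintegralZl//; last first.
    by apply: integrableS im => //; exact: measurable_itv.
  apply: (@le_trans _ _ (4 * B * nrm (w y - w x))); last first.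
    by rewrite ler_wpM2l ?mulr_ge0//; apply: wm => //; lra.
  rewrite /Phi lerBlDr (le_trans (pos_expand (w x) _))//.
  have h1 : inner (pos (w x)) (w y - w x) <= B * nrm (w y - w x).
    rewrite (le_trans (ler_norm _))// (le_trans (cauchy_schwarz _ _))//.
    rewrite ler_wpM2r ?nrm_ge0// (le_trans (nrm_pos_le _))// wB//; lra.
  have h2 : nrm (w y - w x) ^+ 2 <= 2 * B * nrm (w y - w x).
    rewrite expr2 ler_wpM2r ?nrm_ge0// (le_trans (nrm_triangle _ _))// nrmN mulr_natl mulr2n.
    by rewrite lerD ?wB//; lra.
  have -> : 4 * B * nrm (w y - w x) = 2 * (B * nrm (w y - w x)) + 2 * B * nrm (w y - w x) by ring.
  lra.
- move=> t /andP[ta tb] Nt eps eps0.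
  have [d [dd dle]] : exists d,
     (forall eps, 0 < eps -> exists2 eta, 0 < eta & forall k, 0 < k < eta ->
        nrm (w (t + k) - w t - k *: d) <= eps * k) /\
     inner (pos (w t)) d <= 0.
    by apply: contrapT => nd; apply: Nt; apply: derN => /= /(_ (lt_le_trans a0 ta)).
  (* Half of [eps] absorbs the error of the linear term, half the quadratic one. *)
  pose e1 := Num.min 1 (eps / (4 * (B + 1))).
  have B1 : 0 < 4 * (B + 1) by rewrite mulr_gt0// ltr_wpDl.
  have e10 : 0 < e1 by rewrite lt_min ltr01 divr_gt0.
  have [eta eta0 H] := dd _ e10.
  pose q := (nrm d + 1) ^+ 2.
  have q0 : 0 < q by rewrite exprn_gt0// ltr_wpDl ?nrm_ge0.
  have eq0 : 0 < eps / (2 * q) by rewrite divr_gt0// mulr_gt0.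
  exists (Num.min eta (eps / (2 * q))); first by rewrite lt_min eta0.
  move=> k /andP[k0]; rewrite lt_min => /andP[keta keps].
  have ke : 0 < k < eta by rewrite k0.
  have {}H := H k ke.
  rewrite /Phi lerBlDr (le_trans (pos_expand (w t) _))//.
  set r := w (t + k) - w t - k *: d in H.
  have Er : w (t + k) - w t = k *: d + r by rewrite /r [RHS]addrC subrK.
  have h1 : inner (pos (w t)) (w (t + k) - w t) <= B * (e1 * k).
    rewrite Er innerDr innerZr.
    have : k * inner (pos (w t)) d <= 0 by rewrite pmulr_rle0.
    have : inner (pos (w t)) r <= B * (e1 * k).
      rewrite (le_trans (ler_norm _))// (le_trans (cauchy_schwarz _ _))//.
      by rewrite ler_pM ?nrm_ge0// (le_trans (nrm_pos_le _))// wB// ltW.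
    lra.
  have h2 : nrm (w (t + k) - w t) <= (nrm d + 1) * k.
    rewrite Er (le_trans (nrm_triangle _ _))// nrmZ gtr0_norm// mulrDl mulrC lerD2l.
    by rewrite (le_trans H)// ler_pM2r// /e1 ge_min lexx.
  have h3 : nrm (w (t + k) - w t) ^+ 2 <= q * (k * k).
    rewrite (@le_trans _ _ (((nrm d + 1) * k) ^+ 2))//.
      by rewrite ler_sqr ?nnegrE ?nrm_ge0// mulr_ge0 ?ltW// ltr_wpDl ?nrm_ge0.
    by rewrite exprMn expr2.
  have h4 : B * (e1 * k) <= eps / 4 * k.
    rewrite mulrA ler_pM2r//.
    have : e1 <= eps / (4 * (B + 1)) by rewrite /e1 ge_min lexx orbT.
    rewrite ler_pdivlMr// => h4.
    by nra.
  have h5 : q * (k * k) <= eps / 2 * k.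
    rewrite mulrA ler_pM2r//; have q20 : 0 < 2 * q by rewrite pmulr_rgt0.
    move: keps; rewrite (ltr_pdivlMr _ _ q20); clearbody q; lra.
  lra.
Qed.

Lemma barrier t : 0 <= t -> nrm (pos (w t)) = 0.
Proof.
rewrite le_eqVlt => /predU1P[<-//|t0].
suff : Phi t <= 0.
  rewrite le_eqVlt ltNge sqr_ge0 orbF sqrf_eq0 => /eqP//.
apply/ler_addgt0Pr => eps eps0; rewrite add0r.
have se0 : 0 < Num.sqrt eps by rewrite sqrtr_gt0.
have [eta eta0 H] := w_cont se0.
pose a := Num.min eta t / 2.
have m0 : 0 < Num.min eta t by rewrite lt_min eta0.
have a0 : 0 < a by rewrite divr_gt0.
have : a < Num.min eta t by rewrite ltr_pdivrMr// ltr_pMr// ltr1n.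
rewrite lt_min => /andP[aeta at_].
apply: (le_trans (Phi_nonincreasing a0 at_)).
apply: (le_trans (pos_expand (w 0) _)); rewrite w0 expr0n/= add0r.
have -> : inner (pos (w 0)) (w a - w 0) = 0.
  apply/eqP; rewrite -normr_le0 (le_trans (cauchy_schwarz _ _))//.
  by rewrite w0 mul0r.
rewrite mulr0 add0r -[leRHS](sqr_sqrtr (ltW eps0)) ler_sqr ?nnegrE ?nrm_ge0 ?sqrtr_ge0//.
by apply: ltW; apply: H => //; exact: ltW.
Qed.
End barrier_lemma.

End barrier.

(** * Barriers for shifted differences of strong solutions *)

Section barrier_for_solutions.
Context {R : realType}.
Local Notation leb := (@lebesgue_measure R).

(** The barrier principle for [P (g t) - c t *: e]. The hypothesis [PK] is
    boundedness of a linear map, in a form that only involves norms, hence only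
    values on (0, 1). *)
Section barrier_for_solutions_lemma.
Variables (G : L2 R -> R) (q0 : R -> R) (g : R -> L2 R).
Hypothesis sol : strong_solution G q0 g.
Variables (P : L2 R -> L2 R) (K : R) (c c' : R -> R) (kappa : R) (e : L2 R).
Hypotheses (K0 : 0 <= K) (kappa0 : 0 <= kappa)
  (PK : forall x y z k, nrm (P x - P y - k *: P z) <= K * nrm (x - y - k *: z))
  (c_lip : forall s t, 0 <= s -> 0 <= t -> `|c t - c s| <= kappa * `|t - s|)
  (c_der : forall t eps, 0 < t -> 0 < eps -> exists2 eta, 0 < eta &
     forall k, 0 < k < eta -> `|c (t + k) - c t - k * c' t| <= eps * k).

Let w t := P (g t) - c t *: e.

Let nrm_wB s t : 0 <= s -> 0 <= t ->
  nrm (w t - w s) <= K * nrm (g t - g s) + kappa * nrm e * `|t - s|.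
Proof.
move=> s0 t0.
have -> : w t - w s = (P (g t) - P (g s) - 0 *: P 0) - (c t - c s) *: e.
  rewrite scale0r subr0 scalerBl /w.
  by move: (P _) (P (g s)) (c t *: e) (c s *: e) => x y p q;
    apply/LfuneqP => r; rewrite !L2E; ring.
rewrite (le_trans (nrm_triangle _ _))// nrmN nrmZ lerD//.
  by rewrite (le_trans (PK _ _ _ _))// scale0r subr0.
by rewrite mulrAC ler_wpM2r ?nrm_ge0// c_lip.
Qed.

Let w_ac delta T : 0 < delta < T -> exists m : measurableTypeR R -> R,
    [/\ forall x, 0 <= m x, leb.-integrable setT (EFin \o m) &
     forall s t, delta < s -> s < t -> t < T ->
       nrm (w t - w s) <= \int[leb]_(x in `]s, t[) m x].
Proof.
move=> dT; have [d0 dltT] := andP dT; have T0 := lt_trans d0 dltT.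
have [W cg _ _] := sol.
have [M [M0 iM gM]] := W11_abs_cont dT (W T T0) cg.
pose I : set (measurableTypeR R) := `]0, T[%classic.
have mI : measurable I by exact: measurable_itv.
have lI : (leb I < +oo)%E.
  by rewrite /I lebesgue_measure_itv/= lte_fin T0 -EFinB ltry.
pose C := kappa * nrm e.
have C0 : 0 <= C by rewrite mulr_ge0 ?nrm_ge0.
have i1 : leb.-integrable setT (EFin \o (fun x => K * M x)).
  by under [X in _.-integrable _ X]eq_fun do rewrite /= EFinM; exact: integrableZl.
have i2 : leb.-integrable setT (EFin \o ((cst C : measurableTypeR R -> R) \_ I)).
  rewrite -restrict_EFin; apply/(integrable_restrict leb mI measurableT _).
  rewrite setTI; apply: (integrable_of_bounded (C := C)) => // t _.
  by rewrite ger0_norm.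
exists (fun x => K * M x + (cst C \_ I) x); split.
- move=> x; rewrite addr_ge0// ?mulr_ge0// patchE.
  by case: ifP.
- by under [X in _.-integrable _ X]eq_fun do rewrite /= EFinD; exact: integrableD.
- move=> s t ds st tT.
  have s0 : 0 < s := lt_trans d0 ds.
  rewrite (le_trans (nrm_wB (ltW s0) (ltW (lt_trans s0 st))))//.
  have mst : measurable (`]s, t[%classic : set (measurableTypeR R)).
    exact: measurable_itv.
  rewrite RintegralD//; [|by apply: integrableS i1|by apply: integrableS i2].
  rewrite RintegralZl//; last by apply: integrableS iM.
  apply: lerD; first by rewrite ler_wpM2l// gM.
  rewrite -Rintegral_mkcondr setIidl; last first.
    by apply: subset_itv; rewrite bnd_simp ltW.
  rewrite Rintegral_cst//= lebesgue_measure_itv/= lte_fin st/=.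
  by rewrite gtr0_norm// subr_gt0.
Qed.

Let w_cont eps : 0 < eps -> exists2 eta, 0 < eta &
     forall s, 0 <= s -> s < eta -> nrm (w s - w 0) < eps.
Proof.
move=> e0; have [_ cg _ _] := sol.
have K1 : 0 < 2 * (K + 1) by rewrite mulr_gt0// ltr_wpDl.
have C0 : 0 <= kappa * nrm e by rewrite mulr_ge0 ?nrm_ge0.
have C1 : 0 < 2 * (kappa * nrm e + 1) by rewrite mulr_gt0// ltr_wpDl.
have [eta eta0 H] := continuous_on_nonnegP cg (lexx 0) (divr_gt0 e0 K1).
exists (Num.min eta (eps / (2 * (kappa * nrm e + 1)))).
  by rewrite lt_min eta0 divr_gt0.
move=> s s0; rewrite lt_min => /andP[se1 se2].
rewrite (le_lt_trans (nrm_wB (lexx 0) s0))// subr0 ger0_norm//.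
have h1 : nrm (g s - g 0) < eps / (2 * (K + 1)).
  by apply: H => //; rewrite subr0 ger0_norm.
rewrite ltr_pdivlMr// in h1; rewrite ltr_pdivlMr// in se2.
have := nrm_ge0 (g s - g 0).
move: (nrm _) (kappa * nrm e) h1 C0 se2 => x C h1 C0 se2 x0.
nra.
Qed.

Let w_der (H : forall t d, 0 < t -> subdifferential G (g t) (- d) ->
    inner (pos (w t)) (P d - c' t *: e) <= 0) :
  {ae leb, forall t, 0 < t -> exists d,
     (forall eps, 0 < eps -> exists2 eta, 0 < eta & forall k, 0 < k < eta ->
        nrm (w (t + k) - w t - k *: d) <= eps * k) /\
     inner (pos (w t)) d <= 0}.
Proof.
have [_ _ _] := sol; apply: ae_imp => t + t0 => /(_ t0)[d [sd sub]].
exists (P d - c' t *: e); split; last exact: H.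
move=> eps eps0.
have K1 : 0 < 2 * (K + 1) by rewrite mulr_gt0// ltr_wpDl.
have E1 : 0 < 2 * (nrm e + 1) by rewrite mulr_gt0// ltr_wpDl ?nrm_ge0.
have [eta1 eta10 H1] := c_der t0 (divr_gt0 eps0 E1).
have /cvgrPdist_lt/(_ _ (divr_gt0 eps0 K1)) := sd.
rewrite near_withinE => /nbhs_ballP[eta2 /= eta20 H2].
exists (Num.min eta1 eta2); first by rewrite lt_min eta10.
move=> k /andP[k0]; rewrite lt_min => /andP[k1 k2].
have {}H1 := H1 k ltac:(by rewrite k0).
have {}H2 : nrm (k^-1 *: (g (t + k) - g t) - d) < eps / (2 * (K + 1)).
  have := H2 k; rewrite /ball/= !sub0r !normrN (gtr0_norm k0) => /(_ k2).
  by rewrite gt_eqF// => /(_ isT); rewrite ger0_norm ?nrm_ge0.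
have -> : w (t + k) - w t - k *: (P d - c' t *: e) =
   (P (g (t + k)) - P (g t) - k *: P d) - (c (t + k) - c t - k * c' t) *: e.
  rewrite !scalerBl scalerBr scalerA /w.
  move: (P _) (P (g t)) (k *: P d) (c (t + k) *: e) (c t *: e) ((k * c' t) *: e).
  move=> x y z p q r; apply/LfuneqP => s; rewrite !L2E; ring.
rewrite (le_trans (nrm_triangle _ _))// nrmN nrmZ.
have h1 : nrm (P (g (t + k)) - P (g t) - k *: P d) <= K * (eps / (2 * (K + 1)) * k).
  rewrite (le_trans (PK _ _ _ _))// ler_wpM2l//.
  have -> : g (t + k) - g t - k *: d = k *: (k^-1 *: (g (t + k) - g t) - d).
    by rewrite scalerBr scalerA divff ?gt_eqF// scale1r.
  by rewrite nrmZ gtr0_norm// mulrC ler_pM2r// ltW.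
have h2 : K * (eps / (2 * (K + 1)) * k) <= eps / 2 * k.
  rewrite mulrA ler_pM2r// mulrA ler_pdivrMr//.
  have : 0 <= eps := ltW eps0.
  nra.
have h3 : `|c (t + k) - c t - k * c' t| * nrm e <= eps / (2 * (nrm e + 1)) * k * nrm e.
  by rewrite ler_wpM2r ?nrm_ge0.
have h4 : eps / (2 * (nrm e + 1)) * k * nrm e <= eps / 2 * k.
  rewrite mulrAC ler_pM2r// mulrAC ler_pdivrMr//.
  have : 0 <= eps := ltW eps0.
  nra.
lra.
Qed.

Lemma barrier_solution :
  (forall t d, 0 < t -> subdifferential G (g t) (- d) ->
    inner (pos (P (g t) - c t *: e)) (P d - c' t *: e) <= 0) ->
  nrm (pos (P (g 0) - c 0 *: e)) = 0 ->
  forall t, 0 <= t -> nrm (pos (P (g t) - c t *: e)) = 0.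
Proof. by move=> H w0 t t0; apply: (barrier w_ac w_cont (w_der H) w0). Qed.

End barrier_for_solutions_lemma.

Section translation.
Implicit Types (h x : R) (N : set (measurableTypeR R)).

Lemma measurable_translation h :
  measurable_fun setT (fun x : measurableTypeR R => (x + h : measurableTypeR R)).
Proof. exact: measurable_funD. Qed.

(** Lebesgue measure is determined by its values on intervals. *)
Lemma lebesgue_translation h N : measurable N ->
  leb ((fun x => x + h) @^-1` N) = leb N.
Proof.
move=> mN.
have mh := measurable_translation h.
apply/esym; apply: (@lebesgue_measure_unique R
  (pushforward leb (fun x : measurableTypeR R => (x + h : measurableTypeR R)))) => // _ [[a b]] _ <-.
have E : (fun x : R => x + h) @^-1` `]a, b]%classic = `]a - h, b - h]%classic.
  by apply/seteqP; split => x /=; rewrite !in_itv/= ltrBlDr lerBrDr.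
suff : leb `]a, b]%classic = leb ((fun x : R => x + h) @^-1` `]a, b]%classic) by [].
rewrite E !lebesgue_measure_itv/= !lte_fin ltrD2r.
by case: ifP => // _; rewrite -!EFinB; congr EFin; ring.
Qed.

Lemma ge0_integral_translation h N (f : measurableTypeR R -> \bar R) :
  measurable N -> measurable_fun N f -> (forall x, N x -> 0 <= f x)%E ->
  (\int[leb]_(x in (fun x => (x + h)%R) @^-1` N) f (x + h)%R =
   \int[leb]_(x in N) f x)%E.
Proof.
move=> mN mf f0.
have mh := measurable_translation h.
rewrite -(@ge0_integral_pushforward _ _ _ _ R
  (fun x : measurableTypeR R => (x + h : measurableTypeR R)) mh leb N f)//.
  by apply: eq_measure_integral => A mA _; exact: lebesgue_translation.
by move=> x /set_mem; exact: f0.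
Qed.

Lemma ae_translation h (Q : measurableTypeR R -> Prop) :
  {ae leb, forall s, Q s} -> {ae leb, forall s, Q (s + h)}.
Proof.
move=> [N [mN N0 QN]]; exists ((fun x => x + h) @^-1` N); split.
- by rewrite -[X in measurable X]setTI; exact: measurable_translation.
- by rewrite lebesgue_translation.
- by move=> x /= nQ; exact: QN.
Qed.
End translation.

(** One operator for the four constraints to be propagated: upper bound
    ([al = 1], [be = 0], [h = 0]), lower bound ([0], [1], [0]), monotonicity
    ([-1], [-1], [h]) and Lipschitz bound ([1], [1], [h]). *)
Section difference_operator.
Variables (al be h : R).
Hypothesis h01 : 0 <= h < 1.
Local Notation I01 := (`]0%R, 1%R[%classic : set (measurableTypeR R)).
Let A : set (measurableTypeR R) := `]0, 1 - h[%classic.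

Let mA : measurable A. Proof. exact: measurable_itv. Qed.
Let AI : A `<=` I01.
Proof. by apply: subset_itvl; rewrite bnd_simp gerBl; case/andP: h01. Qed.
Let shiftA : A `<=` (fun x => x + h) @^-1` I01.
Proof.
move=> x xA; have /andP[x0 x1] : 0 < (x : R) < 1 - h := xA.
suff : 0 < (x : R) + h < 1 by [].
by have /andP[h0 h1] := h01; apply/andP; split; lra.
Qed.

Let translate_exists (u : L2 R) : exists v : L2 R,
  [/\ (forall s, 0 < s < 1 -> v s = u (s + h) * \1_A s) & nrm v <= nrm u].
Proof.
have mu : measurable_fun setT (fun s : measurableTypeR R => u (s + h)).
  exact: (measurableT_comp (L2_measurable u) (measurable_translation h)).
have mI : measurable_fun setT (\1_A : measurableTypeR R -> R).
  exact: measurable_indic.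
have m1 D : measurable_fun D (fun s : measurableTypeR R => u (s + h) * \1_A s).
  by apply: (@measurable_funS _ _ _ _ setT) => //; exact: measurable_funM.
have le1 : (\int[leb]_(s in I01) ((u (s + h) * \1_A s) ^+ 2)%:E <=
    (inner u u)%:E)%E.
  rewrite EFin_Rintegral//; last exact: inner_integrable.
  have <- := @ge0_integral_translation h I01 (fun x => (u x * u x)%:E); last 3 first.
  - exact: measurable_oo01.
  - by apply: measurableT_comp => //; apply: measurable_funM; exact: L2_measurable_on.
  - by move=> x _; rewrite lee_fin -expr2 sqr_ge0.
  have mp : measurable ((fun x : measurableTypeR R => x + h) @^-1` I01).
    by rewrite -[X in measurable X]setTI; exact: measurable_translation.
  have mu2 D : measurable_fun D (fun x : measurableTypeR R => (u (x + h) * u (x + h))%:E).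
    apply: (@measurable_funS _ _ _ _ setT) => //.
    by apply: measurableT_comp => //; exact: measurable_funM.
  apply: (@le_trans _ _ (\int[leb]_(s in A) (u (s + h) * u (s + h))%:E)%E).
    rewrite [leRHS]integral_mkcond [leLHS]integral_mkcond.
    apply: ge0_le_integral => //=.
    - by move=> x _; rewrite patchE; case: ifP => // _; rewrite lee_fin sqr_ge0.
    - apply/(measurable_restrictT _ _).1 => //.
      apply: measurableT_comp => //; exact: measurable_funX.
    - by apply/(measurable_restrictT _ _).1.
    - move=> x _; rewrite !patchE indicE.
      case: ifPn => [xI|_]; case: ifPn => xA //.
      + by rewrite mulr1 expr2.
      + by rewrite mulr0 expr0n.
      + by rewrite lee_fin -expr2 sqr_ge0.
  apply: ge0_subset_integral => //.
  by move=> x _; rewrite lee_fin -expr2 sqr_ge0.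
have [v vE] := @exists_L2 _ _ (m1 I01) (le_lt_trans le1 (ltry _)).
exists v; split => //; apply: nrm_le; first exact: nrm_ge0.
rewrite nrm_sqr -lee_fin (le_trans _ le1)// EFin_Rintegral//; last exact: inner_integrable.
rewrite le_eqVlt; apply/orP; left; apply/eqP; apply: eq_integral => s.
by rewrite inE/= in_itv/= => s01; rewrite vE// expr2.
Qed.

Let cut_exists (u : L2 R) : exists v : L2 R,
  forall s, 0 < s < 1 -> v s = u s * \1_A s.
Proof.
apply: (exists_L2_dominated (v := u)).
  apply: measurable_funM; first exact: L2_measurable_on.
  by apply: (@measurable_funS _ _ _ _ setT) => //; exact: measurable_indic.
move=> s _; rewrite normrM ler_piMr// indicE.
by case: (_ \in _); rewrite ?normr1 ?normr0.
Qed.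

Definition diffop (u : L2 R) : L2 R :=
  al *: sval (cid (translate_exists u)) - be *: sval (cid (cut_exists u)).

Lemma diffopE u s : 0 < s -> s < 1 - h -> diffop u s = al * u (s + h) - be * u s.
Proof.
move=> s0 s1; have s01 : 0 < s < 1.
  by rewrite s0 (lt_le_trans s1)// gerBl; case/andP: h01.
have sA : s \in A by rewrite inE; apply/andP.
rewrite /diffop; case: cid => v vP; case: cid => z zE; have [vE _] := vP.
by rewrite !L2E/= vE// zE// indicE sA !mulr1.
Qed.

Lemma diffop0 u s : 0 < s < 1 -> 1 - h <= s -> diffop u s = 0.
Proof.
move=> s01 s1.
have sA : (s \in A) = false.
  apply: memNset => sA; have /andP[_] : 0 < s < 1 - h := sA.
  by rewrite ltNge s1.
rewrite /diffop; case: cid => v vP; case: cid => z zE; have [vE _] := vP.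
by rewrite !L2E/= vE// zE// indicE sA !mulr0 subr0.
Qed.

Lemma diffop_bounded x y z k :
  nrm (diffop x - diffop y - k *: diffop z) <= (`|al| + `|be|) * nrm (x - y - k *: z).
Proof.
set u := x - y - k *: z.
have -> : nrm (diffop x - diffop y - k *: diffop z) = nrm (diffop u).
  rewrite !nrm_eq_sqrt; congr Num.sqrt.
  have E s : 0 < s < 1 -> (diffop x - diffop y - k *: diffop z) s = diffop u s.
    move=> s01.
    suff : diffop x s - diffop y s - k * diffop z s = diffop u s by [].
    have [s1|s1] := ltP s (1 - h); last by rewrite !diffop0//; ring.
    case/andP: s01 => s0 _; rewrite !diffopE//.
    have Eu r : u r = x r - y r - k * z r by [].
    by rewrite !Eu; ring.
  exact: eq_inner.
rewrite /diffop; case: cid => v vP; case: cid => w wE; have [vE vu] := vP => /=.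
rewrite (le_trans (nrm_triangle _ _))// nrmN !nrmZ mulrDl lerD// ler_wpM2l//.
apply: nrm_le; first exact: nrm_ge0.
rewrite nrm_sqr; apply: ae_le_inner; apply: aeW => s s01.
rewrite (wE s s01) indicE; case: (_ \in _); rewrite ?mulr1// !mulr0.
by rewrite -expr2 sqr_ge0.
Qed.
End difference_operator.

End barrier_for_solutions.

(** * The potential of the target and its subgradients *)

Section potential.
Context {R : realType}.
Local Notation leb := (@lebesgue_measure R).
Local Notation I01 := (`]0%R, 1%R[%classic : set (measurableTypeR R)).

(** One-sided: the Lipschitz condition for non-decreasing functions. *)
Definition lipschitz01 (c : R) (q : R -> R) : Prop :=
  forall s1 s2, 0 < s1 -> s1 < s2 -> s2 < 1 -> q s2 - q s1 <= c * (s2 - s1).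

Lemma lipschitz01_dist c q : nondecreasing01 q -> lipschitz01 c q ->
  forall s1 s2, 0 < s1 < 1 -> 0 < s2 < 1 -> `|q s1 - q s2| <= c * `|s1 - s2|.
Proof.
move=> mq lq.
have key s1 s2 : 0 < s1 -> s1 < s2 -> s2 < 1 -> `|q s1 - q s2| <= c * `|s1 - s2|.
  move=> s10 s12 s21; rewrite distrC (distrC s1) ger0_norm; last first.
    by rewrite subr_ge0 mq ?in_itv/= ?(ltW s12)//; apply/andP; split; lra.
  by rewrite gtr0_norm ?subr_gt0// lq.
move=> s1 s2 /andP[s10 s11] /andP[s20 s21].
have [s12|s12|->] := ltgtP s1 s2; first exact: key.
  by rewrite distrC (distrC s1) key.
by rewrite !subrr normr0 mulr0.
Qed.

Lemma lipschitz01_ge0 c q : nondecreasing01 q -> lipschitz01 c q -> 0 <= c.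
Proof.
move=> mq lq.
have h1 : 0 < (1/3 : R) by lra.
have h2 : (1/3 : R) < 2/3 by lra.
have h3 : (2/3 : R) < 1 by lra.
have := lq _ _ h1 h2 h3.
have : q (1/3) <= q (2/3) by apply: mq; rewrite ?in_itv/=; lra.
lra.
Qed.

Lemma lipschitz01_continuous c q : nondecreasing01 q -> lipschitz01 c q ->
  forall s, 0 < s < 1 -> {for s, continuous q}.
Proof.
move=> mq lq s s01; apply/cvgrPdist_lt => /= e e0.
have c0 := lipschitz01_ge0 mq lq.
have c1 : 0 < c + 1 by rewrite ltr_wpDl.
have /andP[s0 s1] := s01; near=> t.
have t01 : 0 < t < 1.
  apply/andP; split; near: t; [exact: lt_nbhsr|exact: lt_nbhsl].
rewrite (le_lt_trans (lipschitz01_dist mq lq s01 t01))//.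
have st : `|s - t| < e / (c + 1).
  near: t; apply/nbhs_ballP; exists (e / (c + 1)) => //=; exact: divr_gt0.
rewrite ltr_pdivlMr// in st.
have := normr_ge0 (s - t); nra.
Unshelve. all: by end_near. Qed.

(** The intermediate value theorem gives points where [q] equals [z'] and [z];
    they are at distance at least [(z - z') / c]. *)
Lemma level_interval c q z' z t1 t2 : nondecreasing01 q -> lipschitz01 c q ->
  0 < t1 < 1 -> 0 < t2 < 1 -> q t1 < z' -> z' < z -> z < q t2 ->
  exists r1 r2, [/\ 0 < r1, r1 <= r2, r2 < 1, z - z' <= c * (r2 - r1) &
    forall t, r1 <= t <= r2 -> z' <= q t <= z].
Proof.
move=> mq lq t101 t201 q1 zz q2.
have t12 : t1 <= t2.
  rewrite leNgt; apply/negP => /ltW t21.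
  have : q t2 <= q t1 by apply: mq; rewrite ?in_itv.
  lra.
have /andP[t10 t11] := t101; have /andP[t20 t21] := t201.
have cq : {within `[t1, t2], continuous q}.
  apply: continuous_in_subspaceT => t; rewrite inE/= in_itv/= => t12'.
  by apply: (lipschitz01_continuous mq lq); lra.
have q12 : q t1 <= q t2 by lra.
have [r1 + qr1] : exists2 r, r \in `[t1, t2] & q r = z'.
  by apply: IVT => //; rewrite min_l// max_r//; lra.
have [r2 + qr2] : exists2 r, r \in `[t1, t2] & q r = z.
  by apply: IVT => //; rewrite min_l// max_r//; lra.
rewrite !in_itv/= => /andP[r21 r22] /andP[r11 r12].
have r1r2 : r1 < r2.
  rewrite ltNge; apply/negP => r21'.
  have : q r2 <= q r1 by apply: mq; rewrite ?in_itv/=; lra.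
  lra.
exists r1, r2; split; [lra|exact: ltW|lra| |].
- by rewrite -qr1 -qr2; apply: lq; lra.
- by move=> t /andP[h1 h2]; rewrite -qr1 -qr2; apply/andP; split; apply: mq;
    rewrite ?in_itv/=; lra.
Qed.

Variable Q : R -> R.
Variables a b : R.
Hypotheses (mQ : measurable_fun I01 (Q : measurableTypeR R -> R))
  (Qab : forall t, 0 < t < 1 -> a <= Q t <= b).

Definition pot (x : R) : R := \int[leb]_(t in `]0, 1[) `|x - Q t|.

Let integrable_pot x : leb.-integrable I01 (EFin \o (fun t => `|x - Q t|)).
Proof.
apply: (integrable_of_bounded (C := `|x| + (`|a| + `|b|))).
- exact: measurable_oo01.
- by rewrite leb_oo01 ltry.
- by apply: measurableT_comp => //; exact: measurable_funB.
- move=> t It; have /Qab/andP[h1 h2] : 0 < t < 1 := It.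
  rewrite normr_id (le_trans (ler_normB _ _))// lerD2l ler_norml.
  have := ler_norm b; have := ler_norm (- a); rewrite normrN.
  have := normr_ge0 a; have := normr_ge0 b => *; lra.
Qed.

Let integrable_potB x y :
  leb.-integrable I01 (EFin \o (fun t => `|x - Q t| - `|y - Q t|)).
Proof.
rewrite (_ : _ \o _ = (fun t => `|x - Q t|%:E - `|y - Q t|%:E)%E)//.
exact: (integrableB measurable_oo01 (integrable_pot x) (integrable_pot y)).
Qed.

Let potB x y : pot x - pot y = \int[leb]_(t in I01) (`|x - Q t| - `|y - Q t|).
Proof.
by rewrite (RintegralB measurable_oo01 (integrable_pot x) (integrable_pot y)).
Qed.

Let Rintegral01_cst k : \int[leb]_(t in I01) (cst k t) = k.
Proof. by rewrite Rintegral_cst//= leb_oo01 mulr1. Qed.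

Let integrable_cst01 k : leb.-integrable I01 (EFin \o (cst k : measurableTypeR R -> R)).
Proof.
by apply: (integrable_of_bounded (C := `|k|)) => //; rewrite leb_oo01 ltry.
Qed.

Lemma pot_lipschitz x y : `|pot x - pot y| <= `|x - y|.
Proof.
rewrite potB (le_trans (le_normr_Rintegral measurable_oo01 (integrable_potB x y)))//.
rewrite -[leRHS]Rintegral01_cst; apply: le_Rintegral => //.
- rewrite (_ : _ \o _ = (abse \o (EFin \o (fun t => (`|x - Q t| - `|y - Q t|)%R)))%E)//.
  exact: integrable_abse.
- move=> t _ /=; rewrite (le_trans (ler_dist_dist _ _))//.
  by rewrite opprB addrA subrK.
Qed.

Lemma continuous_pot : continuous pot.
Proof.
move=> x; apply/cvgrPdist_lt => /= e e0; near=> y.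
by rewrite (le_lt_trans (pot_lipschitz _ _))//; near: y.
Unshelve. all: by end_near. Qed.

Lemma pot_convex x z th : 0 <= th <= 1 ->
  pot (x + th * (z - x)) - pot x <= th * (pot z - pot x).
Proof.
move=> /andP[th0 th1].
rewrite !potB -(RintegralZl th measurable_oo01 (integrable_potB z x)).
apply: (le_Rintegral measurable_oo01 (integrable_potB _ _)).
- under [X in _.-integrable _ X]eq_fun do rewrite /= EFinM.
  exact: (integrableZl measurable_oo01 th (integrable_potB z x)).
- move=> t _ /=; move: (Q t) => y.
  have -> : x + th * (z - x) - y = th * (z - y) + (1 - th) * (x - y) by ring.
  rewrite lerBlDr (le_trans (ler_normD _ _))// !normrM (ger0_norm th0).
  by rewrite (@ger0_norm _ (1 - th)) ?subr_ge0//; lra.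
Qed.

Definition upper_mass (z : R) : R := fine (leb [set t | 0 < t < 1 /\ z < Q t]).
Definition upper_mass_cl (z : R) : R := fine (leb [set t | 0 < t < 1 /\ z <= Q t]).

Let gtE z : [set t | 0 < t < 1 /\ z < Q t] = I01 `&` Q @^-1` `]z, +oo[.
Proof. by apply/seteqP; split => t /=; rewrite !in_itv/= andbT. Qed.

Let geE z : [set t | 0 < t < 1 /\ z <= Q t] = I01 `&` Q @^-1` `[z, +oo[.
Proof. by apply/seteqP; split => t /=; rewrite !in_itv/= andbT. Qed.

Let mgt z : measurable ([set t | 0 < t < 1 /\ z < Q t] : set (measurableTypeR R)).
Proof. by rewrite gtE; apply: mQ => //; exact: measurable_itv. Qed.

Let mge z : measurable ([set t | 0 < t < 1 /\ z <= Q t] : set (measurableTypeR R)).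
Proof. by rewrite geE; apply: mQ => //; exact: measurable_itv. Qed.

Let integral_step (A : set (measurableTypeR R)) k : measurable A -> A `<=` I01 ->
  leb.-integrable I01 (EFin \o (fun t : measurableTypeR R => k * (1 - 2 * \1_A t))) /\
  \int[leb]_(t in I01) (k * (1 - 2 * \1_A t)) = k * (1 - 2 * fine (leb A)).
Proof.
move=> mA AI.
have i1 : leb.-integrable I01 (EFin \o (\1_A : measurableTypeR R -> R)).
  apply: (integrable_of_bounded (C := 1)) => //.
  - by rewrite leb_oo01 ltry.
  - by move=> t _; rewrite indicE; case: (_ \in _); rewrite ?normr1 ?normr0.
have i2 : leb.-integrable I01 (EFin \o (fun t : measurableTypeR R => (2 * k) * \1_A t)).
  under [X in _.-integrable _ X]eq_fun do rewrite /= EFinM.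
  exact: (integrableZl measurable_oo01 (2 * k) i1).
have E : (fun t : measurableTypeR R => k * (1 - 2 * \1_A t)) =
    (fun t => cst k t - (2 * k) * \1_A t).
  by apply/funext => t /=; ring.
rewrite E; split.
  rewrite (_ : _ \o _ = (fun t => (cst k t)%:E - ((2 * k) * \1_A t)%:E)%E)//.
  exact: (integrableB measurable_oo01 (integrable_cst01 k) i2).
rewrite (RintegralB measurable_oo01 (integrable_cst01 k) i2) Rintegral01_cst.
rewrite (RintegralZl (2 * k) measurable_oo01 i1).
have -> : \int[leb]_(t in I01) \1_A t = fine (leb A).
  by rewrite /Rintegral integral_indic// setIidl.
ring.
Qed.

(** A subgradient at [x] dominates the difference quotient on [[z, x]], and
    [|x - t| - |z - t|] equals [x - z] for [t <= z] and is at least [z - x]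
    elsewhere. *)
Lemma subgradient_ge x z eta : z < x -> pot z - pot x >= eta * (z - x) ->
  1 - 2 * upper_mass z <= eta.
Proof.
move=> zx sub.
have AI : [set t | 0 < t < 1 /\ z < Q t] `<=` I01 by move=> t [].
have [i1 e1] := integral_step (x - z) (mgt z) AI.
have : (x - z) * (1 - 2 * upper_mass z) <= pot x - pot z.
  rewrite /upper_mass -e1 potB; apply: le_Rintegral => // t It.
  have t01 : 0 < t < 1 := It.
  rewrite indicE; have [Qz|Qz] := ltP z (Q t).
    rewrite mem_set//=.
    by case: (ger0P (x - Q t)); case: (ger0P (z - Q t)) => ? ?; lra.
  rewrite memNset/= => [|[_]]; last by rewrite ltNge Qz.
  by case: (ger0P (x - Q t)); case: (ger0P (z - Q t)) => ? ?; lra.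
have xz : 0 < x - z by rewrite subr_gt0.
by move=> h; rewrite -(ler_pM2l xz); lra.
Qed.

Lemma subgradient_le y z eta : y < z -> pot z - pot y >= eta * (z - y) ->
  eta <= 1 - 2 * upper_mass_cl z.
Proof.
move=> yz sub.
have AI : [set t | 0 < t < 1 /\ z <= Q t] `<=` I01 by move=> t [].
have [i1 e1] := integral_step (z - y) (mge z) AI.
have : pot z - pot y <= (z - y) * (1 - 2 * upper_mass_cl z).
  rewrite /upper_mass_cl -e1 potB; apply: le_Rintegral => // t It.
  have t01 : 0 < t < 1 := It.
  rewrite indicE; have [Qz|Qz] := leP z (Q t).
    rewrite mem_set//=.
    by case: (ger0P (y - Q t)); case: (ger0P (z - Q t)) => ? ?; lra.
  rewrite memNset/= => [|[_]]; last by rewrite leNgt Qz.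
  by case: (ger0P (y - Q t)); case: (ger0P (z - Q t)) => ? ?; lra.
have xz : 0 < z - y by rewrite subr_gt0.
by move=> h; rewrite -(ler_pM2l xz); lra.
Qed.

Lemma upper_mass_eq0 z : b <= z -> upper_mass z = 0.
Proof.
move=> bz; rewrite /upper_mass (_ : [set _ | _] = set0) ?measure0//.
apply/seteqP; split => // t [/Qab/andP[_ tb]].
by rewrite ltNge (le_trans tb).
Qed.

Lemma upper_mass_cl_eq1 z : z <= a -> upper_mass_cl z = 1.
Proof.
move=> za; rewrite /upper_mass_cl (_ : [set _ | _] = I01) ?leb_oo01//.
apply/seteqP; split => [t []//|t It]; have t01 : 0 < t < 1 := It.
by split => //; have /andP[+ _] := Qab t01; exact: le_trans.
Qed.

Let fin_sub (A : set (measurableTypeR R)) : measurable A -> A `<=` I01 ->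
  leb A \is a fin_num.
Proof.
move=> mA AI; rewrite ge0_fin_numE//; apply: (@le_lt_trans _ _ 1%E); last exact: ltry.
by rewrite -leb_oo01 le_measure ?inE.
Qed.

Lemma upper_mass_mono z' z : z' <= z -> upper_mass z <= upper_mass_cl z'.
Proof.
move=> zz; rewrite /upper_mass /upper_mass_cl fine_le//.
- by apply: fin_sub => // t [].
- by apply: fin_sub => // t [].
- rewrite le_measure ?inE// => t [t01 h]; split => //.
  by rewrite (le_trans zz)// ltW.
Qed.

Lemma upper_mass_cl_le y z' : y < z' -> upper_mass_cl z' <= upper_mass y.
Proof.
move=> yz; rewrite /upper_mass /upper_mass_cl fine_le//.
- by apply: fin_sub => // t [].
- by apply: fin_sub => // t [].
- by rewrite le_measure ?inE// => t [t01 h]; split => //; exact: lt_le_trans h.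
Qed.

(** The difference contains the measure of the interval of [level_interval]. *)
Lemma upper_mass_strict c z' z t1 t2 : nondecreasing01 Q -> lipschitz01 c Q ->
  0 < t1 < 1 -> 0 < t2 < 1 -> Q t1 < z' -> z' < z -> z < Q t2 ->
  z - z' <= c * (upper_mass_cl z' - upper_mass z).
Proof.
move=> mq lq t101 t201 q1 zz q2.
have c0 := lipschitz01_ge0 mq lq.
have [r1 [r2 [r10 r12 r21 zr Hr]]] := level_interval mq lq t101 t201 q1 zz q2.
apply: (le_trans zr); rewrite ler_wpM2l// lerBrDr.
have mI : measurable (`[r1, r2]%classic : set (measurableTypeR R)).
  exact: measurable_itv.
have lI : leb `[r1, r2]%classic = (r2 - r1)%:E.
  rewrite lebesgue_measure_itv/= lte_fin; case: ltP => [_|h]; first by rewrite EFinB.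
  by have -> : r2 - r1 = 0 by lra.
have II : `[r1, r2]%classic `<=` I01.
  move=> t rt; have /andP[h1 h2] : r1 <= (t : R) <= r2 := rt.
  by suff : 0 < (t : R) < 1 by []; apply/andP; split; lra.
have dis : [set t | 0 < t < 1 /\ z < Q t] `&` `[r1, r2]%classic = set0.
  apply/seteqP; split => // t [[_ zq] rt].
  have /Hr/andP[_] : r1 <= (t : R) <= r2 := rt.
  by rewrite leNgt zq.
rewrite addrC -lee_fin EFinD -lI /upper_mass /upper_mass_cl.
rewrite fineK; last by apply: fin_sub => // t [].
rewrite fineK; last by apply: fin_sub => // t [].
rewrite -measureU// le_measure ?inE//; first exact: measurableU.
move=> t [[t01 zq]|rt]; first by split => //; apply: ltW; exact: lt_trans zq.
have rt' : r1 <= (t : R) <= r2 := rt.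
by split; [exact: II|have /andP[] := Hr t rt'].
Qed.

(** The subgradient inequality is only required for rational [z], a countable
    family of conditions being what can be asked for almost every [s]. *)
Lemma subgradient_mono x y eta zeta : y < x ->
  (forall z : rat, pot (ratr z) - pot x >= eta * (ratr z - x)) ->
  (forall z : rat, pot (ratr z) - pot y >= zeta * (ratr z - y)) ->
  zeta <= eta.
Proof.
move=> yx Hx Hy.
have [z /[!in_itv]/= /andP[z1 z2]] := rat_in_itvoo yx.
have h1 := subgradient_ge z2 (Hx z).
have h2 := subgradient_le z1 (Hy z).
have := upper_mass_mono (lexx (ratr z)); lra.
Qed.

(** Squeeze two rational levels [z' < z] between [y] and [x]: the subgradients
    differ by at least twice the mass of [Q] in [[z', z]]. *)
Lemma subgradient_strong_mono c x y eta zeta : nondecreasing01 Q -> lipschitz01 c Q ->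
  (forall z, a < z -> exists t, 0 < t < 1 /\ Q t < z) ->
  (forall z, z < b -> exists t, 0 < t < 1 /\ z < Q t) ->
  a <= y -> y < x -> x <= b ->
  (forall z : rat, pot (ratr z) - pot x >= eta * (ratr z - x)) ->
  (forall z : rat, pot (ratr z) - pot y >= zeta * (ratr z - y)) ->
  2 * (x - y) <= c * (eta - zeta).
Proof.
move=> mq lq Qa Qb ay yx xb Hx Hy.
have c0 := lipschitz01_ge0 mq lq.
apply/ler_addgt0Pr => e e0.
pose d := Num.min (e / 4) ((x - y) / 2).
have d0 : 0 < d by rewrite lt_min !divr_gt0// subr_gt0.
have dxy : d <= (x - y) / 2 by rewrite ge_min lexx orbT.
have de : d <= e / 4 by rewrite ge_min lexx.
have [z' /[!in_itv]/= /andP[z'1 z'2]] := @rat_in_itvoo _ y (y + d) ltac:(by rewrite ltrDl).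
have [z /[!in_itv]/= /andP[z1 z2]] := @rat_in_itvoo _ (x - d) x ltac:(by rewrite gtrBl).
have zz : (ratr z' : R) < ratr z by lra.
have [t1 [t101 q1]] := Qa (ratr z') (le_lt_trans ay z'1).
have [t2 [t201 q2]] := Qb (ratr z) (lt_le_trans z2 xb).
have h := upper_mass_strict mq lq t101 t201 q1 zz q2.
have h1 := subgradient_ge z2 (Hx z).
have h2 := subgradient_le z'1 (Hy z').
have h3 : c * (2 * (upper_mass_cl (ratr z') - upper_mass (ratr z))) <= c * (eta - zeta).
  by rewrite ler_wpM2l//; lra.
lra.
Qed.

Lemma subgradient_above x eta : b < x ->
  (forall z : rat, pot (ratr z) - pot x >= eta * (ratr z - x)) -> 1 <= eta.
Proof.
move=> bx Hx.
have [z /[!in_itv]/= /andP[z1 z2]] := rat_in_itvoo bx.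
have := subgradient_ge z2 (Hx z); rewrite (upper_mass_eq0 (ltW z1)); lra.
Qed.

Lemma subgradient_below x eta : x < a ->
  (forall z : rat, pot (ratr z) - pot x >= eta * (ratr z - x)) -> eta <= -1.
Proof.
move=> xa Hx.
have [z /[!in_itv]/= /andP[z1 z2]] := rat_in_itvoo xa.
have := subgradient_le z1 (Hx z); rewrite (upper_mass_cl_eq1 (ltW z2)); lra.
Qed.
End potential.

(** * The subdifferential of the energy, pointwise *)

Section pointwise_subdifferential.
Context {R : realType}.
Local Notation leb := (@lebesgue_measure R).
Local Notation I01 := (`]0%R, 1%R[%classic : set (measurableTypeR R)).

(** Constants, indicators and affine functions are obtained from this. *)
Lemma exists_L2_bounded (f : measurableTypeR R -> R) C : measurable_fun I01 f ->
  (forall s, 0 < s < 1 -> `|f s| <= C) ->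
  exists u : L2 R, forall s, 0 < s < 1 -> u s = f s.
Proof.
move=> mf fC; apply: exists_L2 => //.
have C0 : 0 <= C.
  by apply: (le_trans _ (fC (1/2) _)) => //; apply/andP; split; lra.
apply: (@le_lt_trans _ _ (\int[leb]_(s in I01) (cst (C ^+ 2)%:E s))%E); last first.
  by rewrite integral_cst//= leb_oo01 mule1 ltry.
apply: ge0_le_integral => //=.
- by move=> x _; rewrite lee_fin sqr_ge0.
- by apply: measurableT_comp => //; exact: measurable_funX.
- move=> x xI; have x01 : 0 < (x : R) < 1 := xI.
  by rewrite lee_fin -[leLHS]real_normK ?num_real// ler_sqr ?nnegrE// fC.
Qed.

Lemma exists_L2_cst k : exists u : L2 R, forall s, 0 < s < 1 -> u s = k.
Proof. exact: (@exists_L2_bounded (cst k) `|k|). Qed.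

Lemma exists_L2_indic (A : set (measurableTypeR R)) : measurable A ->
  exists u : L2 R, forall s, 0 < s < 1 -> u s = \1_A s.
Proof.
move=> mA; apply: (@exists_L2_bounded (\1_A) 1).
  by apply: (@measurable_funS _ _ _ _ setT) => //; exact: measurable_indic.
by move=> s _; rewrite indicE; case: (_ \in _); rewrite ?normr1 ?normr0.
Qed.

Lemma eq_integrable01 (f g : measurableTypeR R -> \bar R) :
  leb.-integrable I01 f -> (forall s : R, 0 < s < 1 -> f s = g s) ->
  leb.-integrable I01 g.
Proof.
move=> intf fg; apply: (eq_integrable measurable_oo01 f) => // s /[!inE] sI.
exact: fg.
Qed.

Lemma L2_integrable (w : L2 R) : leb.-integrable I01 (EFin \o (w : R -> R)).
Proof.
have [w1 w1E] := exists_L2_cst 1.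
apply: (eq_integrable01 (inner_integrable w1 w)) => s s01.
by rewrite /= w1E// mul1r.
Qed.

Variables (Q : R -> R) (a b : R).
Hypotheses (mQ : measurable_fun I01 (Q : measurableTypeR R -> R))
  (Qab : forall t, 0 < t < 1 -> a <= Q t <= b).

Local Notation p := (pot Q).

Definition energy (u : L2 R) : R :=
  \int[leb]_(s in `]0, 1[) ((1 - 2 * s) * u s + p (u s)).

Let integrable_affine (w : L2 R) :
  leb.-integrable I01 (EFin \o (fun s : measurableTypeR R => (1 - 2 * (s : R)) * w s)).
Proof.
have [l lE] : exists l : L2 R, forall s, 0 < s < 1 -> l s = 1 - 2 * s.
  apply: (@exists_L2_bounded _ 1).
    apply: measurable_funB => //; apply: measurable_funM => //.
  by move=> s /andP[s0 s1]; rewrite ler_norml; apply/andP; split; lra.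
apply: (eq_integrable01 (inner_integrable l w)) => s s01.
by rewrite /= lE.
Qed.

Let measurable_p (w : L2 R) D : measurable_fun D (fun s : measurableTypeR R => p (w s)).
Proof.
apply: (@measurable_funS _ _ _ _ setT) => //.
apply: (measurableT_comp (f := p : measurableTypeR R -> R)) => //.
  by apply: continuous_measurable_fun; exact: (continuous_pot mQ Qab).
exact: L2_measurable.
Qed.

Let integrable_p (w : L2 R) :
  leb.-integrable I01 (EFin \o (fun s : measurableTypeR R => p (w s))).
Proof.
have [w1 w1E] := exists_L2_cst `|p 0|.
have [w' w'E] := @exists_L2_dominated R (fun s => `|w s|) w
  ltac:(by apply: measurableT_comp => //; exact: L2_measurable_on)
  ltac:(by move=> s _; rewrite normr_id).
apply: (le_integrable measurable_oo01 _ _ (L2_integrable (w1 + w'))).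
  by apply: measurableT_comp => //; exact: measurable_p.
move=> s sI; have s01 : 0 < (s : R) < 1 := sI.
have h : `|p (w s)| <= `|p 0| + `|w s|.
  have := pot_lipschitz mQ Qab (w s) 0; rewrite subr0 => h.
  rewrite -[X in `|X| <= _](subrK (p 0)) (le_trans (ler_normD _ _))// addrC.
  by rewrite lerD2l.
rewrite /= lee_fin (le_trans h)// -(w1E s s01) -(w'E s s01); exact: ler_norm.
Qed.

Let integrable_energy (w : L2 R) : leb.-integrable I01
  (EFin \o (fun s : measurableTypeR R => (1 - 2 * (s : R)) * w s + p (w s))).
Proof.
by under [X in _.-integrable _ X]eq_fun do rewrite /= EFinD;
  exact: (integrableD measurable_oo01 (integrable_affine w) (integrable_p w)).
Qed.

Let scaled_subgradient_ineq (Eu Ew th iv r Psi e : R) :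
  Eu + th * iv - r <= Ew -> Ew - Eu <= th * Psi -> r <= th * e ->
  th * 0 <= th * (Psi - iv + e).
Proof. lra. Qed.

Let convex_increment (l us ys th p1 p2 p3 : R) : p1 - p2 <= th * (p3 - p2) ->
  l * (us + th * ys) + p1 - (l * us + p2) <= th * (l * ys + (p3 - p2)).
Proof. lra. Qed.

(** Move [u] a fraction [th] of the way towards the constant [z], only on the set
    [A] where the inequality fails. By convexity the energy changes by at most
    [th] times the integral of [psi], so the subgradient inequality, divided by
    [th], says that the integral over [A] of the defect [phi], which is negative
    there, is at least [- eps] for all [eps > 0]; hence [A] is null. *)
Lemma pointwise_subdifferential u v : subdifferential energy u v -> forall z,
  {ae leb, forall s, 0 < s < 1 ->
     v s * (z - u s) <= (1 - 2 * s) * (z - u s) + (p z - p (u s))}.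
Proof.
move=> sub z.
pose phi (s : measurableTypeR R) :=
  (1 - 2 * (s : R)) * (z - u s) + (p z - p (u s)) - v s * (z - u s).
have mphi D : measurable_fun D phi.
  have mu := @L2_measurable_on R D u.
  apply: measurable_funB; last first.
    apply: measurable_funM; first exact: L2_measurable_on.
    exact: measurable_funB.
  apply: measurable_funD; last first.
    by apply: measurable_funB => //; exact: measurable_p.
  apply: measurable_funM; last exact: measurable_funB.
  by apply: measurable_funB => //; exact: measurable_funM.
pose A : set (measurableTypeR R) := [set s | phi s < 0].
have mA : measurable A.
  rewrite (_ : A = setT `&` phi @^-1` `]-oo, 0[).
    by apply: mphi => //; exact: measurable_itv.
  by apply/seteqP; split => s; rewrite setTI /A/= in_itv.
have [zc zcE] := exists_L2_cst z.
have [y yE] : exists y : L2 R, forall s, 0 < s < 1 -> y s = (z - u s) * \1_A s.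
  have [y yE] := @exists_L2_dominated R (fun s => (zc - u) s * \1_A s) (zc - u)
    ltac:(by apply: measurable_funM; [exact: L2_measurable_on|
       apply: (@measurable_funS _ _ _ _ setT) => //; exact: measurable_indic])
    ltac:(by move=> s _; rewrite normrM ler_piMr// indicE; case: (_ \in _);
       rewrite ?normr1 ?normr0).
  by exists y => s s01; rewrite yE//; congr (_ * _); rewrite -(zcE s s01).
pose psi (s : measurableTypeR R) :=
  (1 - 2 * (s : R)) * y s + (p ((u + y) s) - p (u s)).
have ipsi : leb.-integrable I01 (EFin \o psi).
  have iB := integrableB measurable_oo01 (integrable_p (u + y)) (integrable_p u).
  have iD := integrableD measurable_oo01 (integrable_affine y) iB.
  by apply: (eq_integrable01 iD) => s _ /=; rewrite -EFinB -EFinD.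
have ipv : leb.-integrable I01 (EFin \o (fun s => psi s - v s * y s)).
  have iB := integrableB measurable_oo01 ipsi (inner_integrable v y).
  by apply: (eq_integrable01 iB) => s _ /=; rewrite -EFinB.
have psiE s : 0 < s < 1 -> psi s - v s * y s = \1_A s * phi s.
  move=> s01; rewrite /psi.
  have -> : (u + y) s = u s + y s by [].
  rewrite yE// /phi indicE; case: (s \in A); rewrite ?mulr1 ?mulr0 ?mul1r ?mul0r.
    by have -> : u s + (z - u s) = z by ring.
  by rewrite addr0 !subrr subr0 addr0.
have ge0 : 0 <= \int[leb]_(s in I01) (psi s - v s * y s).
  apply/ler_addgt0Pr => e e0.
  have y1 : 0 < nrm y + 1 by rewrite ltr_wpDl ?nrm_ge0.
  have [d d0 H] := sub _ (divr_gt0 e0 y1).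
  pose th := Num.min 1 (d / (nrm y + 1)).
  have th0 : 0 < th by rewrite lt_min ltr01 divr_gt0.
  have th1 : th <= 1 by rewrite ge_min lexx.
  have thd : th * (nrm y + 1) <= d by rewrite -ler_pdivlMr// ge_min lexx orbT.
  have wu : u + th *: y - u = th *: y by rewrite addrC addKr.
  have := H (u + th *: y); rewrite wu nrmZ (gtr0_norm th0) innerZr.
  have le1 : th * nrm y <= d.
    by apply: le_trans thd; rewrite ler_pM2l// lerDl.
  move=> /(_ le1) Hw.
  have Ew : energy (u + th *: y) - energy u <= th * \int[leb]_(s in I01) psi s.
    rewrite /energy -(RintegralB measurable_oo01 (integrable_energy _) (integrable_energy _)).
    rewrite -(RintegralZl th measurable_oo01 ipsi).
    apply: le_Rintegral => //.
    - have iB := integrableB measurable_oo01 (integrable_energy (u + th *: y)) (integrable_energy u).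
      by apply: (eq_integrable01 iB) => s _ /=; rewrite -EFinB.
    - under [X in _.-integrable _ X]eq_fun do rewrite /= EFinM.
      exact: (integrableZl measurable_oo01 th ipsi).
    - move=> s _.
      have E1 : (u + th *: y) s = u s + th * y s by [].
      have E2 : (u + y) s = u s + y s by [].
      rewrite /psi E1 E2.
      have th01 : 0 <= th <= 1 by rewrite (ltW th0).
      have := pot_convex mQ Qab (u s) (u s + y s) th01.
      have -> : u s + y s - u s = y s by ring.
      by move=> h; exact: convex_increment h.
  have Ein : \int[leb]_(s in I01) (psi s - v s * y s) =
      \int[leb]_(s in I01) psi s - inner v y.
    by rewrite (RintegralB measurable_oo01 ipsi (inner_integrable v y)).
  rewrite Ein -(ler_pM2l th0).
  have : e / (nrm y + 1) * (th * nrm y) <= th * e.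
    by rewrite mulrCA ler_pM2l// mulrAC ler_pdivrMr// ler_pM2l// lerDl.
  exact: scaled_subgradient_ineq Hw Ew.
have int0 : (\int[leb]_(s in I01) `|(EFin \o (fun s => psi s - v s * y s)%R) s|)%E = 0%E.
  have -> : (\int[leb]_(s in I01) `|(EFin \o (fun s => psi s - v s * y s)%R) s|)%E =
     (\int[leb]_(s in I01) (- (psi s - v s * y s))%R%:E)%E.
    apply: eq_integral => s /[!inE] sI; have s01 : 0 < (s : R) < 1 := sI.
    rewrite /= psiE// ler0_norm// indicE; case: (boolP (s \in A)) => [|_].
      by rewrite inE mul1r => /ltW.
    by rewrite mul0r.
  apply/eqP; rewrite eq_le; apply/andP; split; last first.
    apply: integral_ge0 => s sI; have s01 : 0 < (s : R) < 1 := sI.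
    rewrite lee_fin psiE// oppr_ge0 indicE; case: (boolP (s \in A)) => [|_].
      by rewrite inE mul1r => /ltW.
    by rewrite mul0r.
  under eq_integral do rewrite EFinN.
  rewrite integralN; last first.
    exact: (integrable_add_def measurable_oo01 ipv).
  by rewrite leeNl oppe0 -EFin_Rintegral.
have mpv : measurable_fun I01 (EFin \o (fun s => psi s - v s * y s)).
  by case/integrableP : ipv.
have := (ae_eq_integral_abs leb measurable_oo01 mpv).1 int0.
apply: ae_imp => s + s01 => /(_ s01) /= [].
rewrite psiE// indicE; case: (boolP (s \in A)) => [|].
  by rewrite inE mul1r /A/= => + E; rewrite E ltxx.
by rewrite notin_setE /A/= => /negP; rewrite -leNgt /phi => h _; lra.
Qed.

Lemma pointwise_subdifferential_rat u v : subdifferential energy u v ->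
  {ae leb, forall s, 0 < s < 1 -> forall z : rat,
     v s * (ratr z - u s) <= (1 - 2 * s) * (ratr z - u s) + (p (ratr z) - p (u s))}.
Proof.
move=> sub.
pose P (n : nat) (s : R) := forall z : rat, unpickle n = Some z -> 0 < s < 1 ->
     v s * (ratr z - u s) <= (1 - 2 * s) * (ratr z - u s) + (p (ratr z) - p (u s)).
have : {ae leb, forall s, forall n, P n s}.
  apply/ae_foralln => n; case E : (unpickle n : option rat) => [z|].
    have := pointwise_subdifferential sub (ratr z).
    by apply: ae_imp => s Hs z'; rewrite E => -[<-].
  by apply: aeW => s z'; rewrite E.
by apply: ae_imp => s H s01 z; apply: (H (pickle z) z) => //; rewrite pickleK.
Qed.

End pointwise_subdifferential.

(** * Supports, quantile functions and monotone representatives *)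

Section support_and_quantile.
Context {R : realType}.
Implicit Types (mu : probability (measurableTypeR R) R) (q : R -> R).

(** A point outside the support has a null neighbourhood with rational end
    points, and there are countably many of these. *)
Lemma negligible_setC_supp mu : mu.-negligible (~` supp mu).
Proof.
pose itv (n : nat) : set (measurableTypeR R) :=
  match (unpickle n : option (rat * rat)) with
  | Some (r1, r2) => if mu `]ratr r1, ratr r2[%classic == 0%E
                     then `]ratr r1, ratr r2[%classic else set0
  | None => set0
  end.
have : mu.-negligible (\bigcup_n itv n).
  apply: negligible_bigcup => n; rewrite /itv.
  case: (unpickle n) => [[r1 r2]|]; last exact: negligible_set0.
  case: ifPn => [/eqP h|_]; last exact: negligible_set0.
  by apply/negligibleP => //; exact: measurable_itv.
move=> [N [mN N0 hN]]; exists N; split => //; apply: (subset_trans _ hN).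
move=> x /existsNP[U /not_implyP[oU /not_implyP[Ux /negP]]].
rewrite -leNgt => U0.
have /nbhs_ballP[e /= e0 eU] : nbhs (x : R) U by apply: open_nbhs_nbhs.
have [r1 /[!in_itv]/= /andP[r11 r12]] := @rat_in_itvoo _ (x - e) x ltac:(by rewrite gtrBl).
have [r2 /[!in_itv]/= /andP[r21 r22]] := @rat_in_itvoo _ (x : R) (x + e) ltac:(by rewrite ltrDl).
have mI : measurable (`]ratr r1, ratr r2[%classic : set (measurableTypeR R)).
  exact: measurable_itv.
have IU : `]ratr r1, ratr r2[%classic `<=` U.
  move=> y /=; rewrite in_itv/= => /andP[y1 y2]; apply: eU.
  by rewrite /ball/= ltr_norml; apply/andP; split; lra.
exists (pickle (r1, r2)); first exact: I.
rewrite /itv pickleK ifT; first by apply/andP.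
rewrite -measure_le0 (le_trans _ U0)// le_measure ?inE//.
exact: open_measurable.
Qed.

Section support_in_segment.
Variables (mu : probability (measurableTypeR R) R) (a b : R).
Hypothesis supp_ab : supp mu `<=` `[a, b]%classic.

Let mNy (x : R) : measurable (`]-oo, x]%classic : set (measurableTypeR R)).
Proof. exact: measurable_itv. Qed.

Let null_outside (A : set (measurableTypeR R)) : measurable A ->
  (forall x : R, A x -> ~~ (a <= x <= b)) -> mu A = 0%E.
Proof.
move=> mA AC; apply/(negligibleP _ mA).
have [N [mN N0 hN]] := negligible_setC_supp mu; exists N; split => //.
apply: (subset_trans _ hN) => x Ax /supp_ab.
by rewrite /= in_itv/=; exact/negP/AC.
Qed.

Lemma Rplus_lt x : x < a -> Rplus mu x = 0.
Proof.
move=> xa; rewrite /Rplus null_outside// => y yx.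
have {}yx : y <= x := yx.
by rewrite negb_and -ltNge (le_lt_trans yx).
Qed.

Lemma Rplus_ge x : b <= x -> Rplus mu x = 1.
Proof.
move=> bx; rewrite /Rplus -[X in mu X]setCK probability_setC; last exact: measurableC.
rewrite null_outside ?sube0//; first exact: measurableC.
move=> y yx; rewrite negb_and -!ltNge.
have : ~ (y <= x) := yx.
by move/negP; rewrite -ltNge => h; rewrite (le_lt_trans bx h) orbT.
Qed.

Lemma Rplus_nondecreasing x y : x <= y -> Rplus mu x <= Rplus mu y.
Proof.
move=> xy; rewrite /Rplus fine_le ?fin_num_measure//.
by rewrite le_measure ?inE//; apply: subset_itvl; rewrite bnd_simp.
Qed.

Let E (s : R) : set R := [set x : R | s <= Rplus mu x].

Let lbE s : 0 < s -> lbound (E s) a.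
Proof.
move=> s0 x; rewrite /E/= => sx; rewrite leNgt; apply/negP => xa.
by move: sx; rewrite (Rplus_lt xa) leNgt s0.
Qed.

Let Eb s : s < 1 -> E s b. Proof. by move=> /ltW s1; rewrite /E/= Rplus_ge. Qed.

Let quantile_le s x : 0 < s -> E s x -> quantile mu s <= x.
Proof. by move=> s0 Ex; apply: inf_lbound => //; exists a; exact: lbE. Qed.

Let quantile_ge s x : s < 1 -> lbound (E s) x -> x <= quantile mu s.
Proof. by move=> s1 lx; apply: lb_le_inf => //; exists b; exact: Eb. Qed.

Lemma quantile_in s : 0 < s < 1 -> a <= quantile mu s <= b.
Proof.
move=> /andP[s0 s1]; apply/andP; split; first by apply: quantile_ge => //; exact: lbE.
by apply: quantile_le => //; exact: Eb.
Qed.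

Lemma quantile_nondecreasing : nondecreasing01 (quantile mu).
Proof.
move=> s t; rewrite !in_itv/= => /andP[s0 s1] /andP[t0 t1] st.
apply: quantile_ge => // x Ex; apply: quantile_le => //.
exact: le_trans st Ex.
Qed.

Lemma supp_bounds_le : a <= b.
Proof.
have h : 0 < (1/2 : R) < 1 by apply/andP; split; lra.
by have /andP[] := quantile_in h; exact: le_trans.
Qed.

(** As [a] is in the support, the midpoint [m] of [a] and [z] has positive
    distribution function, so small levels have quantile at most [m]. *)
Lemma quantile_low z : supp mu a -> a < z -> exists t, 0 < t < 1 /\ quantile mu t < z.
Proof.
move=> sa az; pose m := (a + z) / 2.
have am : a < m by rewrite /m; lra.
have mz : m < z by rewrite /m; lra.
have U0 : (0 < mu `]-oo, m[%classic)%E.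
  by apply: sa; [exact: interval_open|rewrite /= in_itv].
have Rm : 0 < Rplus mu m.
  rewrite /Rplus fine_gt0//; apply/andP; split.
    apply: (lt_le_trans U0).
    have mO : measurable (`]-oo, m[%classic : set (measurableTypeR R)).
      exact: measurable_itv.
    rewrite le_measure ?inE//.
    by apply: subset_itvl; rewrite bnd_simp.
  by rewrite -ge0_fin_numE// fin_num_measure.
exists (Num.min (Rplus mu m) (1 / 2)); split.
  by rewrite lt_min Rm/= gt_min; apply/andP; split; [lra|apply/orP; right; lra].
apply: le_lt_trans mz; apply: quantile_le; last by rewrite /E/= ge_min lexx.
by rewrite lt_min Rm; lra.
Qed.

Lemma quantile_high z : supp mu b -> z < b -> exists t, 0 < t < 1 /\ z < quantile mu t.
Proof.
move=> sb zb; pose m := (z + b) / 2.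
have mb : m < b by rewrite /m; lra.
have zm : z < m by rewrite /m; lra.
have mU : measurable (`]m, +oo[%classic : set (measurableTypeR R)).
  exact: measurable_itv.
have U0 : (0 < mu `]m, +oo[%classic)%E.
  by apply: sb; [exact: interval_open|rewrite /= in_itv/= mb].
have R0 x : 0 <= Rplus mu x by rewrite fine_ge0.
have Rm : Rplus mu m < 1.
  have E1 : (mu `]-oo, m]%classic = 1 - mu `]m, +oo[%classic)%E.
    by rewrite -probability_setC// setCitvr.
  rewrite /Rplus E1 fineB ?fin_num_measure//= ltrBlDr ltrDl.
  by rewrite fine_gt0// U0 -ge0_fin_numE// fin_num_measure.
exists ((Rplus mu m + 1) / 2); have := R0 m => Rm0; split.
  by apply/andP; split; lra.
apply: (lt_le_trans zm); apply: quantile_ge; first by lra.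
move=> x; rewrite /E/= => h; rewrite leNgt; apply/negP => /ltW xm.
have := Rplus_nondecreasing xm; lra.
Qed.
End support_in_segment.

Lemma Lip_finite q : (Lip q < +oo)%E -> exists2 c, 0 <= c &
  Lip q = c%:E /\ lipschitz01 c q.
Proof.
move=> qoo.
have L0 : (0 <= Lip q)%E by apply: le_ereal_inf_tmp => L [].
have fin : Lip q \is a fin_num by rewrite ge0_fin_numE.
exists (fine (Lip q)); first exact: fine_ge0.
split; first by rewrite fineK.
move=> s1 s2 s10 s12 s21.
have : ((slope q s2 s1)%:E <= Lip q)%E.
  apply: le_ereal_inf_tmp => L [_ HL]; apply: HL; rewrite ?gt_eqF//; apply/andP; split; lra.
by rewrite -[X in (_ <= X)%E]fineK// lee_fin /slope ler_pdivrMr ?subr_gt0.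
Qed.

Lemma Lip_le q c : 0 <= c -> lipschitz01 c q -> (Lip q <= c%:E)%E.
Proof.
move=> c0 lq; apply: ereal_inf_lbound; split; first by rewrite lee_fin.
move=> s1 s2 /andP[s10 s11] /andP[s20 s21] ne; rewrite lee_fin /slope.
have [s12|s12|s12] := ltgtP s1 s2; last by rewrite s12 eqxx in ne.
- rewrite -mulrNN -invrN !opprB ler_pdivrMr ?subr_gt0//; exact: lq.
- rewrite ler_pdivrMr ?subr_gt0//; exact: lq.
Qed.
End support_and_quantile.

Section representative.
Context {R : realType}.
Local Notation leb := (@lebesgue_measure R).
Local Notation I01 := (`]0%R, 1%R[%classic : set (measurableTypeR R)).

Lemma lebesgue_pt_small (f : R -> R) (x e : R) : lebesgue_pt f x -> 0 < e ->
  exists2 d, 0 < d & forall r, 0 < r < d ->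
    (\int[leb]_(y in ball x r) `|f y - f x|%:E < (2 * r * e)%:E)%E.
Proof.
move=> /fine_cvgP[ffin fc] e0.
have n1 : \forall t \near 0^'+, (fine \o [eta davg f x]) t < e.
  exact: (cvgr_lt _ fc).
have : \forall r \near 0^'+, davg f x r \is a fin_num /\ fine (davg f x r) < e.
  exact: filterI ffin n1.
rewrite near_withinE => /nbhs_ballP[d /= d0 H].
exists d => // r /andP[r0 rd].
have [] := H r; first by rewrite /ball/= sub0r normrN gtr0_norm.
  by [].
move=> h1 h2.
have : (davg f x r < e%:E)%E by rewrite -[X in (X < _)%E]fineK// lte_fin.
rewrite /davg /iavg lebesgue_measure_ball ?ltW//.
have r2 : 0 < r *+ 2 by rewrite mulrn_wgt0.
rewrite inver gt_eqF// lte_pdivrMl// -EFinM => h.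
have -> : 2 * r * e = r *+ 2 * e by rewrite mulr_natl.
apply: le_lt_trans h.
by rewrite le_eqVlt; apply/orP; left; apply/eqP; apply: eq_integral.
Qed.

(** Away from the null set [N], points are Lebesgue points. The hypothesis for
    [h = s2 - s1] compares the averages of [u] over two balls of the same small
    radius, which are close to [u s1] and [u s2]. *)
Lemma ae_increment (u : L2 R) C :
  (forall h, 0 < h < 1 ->
     {ae leb, forall s, 0 < s -> s < 1 - h -> u (s + h) - u s <= C * h}) ->
  exists N, [/\ measurable (N : set (measurableTypeR R)), leb N = 0%E &
    forall s1 s2, ~ N s1 -> ~ N s2 -> 0 < s1 -> s1 < s2 -> s2 < 1 ->
      u s2 - u s1 <= C * (s2 - s1)].
Proof.
move=> H.
pose uu : R -> R := (u : R -> R) \_ I01.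
have muu : measurable_fun setT (uu : measurableTypeR R -> R).
  by apply/(measurable_restrictT _ _).1 => //; exact: L2_measurable_on.
have luu : locally_integrable setT uu.
  split; [exact: muu|exact: openT|].
  move=> K _ cK.
  have mK : measurable (K : set (measurableTypeR R)) by exact: compact_measurable.
  apply: (@le_lt_trans _ _ (\int[leb]_x `|uu x|%:E)%E).
    apply: ge0_subset_integral => //.
    by do 2 apply: measurableT_comp => //.
  have /integrableP[_] := L2_integrable u; apply: le_lt_trans.
  rewrite [leRHS]integral_mkcond le_eqVlt; apply/orP; left; apply/eqP.
  apply: eq_integral => x _; rewrite /uu !patchE.
  by case: ifP; rewrite ?normr0.
have [N [mN N0 ptN]] := lebesgue_differentiation luu.
exists N; split => // s1 s2 N1 N2 s10 s12 s21.
have p1 : lebesgue_pt uu s1 by apply: contrapT => /ptN.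
have p2 : lebesgue_pt uu s2 by apply: contrapT => /ptN.
pose h := s2 - s1.
have h01 : 0 < h < 1 by rewrite /h; apply/andP; split; lra.
have uE s : 0 < s < 1 -> uu s = u s.
  by move=> s01; rewrite /uu patchE mem_set.
rewrite leNgt; apply/negP => lt.
pose kap := u s2 - u s1 - C * h.
have kap0 : 0 < kap by rewrite subr_gt0.
have kap2 : 0 < kap / 2 by rewrite divr_gt0.
have [d1 d10 D1] := lebesgue_pt_small p1 kap2.
have [d2 d20 D2] := lebesgue_pt_small p2 kap2.
pose m := Num.min (Num.min d1 d2) (Num.min s1 (1 - s2)).
have m0 : 0 < m by rewrite !lt_min d10 d20 s10 subr_gt0.
pose r := m / 2.
have r0 : 0 < r by rewrite divr_gt0.
have : r < m by rewrite ltr_pdivrMr// ltr_pMr// ltr1n.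
rewrite !lt_min => /andP[/andP[rd1 rd2] /andP[rs1 rs2]].
have {}D1 := D1 r ltac:(by rewrite r0).
have {}D2 := D2 r ltac:(by rewrite r0).
have mb1 : measurable (ball s1 r : set (measurableTypeR R)) by exact: measurable_ball.
have mb2 : measurable (ball s2 r : set (measurableTypeR R)) by exact: measurable_ball.
have mf s D : measurable_fun D (fun y : measurableTypeR R => `|uu y - uu s|%:E).
  apply: (@measurable_funS _ _ _ _ setT) => //.
  by do 2 apply: measurableT_comp => //; exact: measurable_funB.
have mfh s D : measurable_fun D (fun y : measurableTypeR R => `|uu (y + h) - uu s|%:E).
  apply: (@measurable_funS _ _ _ _ setT) => //.
  exact: (measurableT_comp (mf s setT) (measurable_translation h)).
have T2 : (\int[leb]_(y in ball s1 r) `|uu (y + h) - uu s2|%:E =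
    \int[leb]_(y in ball s2 r) `|uu y - uu s2|%:E)%E.
  rewrite -(@ge0_integral_translation _ h (ball s2 r) (fun y => `|uu y - uu s2|%:E))//.
  suff -> : (fun x : R => x + h) @^-1` ball s2 r = ball s1 r by [].
  apply/seteqP; split => y; rewrite /ball/= /h;
    by have -> : s2 - (y + (s2 - s1)) = s1 - y by ring.
have lb1 : leb (ball s1 r) = (2 * r)%:E.
  by rewrite lebesgue_measure_ball ?(ltW r0)// mulr_natl.
have b01 y : ball s1 r y -> 0 < y /\ y < 1 - h.
  rewrite /ball/= ltr_norml => /andP[y1 y2]; split; first by lra.
  by rewrite /h; lra.
have : (\int[leb]_(y in ball s1 r) kap%:E <=
   \int[leb]_(y in ball s1 r) (`|uu (y + h) - uu s2|%:E + `|uu y - uu s1|%:E))%E.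
  apply: ae_ge0_le_integral => //.
  - by move=> y _; rewrite lee_fin ltW.
  - by move=> y _; rewrite -EFinD lee_fin addr_ge0.
  - by apply: emeasurable_funD; [exact: mfh|exact: mf].
  - have := H h h01; apply: ae_imp => y + yb => /(_ (proj1 (b01 y yb)) (proj2 (b01 y yb))).
    have [y0 y1] := b01 y yb.
    have /andP[h0 h1] := h01.
    have e1 : uu y = u y by apply: uE; rewrite y0 (lt_trans y1)// gtrBl.
    have e2 : uu (y + h) = u (y + h).
      by apply: uE; rewrite addr_gt0//= -ltrBrDr.
    have e3 : uu s1 = u s1 by apply: uE; rewrite s10 (lt_trans s12).
    have e4 : uu s2 = u s2 by apply: uE; rewrite (lt_trans s10).
    rewrite e1 e2 e3 e4 -EFinD lee_fin /kap => H'.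
    have := ler_norm (- (u (y + h) - u s2)); rewrite normrN.
    have := ler_norm (u y - u s1).
    lra.
have -> : (\int[leb]_(y in ball s1 r) kap%:E = (kap * (2 * r))%:E)%E.
  by rewrite integral_cst// EFinM; congr (_ * _)%E; exact: lb1.
rewrite ge0_integralD//.
rewrite T2 => hle.
have := le_lt_trans hle (lteD D2 D1).
rewrite -EFinD lte_fin; nra.
Qed.

Lemma exists_notin_null (N : set (measurableTypeR R)) (x y : R) : measurable N ->
  leb N = 0%E -> x < y -> exists z, x < z < y /\ ~ N z.
Proof.
move=> mN N0 xy; apply: contrapT => nz.
have sub : `]x, y[%classic `<=` N.
  move=> z /=; rewrite in_itv/= => xzy; apply: contrapT => Nz; apply: nz.
  by exists z.
have mI : measurable (`]x, y[%classic : set (measurableTypeR R)).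
  exact: measurable_itv.
have : (leb `]x, y[%classic <= leb N)%E by rewrite le_measure ?inE.
by rewrite N0 lebesgue_measure_itv/= lte_fin xy -EFinB lee_fin leNgt subr_gt0 xy.
Qed.

(** [q s] is the supremum of [u] over the points up to [s] outside [N]. *)
Lemma exists_nondecreasing (u : L2 R) (N : set (measurableTypeR R)) :
  measurable N -> leb N = 0%E ->
  (forall s1 s2, ~ N s1 -> ~ N s2 -> 0 < s1 -> s1 < s2 -> s2 < 1 -> u s1 <= u s2) ->
  exists q, [/\ nondecreasing01 q, {ae leb, forall s, 0 < s < 1 -> u s = q s} &
    forall c, 0 <= c ->
      (forall s1 s2, ~ N s1 -> ~ N s2 -> 0 < s1 -> s1 < s2 -> s2 < 1 ->
        u s2 - u s1 <= c * (s2 - s1)) -> lipschitz01 c q].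
Proof.
move=> mN N0 mono.
have dense x y := @exists_notin_null N x y mN N0.
pose E (s : R) : set R := [set v | exists2 x, [/\ 0 < x, x <= s & ~ N x] & v = u x].
pose q s := sup (E s).
have hE s : 0 < s < 1 -> has_sup (E s).
  move=> /andP[s0 s1]; have [x [/andP[x0 xs] Nx]] := dense _ _ s0.
  have [y [/andP[ys y1] Ny]] := dense _ _ s1.
  split; first by exists (u x); exists x => //; split => //; exact: ltW.
  exists (u y) => _ [z [z0 zs Nz] ->]; apply: mono => //.
  exact: le_lt_trans ys.
have qub s x : 0 < s < 1 -> 0 < x -> x <= s -> ~ N x -> u x <= q s.
  move=> s01 x0 xs Nx; apply: sup_ubound; first by case: (hE s s01).
  by exists x.
have qleast s v : 0 < s < 1 ->
    (forall x, 0 < x -> x <= s -> ~ N x -> u x <= v) -> q s <= v.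
  move=> s01 H; apply: ge_sup; first by case: (hE s s01).
  by move=> _ [x [x0 xs Nx] ->]; exact: H.
exists q; split.
- move=> s t; rewrite !in_itv/= => s01 t01 st; apply: qleast => // x x0 xs Nx.
  by apply: qub => //; exact: le_trans st.
- exists N; split => // s /= /not_implyP[s01 us]; apply: contrapT => Ns; apply: us.
  have /andP[s0 s1] := s01.
  apply/eqP; rewrite eq_le qub//= ?lexx//; apply: qleast => // x x0 xs Nx.
  by move: xs; rewrite le_eqVlt => /predU1P[->//|xs]; exact: mono.
- move=> c c0 H s1 s2 s10 s12 s21.
  have s101 : 0 < s1 < 1 by apply/andP; split; lra.
  have s201 : 0 < s2 < 1 by apply/andP; split; lra.
  apply/ler_addgt0Pr => e e0; rewrite lerBlDr.
  apply: qleast => // x x0 xs Nx.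
  have [xs1|xs1] := leP x s1.
    have h1 := qub s1 x s101 x0 xs1 Nx.
    have : 0 <= c * (s2 - s1) by rewrite mulr_ge0// subr_ge0 ltW.
    lra.
  have c1 : 0 < c + 1 by rewrite ltr_wpDl.
  have ec : 0 < e / (c + 1) by rewrite divr_gt0.
  have [y [/andP[y1 y2] Ny]] := dense (Num.max 0 (s1 - e / (c + 1))) s1
    ltac:(by rewrite gt_max s10 gtrBl).
  move: y1; rewrite gt_max => /andP[y0 y1].
  have h1 := qub s1 y s101 y0 (ltW y2) Ny.
  have h2 : u x - u y <= c * (x - y).
    by apply: H => //; [exact: lt_trans xs1|exact: le_lt_trans s21].
  have h3 : c * (x - y) <= c * (s2 - s1) + c * (e / (c + 1)).
    by rewrite -mulrDr ler_wpM2l//; lra.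
  have h4 : c * (e / (c + 1)) <= e.
    by rewrite mulrA ler_pdivrMr// mulrC ler_pM2l// lerDl.
  lra.
Qed.

(** Left limits are determined on the complement of a null set, so the
    left-continuous representative agrees everywhere with a continuous one. *)
Lemma lc_representative_of (u : L2 R) q c : nondecreasing01 q -> lipschitz01 c q ->
  {ae leb, forall s, 0 < s < 1 -> u s = q s} ->
  nondecreasing01 (lc u) /\ forall s, 0 < s < 1 -> lc u s = q s.
Proof.
move=> mq lq uq.
have qrep : lc_representative u q.
  split => //; last exact/ae_Leb01.
  by move=> s s01; apply: cvg_at_left_filter; exact: (lipschitz01_continuous mq lq).
have [mlc lclc aelc] : lc_representative u (lc u).
  exact: (xgetPex (cst 0) (ex_intro _ q qrep)).
split => // s s01; have /andP[s0 s1] := s01.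
have /ae_Leb01[N [mN N0 hN]] := aelc.
have [M [mM M0 hM]] := uq.
have mNM : measurable (N `|` M) by exact: measurableU.
have NM0 : leb (N `|` M) = 0%E.
  have : (leb (N `|` M) <= leb N + leb M)%E by exact: measureU2.
  by rewrite N0 M0 adde0 measure_le0 => /eqP.
have dense x y := @exists_notin_null (N `|` M) x y mNM NM0.
have eqNM z : 0 < z < 1 -> ~ (N `|` M) z -> lc u z = q z.
  move=> z01 /not_orP[Nz Mz].
  have -> : q z = u z.
    by apply/esym; apply: contrapT => h; apply: Mz; apply: hM => /= /(_ z01).
  by apply/esym; apply: contrapT => h; apply: Nz; apply: hN => /= /(_ z01).
have c1 : lc u x @[x --> s^'-] --> lc u s by exact: lclc.
have c2 : q x @[x --> s^'-] --> q s by case: qrep => _ + _; exact.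
apply: contrapT => /eqP ne.
pose e := `|lc u s - q s| / 2.
have e0 : 0 < e by rewrite divr_gt0// normr_gt0 subr_eq0.
have /cvgrPdist_lt/(_ _ e0) n1 := c1.
have /cvgrPdist_lt/(_ _ e0) n2 := c2.
have : \forall z \near s^'-, `|lc u s - lc u z| < e /\ `|q s - q z| < e.
  exact: filterI n1 n2.
rewrite near_withinE => /nbhs_ballP[d /= d0 H].
have [z [/andP[z1 z2] Nz]] := dense (Num.max 0 (s - d)) s
  ltac:(by rewrite gt_max s0 gtrBl).
move: z1; rewrite gt_max => /andP[z0 z1].
have := H z; rewrite /ball/= gtr0_norm ?subr_gt0// => /(_ ltac:(lra) z2)[].
have z01 : 0 < z < 1 by rewrite z0 (lt_trans z2).
rewrite (eqNM z z01 Nz).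
move=> h1 h2.
have : `|lc u s - q s| <= `|lc u s - q z| + `|q s - q z|.
  by rewrite (distrC (q s)) (le_trans _ (ler_normD _ _))// addrA subrK.
rewrite /e in h1 h2; lra.
Qed.

End representative.

(** * Estimates along the flow *)

Section exponential_barrier.
Context {R : realType}.
Implicit Types (A C k s t eps : R).

Lemma exp_lipschitz A C k s t : 0 <= k -> 0 <= s -> 0 <= t ->
  `|(A + C * expR (- (k * t))) - (A + C * expR (- (k * s)))| <= `|C| * k * `|t - s|.
Proof.
move=> k0 s0 t0.
have key x y : 0 <= x -> x <= y -> `|expR (- (k * x)) - expR (- (k * y))| <= k * (y - x).
  move=> x0 xy.
  have kx : 0 <= k * x by rewrite mulr_ge0.
  have kxy : 0 <= k * (y - x) by rewrite mulr_ge0// subr_ge0.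
  have -> : - (k * y) = - (k * x) + - (k * (y - x)) by ring.
  rewrite expRD -[X in `|X - _|]mulr1 -mulrBr normrM ger0_norm ?expR_ge0//.
  have e1 : expR (- (k * x)) <= 1 by rewrite -expR0 ler_expR oppr_le0.
  have e2 : expR (- (k * (y - x))) <= 1 by rewrite -expR0 ler_expR oppr_le0.
  rewrite ger0_norm ?subr_ge0//.
  have := expR_ge1Dx (- (k * (y - x))) => e3.
  rewrite (@le_trans _ _ (1 * (1 - expR (- (k * (y - x))))))//.
    by rewrite ler_wpM2r ?subr_ge0.
  by rewrite mul1r; lra.
have -> : A + C * expR (- (k * t)) - (A + C * expR (- (k * s))) =
  C * (expR (- (k * t)) - expR (- (k * s))) by ring.
rewrite normrM -mulrA ler_wpM2l//.
have [st|/ltW ts] := leP s t.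
  by rewrite distrC (ger0_norm (_ : 0 <= t - s)) ?subr_ge0// key.
by rewrite (distrC t s) (ger0_norm (_ : 0 <= s - t)) ?subr_ge0// key.
Qed.

(** Since [expR x >= 1 + x], the remainder of [expR (- x)] lies between 0 and
    [1 / (1 + x) - 1 + x], which is at most [x ^+ 2]. *)
Lemma exp_derivative A C k t eps : 0 <= k -> 0 <= t -> 0 < eps ->
  exists2 eta, 0 < eta & forall h, 0 < h < eta ->
    `|(A + C * expR (- (k * (t + h)))) - (A + C * expR (- (k * t)))
      - h * (- (C * k * expR (- (k * t))))| <= eps * h.
Proof.
move=> k0 t0 eps0.
pose q := `|C| * k ^+ 2 + 1.
have q0 : 0 < q by rewrite ltr_wpDl// mulr_ge0// sqr_ge0.
exists (eps / q); first by rewrite divr_gt0.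
move=> h /andP[h0 hq].
set f := expR (- (k * t)).
have f0 : 0 <= f by exact: expR_ge0.
have f1 : f <= 1 by rewrite /f -expR0 ler_expR oppr_le0 mulr_ge0.
have kh0 : 0 <= k * h by rewrite mulr_ge0// ltW.
have -> : - (k * (t + h)) = - (k * t) + - (k * h) by ring.
rewrite expRD -/f; set e := expR (- (k * h)).
have -> : A + C * (f * e) - (A + C * f) - h * - (C * k * f) = C * (f * (e - 1 + k * h)) by ring.
have e1 : 0 <= e - 1 + k * h by have := expR_ge1Dx (- (k * h)); rewrite -/e; lra.
have e2 : e - 1 + k * h <= (k * h) ^+ 2.
  have d : 0 < 1 + k * h by rewrite ltr_pwDl.
  have : e * (1 + k * h) <= 1.
    rewrite /e expRN ler_pdivrMl ?expR_gt0// mulr1; exact: expR_ge1Dx.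
  rewrite -(ler_pM2r d); nra.
rewrite !normrM (ger0_norm f0) (ger0_norm e1).
have h1 : f * (e - 1 + k * h) <= 1 * (k * h) ^+ 2 by rewrite ler_pM.
rewrite (le_trans (ler_wpM2l (normr_ge0 C) h1))// mul1r exprMn.
have : h * q <= eps by rewrite -ler_pdivlMr// ltW.
have h2 : `|C| * (k ^+ 2 * h ^+ 2) <= h * q * h.
  have : 0 <= h ^+ 2 by exact: sqr_ge0.
  by rewrite /q expr2; nra.
move=> h3; rewrite (le_trans h2)// ler_pM2r//.
Qed.
End exponential_barrier.

Section flow.
Context {R : realType}.
Local Notation leb := (@lebesgue_measure R).
Local Notation I01 := (`]0%R, 1%R[%classic : set (measurableTypeR R)).

Section propagation.
Variables (G : L2 R -> R) (q0 : R -> R) (g : R -> L2 R).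
Hypothesis sol : strong_solution G q0 g.

Lemma pos_mul_le0 (u v : L2 R) s : 0 < s < 1 -> (0 < u s -> v s <= 0) ->
  pos u s * v s <= 0.
Proof.
move=> s01 uv; rewrite pos_valE//; have [us|us] := leP (u s) 0; first by rewrite mul0r.
by rewrite pmulr_rle0// uv.
Qed.

Lemma ae_pos_eq0 (u : L2 R) : {ae leb, forall s, 0 < s < 1 -> u s <= 0} ->
  nrm (pos u) = 0.
Proof.
move=> H; rewrite nrm_eq_sqrt.
suff : inner (pos u) (pos u) <= inner 0 0.
  by rewrite inner0l => h; apply/eqP; rewrite sqrtr_eq0.
apply: ae_le_inner; apply: ae_imp H => s H s01.
by rewrite pos_valE// max_l ?H// !mul0r.
Qed.

(** Linear one-sided constraints on [al * g(t, s + h) - be * g(t, s)]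
    propagate in time as soon as the velocity points inwards wherever they
    are violated. *)
Lemma constraint_propagates al be h (A C k : R) : 0 <= h < 1 -> 0 <= k ->
  (forall s, 0 < s -> s < 1 - h -> al * q0 (s + h) - be * q0 s <= A + C) ->
  (forall t d, 0 < t -> subdifferential G (g t) (- d) ->
    {ae leb, forall s, 0 < s -> s < 1 - h ->
       A + C * expR (- (k * t)) < al * g t (s + h) - be * g t s ->
       al * d (s + h) - be * d s <= - (C * k * expR (- (k * t)))}) ->
  forall t, 0 <= t -> {ae leb, forall s, 0 < s -> s < 1 - h ->
     al * g t (s + h) - be * g t s <= A + C * expR (- (k * t))}.
Proof.
move=> h01 k0 init dyn.
have /andP[h0 h1] := h01.
pose c t := A + C * expR (- (k * t)).
pose c' t := - (C * k * expR (- (k * t))).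
have mA : measurable (`]0, 1 - h[%classic : set (measurableTypeR R)).
  exact: measurable_itv.
have [e eE] := exists_L2_indic mA.
have e_in s : 0 < s -> s < 1 - h -> e s = 1.
  move=> s0 s1; rewrite eE; last by apply/andP; split; lra.
  by rewrite indicE mem_set//=; apply/andP.
have e_out s : 0 < s < 1 -> 1 - h <= s -> e s = 0.
  move=> s01 s1; rewrite eE// indicE memNset//= => sA.
  by have /andP[_] : 0 < s < 1 - h := sA; rewrite ltNge s1.
pose w t := diffop al be h01 (g t) - c t *: e.
have w_in t s : 0 < s -> s < 1 - h -> w t s = al * g t (s + h) - be * g t s - c t.
  move=> s0 s1.
  suff : diffop al be h01 (g t) s - c t * e s = al * g t (s + h) - be * g t s - c t by [].
  by rewrite diffopE// e_in// mulr1.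
have w_out t s : 0 < s < 1 -> 1 - h <= s -> w t s = 0.
  move=> s01 s1.
  suff : diffop al be h01 (g t) s - c t * e s = 0 by [].
  by rewrite diffop0// e_out// mulr0 subr0.
have bar : forall t, 0 <= t -> nrm (pos (w t)) = 0.
  apply: (barrier_solution sol (P := diffop al be h01) (K := `|al| + `|be|)
    (c := c) (c' := c') (kappa := `|C| * k) (e := e)).
  - by rewrite addr_ge0.
  - by rewrite mulr_ge0.
  - exact: diffop_bounded.
  - by move=> s t s0 t0; exact: exp_lipschitz.
  - by move=> t eps t0 eps0; apply: exp_derivative => //; exact: ltW.
  - move=> t d t0 sub; rewrite -(inner0l 0); apply: ae_le_inner.
    have := dyn t d t0 sub; apply: ae_imp => s H s01.
    have /andP[s0 s1] := s01.
    apply: (@le_trans _ _ 0); last exact: (mulr_ge0 (lexx 0) (lexx 0)).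
    apply: pos_mul_le0 => // ws.
    have [sh|sh] := ltP s (1 - h); last first.
      by have := w_out t s s01 sh; rewrite /w => E0; rewrite E0 ltxx in ws.
    suff : diffop al be h01 d s - c' t * e s <= 0 by [].
    rewrite diffopE// e_in// mulr1 subr_le0; apply: H => //.
    have ws' : 0 < w t s := ws.
    by move: ws'; rewrite w_in// subr_gt0.
  - have [_ _ /ae_Leb01 g0 _] := sol.
    apply: ae_pos_eq0; have := ae_and g0 (ae_translation h g0).
    apply: ae_imp => s [g1 g2] s01; have /andP[s0 s1] := s01.
    suff : w 0 s <= 0 by [].
    have [sh|sh] := ltP s (1 - h); last by rewrite w_out.
    rewrite w_in// g1// g2; last by apply/andP; split; lra.
    by rewrite subr_le0 /c mulr0 oppr0 expR0 mulr1 init.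
move=> t t0; have := ae_le0_pos (bar t t0); apply: ae_imp => s H s0 s1.
have s01 : 0 < s < 1 by apply/andP; split; lra.
by have := H s01; rewrite w_in// subr_le0.
Qed.
End propagation.

Section dynamics.
Variables (Q q0 : R -> R) (a b L L0 : R) (g : R -> L2 R).
Hypotheses (mQ : nondecreasing01 Q) (lQ : lipschitz01 L Q)
  (Qab : forall t, 0 < t < 1 -> a <= Q t <= b)
  (Qa : forall z, a < z -> exists t, 0 < t < 1 /\ Q t < z)
  (Qb : forall z, z < b -> exists t, 0 < t < 1 /\ z < Q t)
  (mq0 : nondecreasing01 q0) (lq0 : lipschitz01 L0 q0)
  (q0ab : forall t, 0 < t < 1 -> a <= q0 t <= b)
  (sol : strong_solution (energy Q) q0 g).

Lemma measurable_lipschitz01 c (q : R -> R) : nondecreasing01 q -> lipschitz01 c q ->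
  measurable_fun I01 (q : measurableTypeR R -> R).
Proof.
move=> mq lq; apply: open_continuous_measurable_fun; first exact: interval_open.
by move=> x; rewrite inE/= in_itv/=; exact: (lipschitz01_continuous mq lq).
Qed.

Let meQ := measurable_lipschitz01 mQ lQ.

(** With [- d] in the subdifferential, the pointwise inequality says that
    [2 s - 1 - d s] is a subgradient of the potential. *)
Lemma velocity_subgradient u d : subdifferential (energy Q) u (- d) ->
  {ae leb, forall s, 0 < s < 1 -> forall z : rat,
    pot Q (ratr z) - pot Q (u s) >= (2 * s - 1 - d s) * (ratr z - u s)}.
Proof.
move=> /(pointwise_subdifferential_rat meQ Qab); apply: ae_imp => s H s01 z.
have := H s01 z.
have -> : (- d) s = - d s by [].
lra.
Qed.

Let ae_velocity_shift u d h : subdifferential (energy Q) u (- d) -> 0 <= h < 1 ->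
  {ae leb, forall s, 0 < s -> s < 1 - h ->
    (forall z : rat, pot Q (ratr z) - pot Q (u s) >= (2 * s - 1 - d s) * (ratr z - u s)) /\
    (forall z : rat, pot Q (ratr z) - pot Q (u (s + h)) >=
       (2 * (s + h) - 1 - d (s + h)) * (ratr z - u (s + h)))}.
Proof.
move=> /velocity_subgradient sub /andP[h0 h1].
have := ae_and sub (ae_translation h sub); apply: ae_imp => s [H1 H2] s0 s1; split.
  by apply: H1; apply/andP; split; lra.
by apply: H2; apply/andP; split; lra.
Qed.

(** Above [b] the subgradient is at least 1, so the velocity is at most
    [2 s - 2]. *)
Lemma flow_le t : 0 <= t -> {ae leb, forall s, 0 < s < 1 -> g t s <= b}.
Proof.
move=> t0.
have h01 : 0 <= (0 : R) < 1 by rewrite lexx ltr01.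
have := @constraint_propagates _ _ _ sol 1 0 0 b 0 0 h01 (lexx 0).
move=> /(_ _ _ t t0) H.
apply: ae_imp (H _ _) => [s + /andP[s0 s1]||].
- rewrite subr0 => /(_ s0 s1); rewrite addr0; lra.
- move=> s s0; rewrite subr0 addr0 => s1.
  have /q0ab/andP[_] : 0 < s < 1 by rewrite s0.
  lra.
- move=> r d r0 /ae_velocity_shift/(_ h01); apply: ae_imp => s + s0 s1.
  move=> /(_ s0 s1)[H1 _]; rewrite addr0 => lt.
  have bg : b < g r s by lra.
  have := subgradient_above meQ Qab bg H1.
  move: s1; rewrite subr0; lra.
Qed.

(** Below [a] the subgradient is at most [-1], so the velocity is at least
    [2 s]. *)
Lemma flow_ge t : 0 <= t -> {ae leb, forall s, 0 < s < 1 -> a <= g t s}.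
Proof.
move=> t0.
have h01 : 0 <= (0 : R) < 1 by rewrite lexx ltr01.
have := @constraint_propagates _ _ _ sol 0 1 0 (- a) 0 0 h01 (lexx 0).
move=> /(_ _ _ t t0) H.
apply: ae_imp (H _ _) => [s + /andP[s0 s1]||].
- rewrite subr0 => /(_ s0 s1); rewrite addr0; lra.
- move=> s s0; rewrite subr0 addr0 => s1.
  have /q0ab/andP[+ _] : 0 < s < 1 by rewrite s0.
  lra.
- move=> r d r0 /ae_velocity_shift/(_ h01); apply: ae_imp => s + s0 s1.
  move=> /(_ s0 s1)[H1 _]; rewrite addr0 => lt.
  have ga : g r s < a by lra.
  have := subgradient_below meQ Qab ga H1.
  lra.
Qed.

(** Where [g] decreases from [s] to [s + h], the velocity at [s + h] exceeds the
    one at [s] by at least [2 h]. *)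
Lemma flow_mono t h : 0 <= t -> 0 < h < 1 ->
  {ae leb, forall s, 0 < s -> s < 1 - h -> g t s <= g t (s + h)}.
Proof.
move=> t0 /andP[h0 h1].
have h01 : 0 <= h < 1 by rewrite ltW.
have := @constraint_propagates _ _ _ sol (-1) (-1) h 0 0 0 h01 (lexx 0).
move=> /(_ _ _ t t0) H.
apply: ae_imp (H _ _) => [s + s0 s1||].
- move=> /(_ s0 s1); lra.
- move=> s s0 s1.
  have : q0 s <= q0 (s + h) by apply: mq0; rewrite ?in_itv/=; lra.
  lra.
- move=> r d r0 /ae_velocity_shift/(_ h01); apply: ae_imp => s + s0 s1.
  move=> /(_ s0 s1)[H1 H2] lt.
  have gg : g r (s + h) < g r s by lra.
  have := subgradient_mono meQ Qab gg H1 H2.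
  lra.
Qed.

(** The right-hand side [c] solves [c' = 2 h - (2 / L) c], and an increment
    [w > c] has velocity at most [2 h - (2 / L) w]. *)
Lemma flow_lip t h : 0 < L -> 0 <= t -> 0 < h < 1 ->
  {ae leb, forall s, 0 < s -> s < 1 - h ->
     g t (s + h) - g t s <= (L + (L0 - L) * expR (- (2 / L * t))) * h}.
Proof.
move=> Lp t0 /andP[h0 h1].
have h01 : 0 <= h < 1 by rewrite ltW.
have L20 : 0 <= 2 / L by rewrite divr_ge0// ltW.
have := @constraint_propagates _ _ _ sol 1 1 h (L * h) ((L0 - L) * h) (2 / L) h01 L20.
move=> /(_ _ _ t t0) H.
apply: ae_imp (H _ _) => [s + s0 s1||].
- move=> /(_ s0 s1); lra.
- move=> s s0 s1.
  have : q0 (s + h) - q0 s <= L0 * (s + h - s) by apply: lq0; lra.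
  lra.
- move=> r d r0 /ae_velocity_shift/(_ h01) sub.
  have gle := flow_le (ltW r0); have gge := flow_ge (ltW r0).
  have := ae_and sub (ae_and gge (ae_translation h gle)).
  apply: ae_imp => s [+ [ge le]] s0 s1 => /(_ s0 s1)[H1 H2].
  have {}ge := ge ltac:(by rewrite s0 (lt_trans s1)// gtrBl).
  have {}le := le ltac:(by rewrite addr_gt0//= -ltrBrDr).
  set E := expR _; rewrite !mul1r => lt.
  have c0 : 0 <= L + (L0 - L) * E.
    have E0 : 0 <= E by exact: expR_ge0.
    have kr : 0 <= 2 / L * r := mulr_ge0 L20 (ltW r0).
    have E1 : E <= 1 by rewrite /E -[leRHS]expR0 ler_expR oppr_le0.
    have := lipschitz01_ge0 mq0 lq0; nra.
  have gg : g r s < g r (s + h).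
    have : 0 <= (L + (L0 - L) * E) * h by rewrite mulr_ge0// ltW.
    lra.
  have := subgradient_strong_mono meQ Qab mQ lQ Qa Qb ge gg le H2 H1.
  move=> sm.
  have -> : - ((L0 - L) * h * (2 / L) * E) = (2 * L * h - 2 * (L * h + (L0 - L) * h * E)) / L.
    by field; rewrite gt_eqF.
  rewrite ler_pdivlMr//; lra.
Qed.
End dynamics.
End flow.

(** * Conclusion *)

Section flow_representative.
Context {R : realType}.
Local Notation leb := (@lebesgue_measure R).
Local Notation I01 := (`]0%R, 1%R[%classic : set (measurableTypeR R)).
Variables (Q q0 : R -> R) (a b L L0 : R) (g : R -> L2 R).
Hypotheses (mQ : nondecreasing01 Q) (lQ : lipschitz01 L Q)
  (Qab : forall t, 0 < t < 1 -> a <= Q t <= b)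
  (Qa : forall z, a < z -> exists t, 0 < t < 1 /\ Q t < z)
  (Qb : forall z, z < b -> exists t, 0 < t < 1 /\ z < Q t)
  (mq0 : nondecreasing01 q0) (lq0 : lipschitz01 L0 q0)
  (q0ab : forall t, 0 < t < 1 -> a <= q0 t <= b)
  (sol : strong_solution (energy Q) q0 g).

(** The real number that [Lip_bound] denotes for finite arguments; [2 / L] would
    vanish for [L = 0], whereas the decay rate is then infinite. *)
Definition flow_lip_constant (L0 L t : R) : R :=
  if L == 0 then 0 else L + (L0 - L) * expR (- (2 / L * t)).

Let L_ge0 : 0 <= L := lipschitz01_ge0 mQ lQ.

Lemma flow_lip_constant_ge0 t : 0 <= t -> 0 <= flow_lip_constant L0 L t.
Proof.
move=> t0; rewrite /flow_lip_constant; case: ifPn => // Ln0.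
have Lp : 0 < L by rewrite lt_neqAle eq_sym Ln0.
have kt : 0 <= 2 / L * t by rewrite mulr_ge0// divr_ge0.
have E0 : 0 <= expR (- (2 / L * t)) by exact: expR_ge0.
have E1 : expR (- (2 / L * t)) <= 1 by rewrite -[leRHS]expR0 ler_expR oppr_le0.
have := lipschitz01_ge0 mq0 lq0; nra.
Qed.

(** If [Q] is constant, the constraint [a <= g <= b] pins [g] down. *)
Let degenerate : L = 0 -> b <= a.
Proof.
move=> L00; rewrite leNgt; apply/negP => ab.
pose m := (a + b) / 2.
have am : a < m by rewrite /m; lra.
have mb : m < b by rewrite /m; lra.
have [t1 [t101 h1]] := Qa am.
have [t2 [t201 h2]] := Qb mb.
have := lipschitz01_dist mQ lQ t201 t101.
rewrite L00 mul0r normr_le0 subr_eq0 => /eqP E.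
by rewrite E in h2; have := lt_trans h1 h2; rewrite ltxx.
Qed.

Let flow_increment t h : 0 <= t -> 0 < h < 1 ->
  {ae leb, forall s, 0 < s -> s < 1 - h ->
     g t (s + h) - g t s <= flow_lip_constant L0 L t * h}.
Proof.
move=> t0 h01; rewrite /flow_lip_constant; case: ifPn => [/eqP L00|Ln0].
  have ba := degenerate L00.
  have gle := flow_le mQ lQ Qab q0ab sol t0.
  have gge := flow_ge mQ lQ Qab q0ab sol t0.
  have := ae_and gge (ae_translation h gle).
  apply: ae_imp => s [ge le] s0 s1; have /andP[h0 h1] := h01.
  have {}ge := ge ltac:(by rewrite s0 (lt_trans s1)// gtrBl).
  have {}le := le ltac:(by rewrite addr_gt0//= -ltrBrDr).
  lra.
have Lp : 0 < L by rewrite lt_neqAle eq_sym Ln0.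
exact: (flow_lip mQ lQ Qab Qa Qb mq0 lq0 q0ab sol).
Qed.

Lemma flow_representative t : 0 <= t -> exists q,
  [/\ nondecreasing01 q, lipschitz01 (flow_lip_constant L0 L t) q &
   {ae leb, forall s, 0 < s < 1 -> g t s = q s}].
Proof.
move=> t0.
have mono h : 0 < h < 1 -> {ae leb, forall s, 0 < s -> s < 1 - h ->
    (- g t) (s + h) - (- g t) s <= 0 * h}.
  move=> h01; have := flow_mono mQ lQ Qab mq0 sol t0 h01.
  apply: ae_imp => s H s0 s1; have {}H := H s0 s1.
  by suff : - g t (s + h) - - g t s <= 0 * h by []; lra.
have [N1 [mN1 N10 H1]] := ae_increment mono.
have [N2 [mN2 N20 H2]] := ae_increment (fun h => @flow_increment t h t0).
have mN : measurable (N1 `|` N2) by exact: measurableU.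
have N0 : leb (N1 `|` N2) = 0%E.
  have : (leb (N1 `|` N2) <= leb N1 + leb N2)%E by exact: measureU2.
  by rewrite N10 N20 adde0 measure_le0 => /eqP.
have mon s1 s2 : ~ (N1 `|` N2) s1 -> ~ (N1 `|` N2) s2 -> 0 < s1 -> s1 < s2 ->
    s2 < 1 -> g t s1 <= g t s2.
  move=> /not_orP[n1 _] /not_orP[n2 _] s10 s12 s21.
  have := H1 s1 s2 n1 n2 s10 s12 s21.
  have -> : (- g t) s2 = - g t s2 by [].
  have -> : (- g t) s1 = - g t s1 by [].
  lra.
have [q [mq uq lq]] := exists_nondecreasing mN N0 mon.
exists q; split => //; apply: lq; first exact: flow_lip_constant_ge0.
by move=> s1 s2 /not_orP[_ n1] /not_orP[_ n2]; exact: H2.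
Qed.
End flow_representative.

Section conclusion.
Context {R : realType}.
Local Notation leb := (@lebesgue_measure R).
Local Notation I01 := (`]0%R, 1%R[%classic : set (measurableTypeR R)).

Lemma flow_cdfE (u : L2 R) q c x : nondecreasing01 q -> lipschitz01 c q ->
  {ae leb, forall s, 0 < s < 1 -> u s = q s} ->
  flow_cdf u x = 1 - upper_mass q x.
Proof.
move=> mq lq uq.
have meq := measurable_lipschitz01 mq lq.
have mu : measurable_fun I01 (u : R -> R) by exact: L2_measurable_on.
pose A : set (measurableTypeR R) := I01 `&` u @^-1` `]-oo, x].
pose B : set (measurableTypeR R) := I01 `&` q @^-1` `]x, +oo[.
have mA : measurable A by apply: mu => //; exact: measurable_itv.
have mB : measurable B by apply: meq => //; exact: measurable_itv.
have -> : flow_cdf u x = fine (leb A).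
  by rewrite /flow_cdf /Rplus /pushforward /= /mrestr setIC.
have -> : upper_mass q x = fine (leb B).
  congr (fine (leb _)); apply/seteqP; split => t.
    by move=> [t01 xq]; split => //=; rewrite in_itv/= xq.
  by move=> [t01 /=]; rewrite in_itv/= andbT.
have [N [mN N0 hN]] := uq.
have fin (C : set (measurableTypeR R)) : measurable C -> C `<=` I01 -> leb C \is a fin_num.
  move=> mC CI; rewrite ge0_fin_numE//; apply: (@le_lt_trans _ _ 1%E); last exact: ltry.
  by rewrite -leb_oo01 le_measure ?inE.
pose A' : set (measurableTypeR R) := I01 `&` q @^-1` `]-oo, x].
have mA' : measurable A' by apply: meq => //; exact: measurable_itv.
have AA' : leb A = leb A'.
  have le (C D : set (measurableTypeR R)) : measurable C -> measurable D ->
      C `<=` D `|` N -> (leb C <= leb D)%E.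
    move=> mC mD CD; apply: (@le_trans _ _ (leb D + leb N)%E); last by rewrite N0 adde0.
    apply: le_trans (measureU2 _ mD mN).
    by rewrite le_measure ?inE//; exact: measurableU.
  have uqN s : I01 s -> ~ N s -> u s = q s.
    move=> sI Ns; have s01 : 0 < (s : R) < 1 := sI.
    by apply: contrapT => h; apply: Ns; apply: hN => /= /(_ s01).
  apply/eqP; rewrite eq_le !le//.
  - move=> s [sI qs]; have [?|Ns] := pselect (N s); first by right.
    by left; split => //=; rewrite uqN.
  - move=> s [sI us]; have [?|Ns] := pselect (N s); first by right.
    by left; split => //=; rewrite -uqN.
have AB : (leb A' + leb B = 1)%E.
  rewrite -measureU//; last first.
    apply/seteqP; split => // s [[_ /= +] [_ /=]].
    by rewrite !in_itv/= andbT => h1 h2; have := le_lt_trans h1 h2; rewrite ltxx.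
  rewrite -leb_oo01; congr (leb _); apply/seteqP; split => s.
    by move=> [[]|[]].
  move=> sI; have [qx|qx] := leP (q s) x; [left|right]; split => //=;
    by rewrite in_itv/= ?andbT.
have A'I : A' `<=` I01 by exact: subIsetl.
have BI : B `<=` I01 by exact: subIsetl.
rewrite AA'; apply/eqP; rewrite eq_sym subr_eq; apply/eqP.
by rewrite -fineD ?fin// AB.
Qed.

(** Points of the closure can be approached by levels [z] with
    [0 < flow_cdf u z < 1], so all levels strictly between [y] and [x] are taken
    by [q], and [upper_mass_strict] applies to [q]. *)
Lemma flow_cdf_lower_slope (u : L2 R) q c x y : nondecreasing01 q -> lipschitz01 c q ->
  {ae leb, forall s, 0 < s < 1 -> u s = q s} ->
  closure (flow_cdf u @^-1` `]0, 1[%classic) x ->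
  closure (flow_cdf u @^-1` `]0, 1[%classic) y -> y < x ->
  x - y <= c * (flow_cdf u x - flow_cdf u y).
Proof.
move=> mq lq uq clx cly yx.
have meq := measurable_lipschitz01 mq lq.
have E z := flow_cdfE z mq lq uq.
have qhigh z : z < x -> exists t, 0 < t < 1 /\ z < q t.
  move=> zx.
  have [x' [/= /andP[_ F1] x'z]] := clx (`]z, +oo[%classic) ltac:(
    by apply: open_nbhs_nbhs; split; [exact: interval_open|rewrite /= in_itv/= zx]).
  apply: contrapT => nt; move: F1; rewrite bnd_simp E.
  rewrite /upper_mass (_ : [set _ | _] = set0) ?measure0/= ?subr0 ?ltxx//.
  apply/seteqP; split => // t [t01 xt]; apply: nt; exists t; split => //.
  by apply: lt_trans xt; move: x'z; rewrite /= in_itv/= andbT.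
have qlow z : y < z -> exists t, 0 < t < 1 /\ q t < z.
  move=> yz.
  have [y' [/= /andP[F0 _] y'z]] := cly (`]-oo, z[%classic) ltac:(
    by apply: open_nbhs_nbhs; split; [exact: interval_open|rewrite /= in_itv/= yz]).
  apply: contrapT => nt; move: F0; rewrite bnd_simp E.
  rewrite /upper_mass (_ : [set _ | _] = I01) ?leb_oo01/= ?subrr ?ltxx//.
  apply/seteqP; split => [t []//|t It]; have t01 : 0 < (t : R) < 1 := It; split => //.
  rewrite ltNge; apply/negP => qt; apply: nt; exists t; split => //.
  by apply: (le_lt_trans qt); move: y'z; rewrite /= in_itv.
have c0 := lipschitz01_ge0 mq lq.
apply/ler_addgt0Pr => e e0.
pose d := Num.min (e / 4) ((x - y) / 4).
have d0 : 0 < d by rewrite lt_min !divr_gt0// subr_gt0.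
have dxy : d <= (x - y) / 4 by rewrite ge_min lexx orbT.
have de : d <= e / 4 by rewrite ge_min lexx.
have [t1 [t101 q1]] := qlow (y + d) ltac:(by rewrite ltrDl).
have [t2 [t201 q2]] := qhigh (x - d) ltac:(by rewrite gtrBl).
have zz : y + d < x - d by lra.
have h := upper_mass_strict meq mq lq t101 t201 q1 zz q2.
have yd : y < y + d by rewrite ltrDl.
have xd : x - d < x by rewrite gtrBl.
have h1 := upper_mass_cl_le meq yd.
have h2 : upper_mass q x <= upper_mass q (x - d).
  exact: le_trans (upper_mass_mono meq (lexx x)) (upper_mass_cl_le meq xd).
have h3 : c * (upper_mass_cl q (y + d) - upper_mass q (x - d)) <=
    c * (flow_cdf u x - flow_cdf u y).
  by rewrite ler_wpM2l// !E; lra.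
lra.
Qed.

(** For [c = 0] the previous estimate excludes pairs of distinct points, and the
    inverse of [c] is infinite. *)
Lemma L_low_flow_cdf (u : L2 R) q c : nondecreasing01 q -> lipschitz01 c q ->
  {ae leb, forall s, 0 < s < 1 -> u s = q s} ->
  (c%:E^-1 <= L_low (flow_cdf u))%E.
Proof.
move=> mq lq uq; have c0 := lipschitz01_ge0 mq lq.
apply: ereal_sup_ubound; split; first by rewrite inve_ge0 lee_fin.
have key x y : closure (flow_cdf u @^-1` `]0, 1[%classic) x ->
    closure (flow_cdf u @^-1` `]0, 1[%classic) y -> y < x ->
    (c%:E^-1 <= (slope (flow_cdf u) x y)%:E)%E.
  move=> clx cly yx.
  have h := flow_cdf_lower_slope mq lq uq clx cly yx.
  have xy : 0 < x - y by rewrite subr_gt0.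
  have cn0 : c != 0 by apply: contraTneq h => ->; rewrite mul0r -ltNge.
  have cp : 0 < c by rewrite lt_neqAle eq_sym cn0.
  rewrite inver (negbTE cn0) lee_fin /slope ler_pdivlMr// mulrC ler_pdivrMr//.
  by rewrite mulrC.
move=> x y clx cly ne; have [xy|yx|E] := ltgtP x y; last by rewrite E eqxx in ne.
  have -> : slope (flow_cdf u) x y = slope (flow_cdf u) y x.
    by rewrite /slope -mulrNN -invrN !opprB.
  exact: key.
exact: key.
Qed.

Lemma Lip_boundE (L0 L t : R) : 0 <= L -> 0 < t ->
  Lip_bound L0%:E L%:E t = (flow_lip_constant L0 L t)%:E.
Proof.
move=> L_ge0 t0; rewrite /Lip_bound /decay /flow_lip_constant inver.
have [->|Ln0] := eqVneq L 0.
  rewrite mul0e adde0.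
  have -> : (- (2 * t)%:E * +oo = -oo)%E.
    by rewrite -EFinN mulry ltr0_sg ?oppr_lt0 ?mulr_gt0// mulN1e.
  by rewrite /= mule0.
rewrite -EFinN -EFinM /= -EFinB -!EFinM -EFinD; congr EFin.
have -> : - (2 * t) / L = - (2 / L * t) by ring.
ring.
Qed.

End conclusion.

Theorem theorem6p7 (R : realType)
    (nu mu0 : probability (measurableTypeR R) R) (a b : R) (g : R -> L2 R)
    (nu_P2 : P2 nu)
    (supp_nu : supp nu = `[a, b]%classic)
    (Lip_nu : (Lip (quantile nu) < +oo)%E)
    (mu0_P2 : P2 mu0)
    (supp_mu0_convex : convex_set (supp mu0 : set R^o))
    (supp_mu0 : supp mu0 `<=` `[a, b]%classic)
    (Lip_mu0 : (Lip (quantile mu0) < +oo)%E)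
    (g_sol : strong_solution (F nu) (quantile mu0) g) :
  (forall t, 0 <= t -> quantile_cone (g t)) /\
  forall t, 0 < t ->
    let B := Lip_bound (Lip (quantile mu0)) (Lip (quantile nu)) t in
    [/\ (Lip (lc (g t)) <= B)%E, (B < +oo)%E,
        (B^-1 <= L_low (flow_cdf (g t)))%E & (0 < B^-1)%E].
Proof.
have [L L_ge0 [EL lQ]] := Lip_finite Lip_nu.
have [L0 L0_ge0 [EL0 lq0]] := Lip_finite Lip_mu0.
have supp_nu_ab : supp nu `<=` `[a, b]%classic by rewrite supp_nu.
have ab := supp_bounds_le supp_nu_ab.
have sa : supp nu a by rewrite supp_nu /= in_itv/= lexx.
have sb : supp nu b by rewrite supp_nu /= in_itv/= lexx andbT.
have rep := flow_representative (quantile_nondecreasing supp_nu_ab) lQ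
  (quantile_in supp_nu_ab) (fun z => quantile_low supp_nu_ab sa)
  (fun z => quantile_high supp_nu_ab sb)
  (quantile_nondecreasing supp_mu0) lq0 (quantile_in supp_mu0) g_sol.
split => [t t0|t t0 B].
  have [q [mq _ uq]] := rep t t0.
  by exists q; split => //; exact/ae_Leb01.
have [q [mq lq uq]] := rep t (ltW t0).
have c0 := lipschitz01_ge0 mq lq.
have -> : B = (flow_lip_constant L0 L t)%:E by rewrite /B EL EL0 Lip_boundE.
have [mlc lcq] := lc_representative_of mq lq uq.
split.
- apply: Lip_le => // s1 s2 s10 s12 s21.
  by rewrite !lcq; [exact: lq|apply/andP; split; lra..].
- exact: ltry.
- exact: L_low_flow_cdf lq uq.
- rewrite inver; case: ifPn => [_|cn0]; first exact: lt0y.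
  by rewrite lte_fin invr_gt0 lt_neqAle eq_sym cn0.
Qed.
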